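(* Let $\mathcal{P}$, $\mathcal{R}_1$, $\mathcal{R}_2$ and, for $K\in\mathcal{R}_1$, the functional $\Phi_K:\mathcal{P}\to\mathbb{R}$ be as defined in the context. (a) Consider a kernel $K:\mathbb{R}^3\to\mathbb{R}$ of the form $$K(x,y_0,y_1)=c\,y_0+K_0(x,y_1),\qquad(\ast)$$ where $c$ is a real constant and $K_0$ is a real function on $\mathbb{R}^2$. If $K\in\mathcal{R}_1$ and the functional $\Phi_K$ is concave, then the function $s:\mathbb{R}^4\to\mathbb{R}$ defined by $$s(x,y_0,y_1,y_2)=c\,y_0+K_0(x,y_1)-y_1\,\partial_1K_0(x,y_1)-\partial^2_{x1}K_0(x,y_1)-y_2\,\partial^2_{11}K_0(x,y_1)\qquad(\ast\ast)$$ represents a local score of order 2 that is proper relative to $\mathcal{P}$. (b) Conversely, if $s\in\mathcal{R}_2$ represents a local score of order 2 that is proper relative to $\mathcal{P}$, then there exists a kernel $K\in\mathcal{R}_1$ of the form $(\ast)$, where $c$ is a real constant and $K_0$ is a real function on $\mathbb{R}^2$, such that the functional $\Phi_K$ is concave and $s$ admits the representation $(\ast\ast)$. (c) Statements (a) and (b) remain valid with ''concave'' replaced by ''strictly concave'' and ''proper'' replaced by ''strictly proper''.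
   Context: The class $\mathcal{P}$ consists of all probability densities $p$ with respect to Lebesgue measure on $\mathbb{R}$ such that: (P1) $p$ is strictly positive on $\mathbb{R}$; (P2) $p$ admits four continuous derivatives on $\mathbb{R}$; (P3) for every $m>0$ and $j=0,1,\ldots,4$, $\lim_{x\to\pm\infty}|x|^m p^{(j)}(x)=0$; (P4) there is a constant $a=a(p)>0$ such that $\lim_{x\to\pm\infty}|x|^{-a}\,p^{(j)}(x)/p(x)=0$ for $j=1,\ldots,4$. This class is convex. For a nonnegative integer $k$, the class $\mathcal{R}_k$ consists of all functions $K:\mathbb{R}^{2+k}\to\mathbb{R}$, $K=K(x,y_0,\ldots,y_k)$, that admit continuous partial derivatives up to order $2k$ and for which there are finite positive constants $C,r$ such that, whenever $W$ is $K$ or any of its partial derivatives up to order $2k$, $|W(x,y_0,\ldots,y_k)|\le C\{(1+|x|)(1+|y_0|)\cdots(1+|y_k|)\}^r$ on $\mathbb{R}^{2+k}$. For $K\in\mathcal{R}_k$ (here $k=1$) and $p\in\mathcal{P}$, $\Phi_K(p)=\int_{\mathbb{R}}K(x,\ln p(x),(\ln p)'(x),\ldots,(\ln p)^{(k)}(x))\,p(x)\,dx$, which is finite. Concavity of $\Phi_K$ means concavity on the convex set $\mathcal{P}$; strict concavity means the concavity inequality is strict for distinct densities and mixing weight in $(0,1)$. Partial derivatives: $\partial_j=\partial/\partial y_j$, $\partial_x=\partial/\partial x$, $\partial^2_{xj}=\partial^2/(\partial x\,\partial y_j)$, $\partial^2_{ij}=\partial^2/(\partial y_i\,\partial y_j)$.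 A scoring rule for $\mathcal{P}$ is a function $S:\mathbb{R}\times\mathcal{P}\to[-\infty,\infty]$ such that, for every $q\in\mathcal{P}$, $S(\cdot,q)$ is Borel measurable and quasi-integrable with respect to $p(x)\,dx$ for every $p\in\mathcal{P}$. Put $S(p,q)=\int_{\mathbb{R}}S(x,q)p(x)\,dx$. $S$ is proper relative to $\mathcal{P}$ if $S(p,p)\le S(p,q)$ for all $p,q\in\mathcal{P}$; it is strictly proper if moreover equality holds if and only if $q=p$. A function $s$ on $\mathbb{R}^{2+k}$ represents a local score of order $k$ if $S(x,q)=s(x,\ln q(x),(\ln q)'(x),\ldots,(\ln q)^{(k)}(x))$, $x\in\mathbb{R}$, $q\in\mathcal{P}$, defines a scoring rule $S$ for $\mathcal{P}$; $s$ is said to be (strictly) proper if this $S$ is. *)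

(* Defs.v *)
From HB Require Import structures.
From mathcomp Require Import all_boot all_order all_algebra.
From mathcomp Require Import all_classical all_reals all_analysis.
From mathcomp Require Import measurable_realfun.

Set Implicit Arguments.
Unset Strict Implicit.
Unset Printing Implicit Defensive.

Import Order.TTheory GRing.Theory Num.Theory.
Import numFieldNormedType.Exports.

Local Open Scope classical_set_scope.
Local Open Scope ring_scope.

Definition prob_density (R : realType) (p : R -> R) : Prop :=
  [/\ measurable_fun setT p, (forall x, 0 <= p x) &
      (\int[lebesgue_measure]_x (p x)%:E = 1)%E].

(* derive1n is total, so the existence of the derivatives is asserted
   separately. *)
Definition cont_derivatives (R : realType) (n : nat) (f : R -> R) : Prop :=
  (forall j x, (j < n)%N -> derivable (derive1n j f) x 1) /\
  (forall j, (j <= n)%N -> continuous (derive1n j f)).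

Definition vanishes_at_infinity (R : realType) (f : R -> R) : Prop :=
  (f x @[x --> +oo] --> (0 : R)) /\ (f x @[x --> -oo] --> (0 : R)).

Definition classP (R : realType) : set (R -> R) :=
  [set p | [/\ prob_density p,
    forall x, 0 < p x,
    cont_derivatives 4 p,
    forall (m : R) (j : nat), 0 < m -> (j <= 4)%N ->
      vanishes_at_infinity (fun x => `|x| `^ m * derive1n j p x) &
    exists2 a : R, 0 < a & forall j : nat, (1 <= j <= 4)%N ->
      vanishes_at_infinity (fun x => `|x| `^ (- a) * (derive1n j p x / p x))]].

Arguments classP R _ : clear implicits.

Definition partial (R : realType) (n : nat) (i : 'I_n.+1)
    (f : 'rV[R]_n.+1 -> R) : 'rV[R]_n.+1 -> R :=
  fun v => 'D_(delta_mx 0 i) f v.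

(* partials [:: i1; ...; im] f differentiates f along im first and i1 last;
   partials [::] f is f. *)
Definition partials (R : realType) (n : nat) (s : seq 'I_n.+1)
    (f : 'rV[R]_n.+1 -> R) : 'rV[R]_n.+1 -> R :=
  foldr (@partial R n) f s.

Definition cont_partials (R : realType) (n m : nat)
    (f : 'rV[R]_n.+1 -> R) : Prop :=
  (forall (s : seq 'I_n.+1) (i : 'I_n.+1) (v : 'rV[R]_n.+1),
     (size s < m)%N -> derivable (partials s f) v (delta_mx 0 i)) /\
  (forall s : seq 'I_n.+1, (size s <= m)%N -> continuous (partials s f)).

(* A point (x, y_0, ..., y_k) of R^(2+k) is a row vector whose coordinate 0 is
   x and whose coordinate j.+1 is y_j. *)
Definition classR (R : realType) (k : nat) : set ('rV[R]_k.+2 -> R) :=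
  [set K | cont_partials (2 * k) K /\
    exists C r : R, [/\ 0 < C, 0 < r &
      forall (s : seq 'I_k.+2) (v : 'rV[R]_k.+2), (size s <= 2 * k)%N ->
        `|partials s K v| <= C * (\prod_(i < k.+2) (1 + `|v 0 i|)) `^ r]].

Arguments classR R k _ : clear implicits.

(* The vector (x, ln p(x), (ln p)'(x), ..., (ln p)^(k)(x)). *)
Definition jet (R : realType) (k : nat) (p : R -> R) (x : R) : 'rV[R]_k.+2 :=
  \row_(i < k.+2)
    if (i : nat) is j.+1 then derive1n j (fun t => ln (p t)) x else x.

(* The real-valued integral is legitimate for K in classR k and p in classP,
   where the integrand is integrable. *)
Definition Phi (R : realType) (k : nat) (K : 'rV[R]_k.+2 -> R) (p : R -> R) : R
  := \int[lebesgue_measure]_x (K (jet k p x) * p x).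

Arguments Phi {R} k K p.

Definition mixture (R : realType) (t : R) (p q : R -> R) : R -> R :=
  fun x => t * p x + (1 - t) * q x.

Definition concave_on (R : realType) (Q : set (R -> R))
    (F : (R -> R) -> R) : Prop :=
  forall (p q : R -> R) (t : R), Q p -> Q q -> 0 <= t <= 1 ->
    t * F p + (1 - t) * F q <= F (mixture t p q).

Definition strictly_concave_on (R : realType) (Q : set (R -> R))
    (F : (R -> R) -> R) : Prop :=
  forall (p q : R -> R) (t : R), Q p -> Q q -> p <> q -> 0 < t < 1 ->
    t * F p + (1 - t) * F q < F (mixture t p q).

(* The integral with respect to p(x)dx exists, possibly with an infinite
   value. *)
Definition quasi_integrable (R : realType) (p : R -> R) (f : R -> \bar R)
    : Prop :=
  (\int[lebesgue_measure]_x (f^\+ x * (p x)%:E) < +oo)%E \/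
  (\int[lebesgue_measure]_x (f^\- x * (p x)%:E) < +oo)%E.

(* Scoring rules S : R x classP -> [-oo, +oo] are given as functions of all
   q : R -> R; only their values for q in classP are ever constrained. *)
Definition scoring_rule (R : realType) (S : R -> (R -> R) -> \bar R) : Prop :=
  forall q, classP R q ->
    measurable_fun setT (S ^~ q) /\
    forall p, classP R p -> quasi_integrable p (S ^~ q).

Definition expected_score (R : realType) (S : R -> (R -> R) -> \bar R)
    (p q : R -> R) : \bar R :=
  (\int[lebesgue_measure]_x (S x q * (p x)%:E))%E.

Definition proper_score (R : realType) (S : R -> (R -> R) -> \bar R) : Prop :=
  forall p q, classP R p -> classP R q ->
    (expected_score S p p <= expected_score S p q)%E.

Definition strictly_proper_score (R : realType) (S : R -> (R -> R) -> \bar R)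
    : Prop :=
  proper_score S /\
  forall p q, classP R p -> classP R q ->
    (expected_score S p p = expected_score S p q <-> q = p).

Definition local_score (R : realType) (k : nat) (s : 'rV[R]_k.+2 -> R)
    : R -> (R -> R) -> \bar R :=
  fun x q => (s (jet k q x))%:E.

Arguments local_score {R} k s _ _.

Definition represents_local_score (R : realType) (k : nat)
    (s : 'rV[R]_k.+2 -> R) : Prop :=
  scoring_rule (local_score k s).

Arguments represents_local_score {R} k s.

Definition rowvec (R : realType) (n : nat) (t : n.-tuple R) : 'rV[R]_n :=
  \row_i tnth t i.

Definition kernel_form (R : realType) (c : R) (K0 : 'rV[R]_2 -> R)
    (K : 'rV[R]_3 -> R) : Prop :=
  forall x y0 y1 : R,
    K (rowvec [tuple x; y0; y1]) = c * y0 + K0 (rowvec [tuple x; y1]).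

(* On R^2 = {(x, y1)}, partial 0 is the derivative in x and partial 1 the
   derivative in y1. *)
Definition score_form (R : realType) (c : R) (K0 : 'rV[R]_2 -> R)
    (s : 'rV[R]_4 -> R) : Prop :=
  forall x y0 y1 y2 : R,
    s (rowvec [tuple x; y0; y1; y2]) =
      c * y0 + K0 (rowvec [tuple x; y1])
      - y1 * partial 1 K0 (rowvec [tuple x; y1])
      - partial 0 (partial 1 K0) (rowvec [tuple x; y1])
      - y2 * partial 1 (partial 1 K0) (rowvec [tuple x; y1]).

(* Main.v *)
From HB Require Import structures.
From mathcomp Require Import all_boot all_order all_algebra.
From mathcomp Require Import all_classical all_reals all_analysis.
From mathcomp Require Import measurable_realfun.
From mathcomp Require Import ring lra.
Require Import Defs.

Set Implicit Arguments.
Unset Strict Implicit.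
Unset Printing Implicit Defensive.

Import Order.TTheory GRing.Theory Num.Theory.
Import numFieldNormedType.Exports.

Local Open Scope classical_set_scope.
Local Open Scope ring_scope.

(** Write u = ln q, y_0 = u, y_1 = u', y_2 = u'', and let s_0, s_1, s_2 be the
    derivatives of s in y_0, y_1, y_2; D is the total derivative in x.

    From kernels to scores. The score attached to K is
    s = K - y_1 d_1 K - D (d_1 K), so integration by parts turns S(p, q) into the
    integral of K p + d_1 K (p' - u' p) over the line ([integral_score]). Hence
    S(q, q) = Phi(q), and S(p, q) - S(q, q) is the one-sided derivative at q of
    Phi along the segment from q to p ([cvg_Phi_quotient], by dominated
    convergence). Concavity bounds this derivative below by Phi(p) - Phi(q), which
    is propriety; slopes of a strictly concave function decrease strictly.

    From scores to kernels. If s is proper, q minimizes q' -> S(q, q'), so the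
    first variation in every direction p - q is nonnegative. Integrated by parts
    twice it is the integral of L_q (p - q), where
    L_q = s_0 + (D + u') G and G = D s_2 + u' s_2 - s_1 ([integral_euler]).
    Letting p concentrate at a point shows that L_q is at least its mean under q
    everywhere, hence constant ([euler_constant]). The constant does not depend
    on q, and L_q is the same constant as a function of free variables
    x, y_0, ..., y_4: a density can be found with prescribed jets at two points,
    namely a mixture of exponentials of polynomials ([density_with_two_jets]).
    Being constant in y_4 and y_3, the expression forces s_22 = 0, and then
    G does not depend on y_2 or y_3; differentiating the remaining identity in y_2
    and y_1, and exchanging mixed derivatives, gives G = 0 and s_0 = c
    ([flux_eq0]). Thus s is affine in y_0 with slope c, affine in y_2, and
    s_1 = D s_2 + y_1 s_2. Integrating s_2 twice in y_1 produces K_0, and s and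
    the score of K then agree because they have the same derivatives and the same
    values at y_0 = y_1 = y_2 = 0 ([kernel_score_form]). Finally
    Phi(p) = S(p, p) is the infimum over q of S(p, q), which is linear in p, hence
    Phi is concave, and strictly so when the infimum is attained only at p. *)

(** * Mean values and differentiability *)

Section Calculus.
Variable R : realType.

Lemma mean_value (f df : R -> R) (a b : R) :
  (forall th, 0 <= th <= 1 ->
     is_derive (a + th * (b - a)) 1 f (df (a + th * (b - a)))) ->
  exists2 th, 0 <= th <= 1 & f b - f a = df (a + th * (b - a)) * (b - a).
Proof.
move=> fdf; pose l (t : R) := a + t * (b - a).
have dg (t : R) : t \in `[0, 1] -> is_derive t 1 (f \o l) (df (l t) * (b - a)).
  rewrite in_itv /= => t01; apply: is_derive1_comp; first exact: fdf.
  have h := is_deriveD (is_derive_cst a t 1) (is_deriveM (is_derive_id t 1) (is_derive_cst (b - a) t 1)).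
  by apply: is_derive_eq h _; rewrite /= scaler0 !add0r [LHS]mulr1.
have cg : {within `[0, 1], continuous (f \o l)}.
  by apply: derivable_within_continuous => t t01; have [] := dg t t01.
have dgo (t : R) : t \in `]0, 1[ -> is_derive t 1 (f \o l) (df (l t) * (b - a)).
  by move=> t01; apply: dg; exact: subset_itv_oo_cc.
have [t t01 E] := MVT ltr01 dgo cg.
exists t; first by move: t01; rewrite in_itv /= => /andP[/ltW -> /ltW ->].
have l0 : (f \o l) 0 = f a by rewrite /= /l mul0r addr0.
have l1 : (f \o l) 1 = f b by rewrite /= /l mul1r addrC subrK.
by move: E; rewrite l0 l1 subr0 mulr1.
Qed.

Lemma is_derive0_eq (f : R -> R) (a b : R) :
  (forall x : R, is_derive x 1 f 0) -> f a = f b.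
Proof.
move=> f0; have [th _ /eqP] := @mean_value f (fun=> 0) a b (fun th _ => f0 _).
by rewrite mul0r subr_eq0 => /eqP.
Qed.

Lemma partial_line n (f : 'rV[R]_n.+1 -> R) v i (s : R) :
  derivable f (v + s *: delta_mx 0 i) (delta_mx 0 i) ->
  is_derive s 1 (fun s => f (v + s *: delta_mx 0 i))
    (partial i f (v + s *: delta_mx 0 i)).
Proof.
set e := delta_mx 0 i => df.
have E : (fun h : R => h^-1 *: (f (v + (h *: (1 : R) + s) *: e) - f (v + s *: e)))
    = (fun h => h^-1 *: ((f \o shift (v + s *: e)) (h *: e) - f (v + s *: e))).
  apply/funext => h /=; congr (_ *: (f _ - _)).
  by rewrite scalerDl [h *: 1]mulr1 [LHS]addrCA.
split; first by rewrite /derivable /= E.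
by rewrite /derive /= E.
Qed.

Lemma normr_entry_le n (v : 'rV[R]_n) i : `|v 0 i| <= `|v|.
Proof.
by rewrite [leRHS]/Num.Def.normr/= mx_normrE; exact: (le_bigmax _ _ (0, i)).
Qed.

Lemma norm_row_le n (v : 'rV[R]_n) (b : R) :
  0 <= b -> (forall i, `|v 0 i| <= b) -> `|v| <= b.
Proof.
move=> b0 vb; rewrite [leLHS]/Num.Def.normr/= mx_normrE.
by apply: bigmax_le => // -[i j] _ /=; rewrite ord1.
Qed.

Section Differentiability.
Variable n : nat.
Implicit Types (f : 'rV[R]_n.+1 -> R) (v h : 'rV[R]_n.+1).

Let truncate (k : nat) h : 'rV[R]_n.+1 := \row_i (if (i < k)%N then h 0 i else 0).

(** The increment along h is a telescoping sum of increments along the axes,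
    each given by the mean value theorem. *)
Lemma increment_partials f v (e d : R) :
  (forall w i, derivable f w (delta_mx 0 i)) ->
  0 <= e ->
  (forall w i, `|w| < d -> `|partial i f (v + w) - partial i f v| <= e) ->
  forall h, `|h| < d ->
  `|f (v + h) - f v - \sum_i h 0 i * partial i f v| <= e * `|h| *+ n.+1.
Proof.
move=> df e0 pe h hd.
pose T k := f (v + truncate k h) - \sum_(i < n.+1 | (i < k)%N) h 0 i * partial i f v.
have step k : (k < n.+1)%N -> `|T k.+1 - T k| <= e * `|h|.
  move=> kn; pose i := Ordinal kn; rewrite /T.
  have -> : truncate k.+1 h = truncate k h + h 0 i *: delta_mx 0 i.
    apply/rowP => j; rewrite !mxE /= ltnS leq_eqVlt.
    have [jk|jk] := eqVneq (j : nat) k.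
      have -> : j = i by apply/val_inj.
      by rewrite /= ltnn !eqxx mulr1 add0r.
    rewrite /= (_ : (j == i) = false) ?mulr0 ?addr0 //.
    by apply/negbTE; apply: contra jk => /eqP ->.
  have [th th01] := @mean_value
      (fun s => f (v + truncate k h + s *: delta_mx 0 i))
      (fun s => partial i f (v + truncate k h + s *: delta_mx 0 i)) 0 (h 0 i)
      (fun th _ => partial_line (df _ i)).
  rewrite scale0r addr0 subr0 add0r => E.
  rewrite (bigD1 i) /=; last by rewrite ltnSn.
  have -> : \sum_(j < n.+1 | (j < k.+1)%N && (j != i)) h 0 j * partial j f v
      = \sum_(j < n.+1 | (j < k)%N) h 0 j * partial j f v.
    apply: eq_bigl => j; rewrite ltnS leq_eqVlt andb_orl.
    have -> : (j < k)%N && (j != i) = (j < k)%N.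
      by apply: andb_idr; apply: contraL => /eqP ->; rewrite /= ltnn.
    have [jk|] := eqVneq (j : nat) k; last by [].
    have -> : j = i by apply/val_inj.
    by rewrite eqxx.
  set S := \sum_(j < n.+1 | _) _.
  set w := v + truncate k h + _ *: _ in E *.
  have -> : f (v + (truncate k h + h 0 i *: delta_mx 0 i)) - (h 0 i * partial i f v + S)
      - (f (v + truncate k h) - S) =
      (partial i f (v + (truncate k h + (th * h 0 i) *: delta_mx 0 i)) - partial i f v) * h 0 i.
    move: E => /eqP; rewrite subr_eq addrA => /eqP ->.
    by rewrite /w addrA; ring.
  rewrite normrM ler_pM //; last exact: normr_entry_le.
  apply: pe; apply: le_lt_trans hd; apply: norm_row_le => // j.
  rewrite !mxE /=; have [jk|jk] := ltnP j k.
    rewrite (_ : (j == i) = false) ?mulr0 ?addr0 ?normr_entry_le //.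
    by apply/negbTE; apply: contraL jk => /eqP ->; rewrite /= ltnn.
  rewrite add0r; have [_|] := eqVneq j i; last by rewrite mulr0 normr0.
  rewrite mulr1 normrM; apply: le_trans (normr_entry_le h i).
  by rewrite ler_piMl //; case/andP: th01 => ? ?; rewrite ger0_norm.
have tele k : (k <= n.+1)%N -> `|T k - T 0%N| <= e * `|h| *+ k.
  elim: k => [|k IH] kn; first by rewrite subrr normr0.
  rewrite -(subrK (T k) (T k.+1)) -addrA mulrS.
  apply: le_trans (ler_normD _ _) _; rewrite lerD ?step //.
  exact/IH/ltnW.
have := tele n.+1 (leqnn _); rewrite /T.
have -> : truncate 0 h = 0 by apply/rowP => i; rewrite !mxE.
have -> : truncate n.+1 h = h by apply/rowP => i; rewrite !mxE ltn_ord.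
rewrite addr0 [X in _ - (_ - X)]big_pred0 // subr0.
rewrite [X in _ - X - _](eq_bigl predT) => [|i]; last by rewrite ltn_ord.
by rewrite addrAC.
Qed.

Lemma gradient_linear f v :
  linear (fun h : 'rV[R]_n.+1 => \sum_i h 0 i * partial i f v : R).
Proof.
move=> a x y; rewrite scaler_sumr -big_split /=; apply: eq_bigr => i _.
by rewrite !mxE mulrDl [in RHS]/GRing.scale/= mulrA.
Qed.

Lemma cont_partials_differentiable f v :
  cont_partials 1 f ->
  differentiable f v /\
  forall h, 'd f v h = \sum_i h 0 i * partial i f v.
Proof.
move=> [df cf].
have [dl dlE] : {dl : {linear 'rV[R]_n.+1 -> R} |
    forall h, dl h = \sum_i h 0 i * partial i f v}.
  pose A := GRing.isLinear.Build R 'rV[R]_n.+1 R *%R _ (gradient_linear f v).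
  pose L : {linear 'rV[R]_n.+1 -> R} := HB.pack (fun h : 'rV[R]_n.+1 => \sum_i h 0 i * partial i f v : R) A.
  by exists L.
have dlc : continuous dl.
  have -> : (dl : _ -> R) = fun h => \sum_i h 0 i * partial i f v.
    by apply/funext => h; exact: dlE.
apply: continuous_big => [|i _]; first exact: add_continuous.
  move=> h; exact: (cvgM (@coord_continuous R 1 n.+1 0 i h) (cvg_cst _)).
have dE : (f : 'rV[R]_n.+1 -> (R : normedModType R)) \o shift v
    = cst (f v) + (dl : 'rV[R]_n.+1 -> R) +o_ (0 : 'rV[R]_n.+1) id.
  apply/eqaddoP => e e0.
  have e0' : 0 < e / n.+1%:R by rewrite divr_gt0 // ltr0n.
  have near_i (i : 'I_n.+1) : \forall w \near nbhs (0 : 'rV[R]_n.+1),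
      `|partial i f (v + w) - partial i f v| <= e / n.+1%:R.
    have ci : {for v, continuous (partial i f)} by exact: (cf [:: i]).
    move/cvgrPdist_le : ci => /(_ _ e0') /nbhs_ballP[d /= d0 H].
    apply/nbhs_ballP; exists d => //= w; rewrite -ball_normE /= sub0r normrN => wd.
    rewrite distrC; apply: H.
    by rewrite -ball_normE /= opprD addrA subrr sub0r normrN.
  have {near_i} : \forall w \near nbhs (0 : 'rV[R]_n.+1), forall i,
      `|partial i f (v + w) - partial i f v| <= e / n.+1%:R.
    by apply: filter_forall.
  case/nbhs_ballP => d /= d0 dE; near=> h.
  rewrite /= -![(_ + _ : _ -> _) _]/(_ + _) -![(- _ : _ -> _) _]/(- _) /=.
  rewrite opprD addrA [h + v]addrC dlE.
  have := @increment_partials f v (e / n.+1%:R) d (fun w i => df [::] i w isT).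
  move=> /(_ (ltW e0') _ h) H.
  apply: le_trans (H _ _) _.
  - move=> w i wd; apply: (dE w _ i); first by rewrite -ball_normE /= sub0r normrN.
  - near: h; apply/nbhs_ballP; exists d => //= h.
    by rewrite -ball_normE /= sub0r normrN.
  - by rewrite -mulr_natr mulrAC divfK // pnatr_eq0.
split.
  by apply/diff_locallyP; rewrite (diff_unique dlc dE).
by move=> h; rewrite -dlE (diff_unique dlc dE).
Unshelve. all: by end_near. Qed.

Lemma is_derive_curve f (g : R -> 'rV[R]_n.+1) (dg : 'I_n.+1 -> R) (t : R) :
  cont_partials 1 f ->
  (forall i, is_derive t 1 (fun s => g s 0 i) (dg i)) ->
  is_derive t 1 (f \o g) (\sum_i dg i * partial i f (g t)).
Proof.
move=> cf dgi.
have [fd fE] := cont_partials_differentiable (g t) cf.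
have gd : derivable g t 1 by apply/derivable_mxP => i j; rewrite ord1; have [] := dgi j.
have gd' : differentiable g t by apply/derivable1_diffP.
have fgd : differentiable (f \o g) t by apply: differentiable_comp.
split; first by apply/derivable1_diffP.
rewrite deriveE // diff_comp //= fE; apply: eq_bigr => i _; congr (_ * _).
rewrite -deriveE // derive_mx // mxE; have [_ h] := dgi i; exact: h.
Qed.

End Differentiability.
End Calculus.

(** * Partial derivatives of higher order *)

Section Partials.
Variables (R : realType) (n : nat).
Implicit Types (f g : 'rV[R]_n.+1 -> R) (v w : 'rV[R]_n.+1) (i j : 'I_n.+1).

Lemma cont_partials0 f : cont_partials 0 f <-> continuous f.
Proof.
split=> [[_ cf]|cf]; first exact: (cf [::]).
by split=> // s; rewrite leqn0 size_eq0 => /eqP ->.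
Qed.

Lemma cont_partialsS m f :
  cont_partials m.+1 f <->
  [/\ continuous f, forall v i, derivable f v (delta_mx 0 i) &
      forall i, cont_partials m (partial i f)].
Proof.
have E s i : partials s (partial i f) = partials (rcons s i) f.
  by rewrite /partials foldr_rcons.
split=> [[df cf]|[cf df pf]].
  split; first exact: (cf [::]).
    by move=> v i; exact: (df [::]).
  move=> i; split=> s.
    by move=> j v hs; rewrite E; apply: df; rewrite size_rcons.
  by move=> hs; rewrite E; apply: cf; rewrite size_rcons.
split=> s; case/lastP: s => [|s k].
- by move=> i v _; exact: df.
- move=> i v; rewrite -E size_rcons ltnS => hs; have [h _] := pf k; exact: h.
- by [].
- rewrite -E size_rcons ltnS => hs; have [_ h] := pf k; exact: h.
Qed.

Lemma cont_partialsW m k f : (m <= k)%N -> cont_partials k f -> cont_partials m f.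
Proof.
move=> mk [df cf]; split=> [s i v hs|s hs].
  by apply: df; exact: leq_trans mk.
by apply: cf; exact: leq_trans mk.
Qed.

Lemma cont_partials_continuous m f : cont_partials m f -> continuous f.
Proof. by case=> _ /(_ [::]); exact. Qed.

Lemma cont_partials_derivable m f v i :
  cont_partials m.+1 f -> derivable f v (delta_mx 0 i).
Proof. by case=> /(_ [::]) h _; exact: h. Qed.

Lemma cont_partials_partial m f i :
  cont_partials m.+1 f -> cont_partials m (partial i f).
Proof. by case/cont_partialsS. Qed.

Lemma partialD f g i :
  (forall v, derivable f v (delta_mx 0 i)) ->
  (forall v, derivable g v (delta_mx 0 i)) ->
  partial i (fun v => f v + g v) = fun v => partial i f v + partial i g v.
Proof. by move=> df dg; apply/funext => v; rewrite /partial deriveD. Qed.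

Lemma partialM f g i :
  (forall v, derivable f v (delta_mx 0 i)) ->
  (forall v, derivable g v (delta_mx 0 i)) ->
  partial i (fun v => f v * g v) =
  fun v => partial i f v * g v + f v * partial i g v.
Proof.
move=> df dg; apply/funext => v; rewrite /partial deriveM //.
by rewrite addrC; congr (_ + _); exact: mulrC.
Qed.

Lemma is_derive_coord v w j :
  is_derive v w (fun u : 'rV[R]_n.+1 => u 0 j) (w 0 j).
Proof.
have d0 : derivable (@id 'rV[R]_n.+1) v w by exact: derivable_id.
split; first by have := d0; move/derivable_mxP => /(_ 0 j).
have := derive_mx d0; rewrite derive_id => /matrixP /(_ 0 j).
by rewrite mxE => ->.
Qed.

Lemma partial_coord i j :
  partial i (fun v => v 0 j) = fun=> (i == j)%:R.
Proof.
apply/funext => v; have [_ h] := is_derive_coord v (delta_mx 0 i) j.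
by rewrite /partial h mxE eqxx eq_sym.
Qed.

Lemma partial_cst (c : R) i : partial i (fun _ : 'rV[R]_n.+1 => c) = fun=> 0.
Proof. by apply/funext => v; rewrite /partial derive_cst. Qed.

Lemma continuous_increment f v (e : R) : continuous f -> 0 < e ->
  exists2 d, 0 < d & forall w, `|w| < d -> `|f (v + w) - f v| <= e.
Proof.
move=> cf e0; have cv : {for v, continuous f} by exact: cf.
move/cvgrPdist_le : cv => /(_ _ e0) /nbhs_ballP[d /= d0 H].
exists d => // w wd; rewrite distrC; apply: H.
by rewrite -ball_normE /= opprD addrA subrr sub0r normrN.
Qed.

(* The mean value theorem in both directions. *)
Let second_difference f v i j (h : R) : cont_partials 2 f ->
  0 <= h -> exists2 w, `|w| <= h + h &
  f (v + h *: delta_mx 0 i + h *: delta_mx 0 j) - f (v + h *: delta_mx 0 i)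
    - f (v + h *: delta_mx 0 j) + f v =
  partial j (partial i f) (v + w) * h * h.
Proof.
move=> cf h0; set ei := delta_mx 0 i; set ej := delta_mx 0 j.
have df w : derivable f w ei by exact: cont_partials_derivable cf.
have dif w : derivable (partial i f) w ej.
  by apply: cont_partials_derivable; exact: cont_partials_partial cf.
have [th th01] := @mean_value R (fun s => f ((v + h *: ej) + s *: ei) - f (v + s *: ei))
  (fun s => partial i f ((v + h *: ej) + s *: ei) - partial i f (v + s *: ei)) 0 h
  (fun th _ => is_deriveB (partial_line (df _)) (partial_line (df _))).
rewrite !scale0r !addr0 subr0 add0r => E.
have [th' th'01] := @mean_value R (fun s => partial i f ((v + (th * h) *: ei) + s *: ej))
  (fun s => partial j (partial i f) ((v + (th * h) *: ei) + s *: ej)) 0 h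
  (fun th _ => partial_line (dif _)).
rewrite scale0r addr0 subr0 add0r => E'.
exists ((th * h) *: ei + (th' * h) *: ej).
  have nd k : `|delta_mx 0 k : 'rV[R]_n.+1| <= 1.
    apply: norm_row_le => // l; rewrite mxE.
    by case: (_ && _); rewrite ?normr1 ?normr0.
  have b k a : 0 <= a <= 1 -> `|(a * h) *: (delta_mx 0 k : 'rV[R]_n.+1)| <= h.
    case/andP=> a0 a1; rewrite normrZ; have -> : `|a * h| = a * h.
      by rewrite ger0_norm // mulr_ge0.
    apply: le_trans (_ : 1 * h * 1 <= _); last by rewrite mul1r mulr1.
    by rewrite !ler_pM // mulr_ge0.
  by apply: le_trans (ler_normD _ _) _; rewrite lerD ?b.
rewrite addrA -E'; move: E; rewrite ![v + h *: ej + _]addrAC => <-.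
by rewrite opprB addrA addrAC.
Qed.

Let eq_of_nearby_values (A B : 'rV[R]_n.+1 -> R) v :
  continuous A -> continuous B ->
  (forall h, 0 < h -> exists w w',
     [/\ `|w| <= h + h, `|w'| <= h + h & A (v + w) = B (v + w')]) ->
  A v = B v.
Proof.
move=> cA cB AB; apply/eqP; rewrite -subr_eq0 -normr_le0.
apply/ler_addgt0Pr => e e0; rewrite add0r.
have e2 : 0 < e / 2 by rewrite divr_gt0 // ltr0n.
have [d d0 H] := continuous_increment v cA e2.
have [d' d'0 H'] := continuous_increment v cB e2.
have m0 : 0 < Num.min d d' by rewrite lt_min d0.
have h0 : 0 < Num.min d d' / 4 by rewrite divr_gt0 // ltr0n.
have [w [w' [wh wh' E]]] := AB _ h0.
have small (u : 'rV[R]_n.+1) : `|u| <= Num.min d d' / 4 + Num.min d d' / 4 ->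
    `|u| < d /\ `|u| < d'.
  move=> uh; suff: `|u| < Num.min d d' by rewrite lt_min => /andP.
  apply: le_lt_trans uh _; clear -m0.
  by move: (Num.min d d') m0 => m m0; lra.
have h1 := H _ (small _ wh).1; have h2 := H' _ (small _ wh').2.
rewrite (splitr e); apply: le_trans (ler_distD (A (v + w)) _ _) _.
by rewrite lerD // 1?distrC // E distrC.
Qed.

(** Mixed partial derivatives of a C2 function commute: both are limits of the
    same second difference quotient. *)
Lemma partialC f i j : cont_partials 2 f ->
  partial i (partial j f) = partial j (partial i f).
Proof.
move=> cf; apply/funext => v; apply: eq_of_nearby_values.
- exact: (cf.2 [:: i; j] isT).
- exact: (cf.2 [:: j; i] isT).
move=> h h0; have [w wh E] := second_difference v j i cf (ltW h0).
have [w' wh' E'] := second_difference v i j cf (ltW h0).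
exists w, w'; split; [exact: wh|exact: wh'|].
have hn0 : h != 0 by rewrite gt_eqF.
apply: (mulIf hn0); apply: (mulIf hn0).
apply: etrans (esym E) (etrans _ E'); congr (_ + _).
rewrite [v + h *: delta_mx 0 j + _]addrAC; exact: addrAC.
Qed.

End Partials.

(** * Polynomial growth and rapid decay *)

Section Growth.
Variable R : realType.
Implicit Types (f g : R -> R) (x : R).

Definition poly_growth f := exists (C : R) (n : nat),
  0 <= C /\ forall x, `|f x| <= C * (1 + `|x|) ^+ n.

Definition rapid_decay f := forall n : nat, exists C : R,
  forall x, `|f x| * (1 + `|x|) ^+ n <= C.

Lemma weight_ge1 x : 1 <= 1 + `|x|. Proof. by rewrite lerDl. Qed.

Lemma weight_ge0 x : 0 <= 1 + `|x|.
Proof. exact: le_trans ler01 (weight_ge1 x). Qed.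

Lemma weight_pow_ge0 x n : 0 <= (1 + `|x|) ^+ n.
Proof. by rewrite exprn_ge0 // weight_ge0. Qed.

Lemma poly_growth_le f g :
  (forall x, `|f x| <= `|g x|) -> poly_growth g -> poly_growth f.
Proof.
by move=> fg [C [n [C0 H]]]; exists C, n; split=> // x; exact: le_trans (H x).
Qed.

Lemma poly_growth_cst (c : R) : poly_growth (fun=> c).
Proof. by exists `|c|, 0%N; split=> // x; rewrite expr0 mulr1. Qed.

Lemma poly_growth_id : poly_growth id.
Proof. by exists 1, 1%N; split=> // x; rewrite expr1 mul1r lerDr. Qed.

Lemma poly_growthD f g : poly_growth f -> poly_growth g ->
  poly_growth (fun x => f x + g x).
Proof.
move=> [C [n [C0 H]]] [D [m [D0 H']]]; exists (C + D), (n + m)%N.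
split=> [|x]; first exact: addr_ge0.
rewrite mulrDl; apply: le_trans (ler_normD _ _) _; apply: lerD.
  apply: le_trans (H x) _; apply: ler_wpM2l => //.
  by apply: ler_weXn2l; [exact: weight_ge1|exact: leq_addr].
apply: le_trans (H' x) _; apply: ler_wpM2l => //.
by apply: ler_weXn2l; [exact: weight_ge1|exact: leq_addl].
Qed.

Lemma poly_growthM f g : poly_growth f -> poly_growth g ->
  poly_growth (fun x => f x * g x).
Proof.
move=> [C [n [C0 H]]] [D [m [D0 H']]]; exists (C * D), (n + m)%N.
split=> [|x]; first exact: mulr_ge0.
by rewrite normrM exprD mulrACA ler_pM.
Qed.

Lemma poly_growthN f : poly_growth f -> poly_growth (fun x => - f x).
Proof. by apply: poly_growth_le => x; rewrite normrN. Qed.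

Lemma poly_growthB f g : poly_growth f -> poly_growth g ->
  poly_growth (fun x => f x - g x).
Proof. by move=> pf pg; apply: poly_growthD => //; exact: poly_growthN. Qed.

Lemma poly_growthX f n : poly_growth f -> poly_growth (fun x => f x ^+ n).
Proof.
move=> pf; elim: n => [|n IH]; first exact: poly_growth_cst.
by under eq_fun do rewrite exprS; exact: poly_growthM.
Qed.

Lemma poly_growth_norm f : poly_growth f -> poly_growth (fun x => `|f x|).
Proof. by apply: poly_growth_le => x; rewrite normr_id. Qed.

Lemma rapid_decay_le f g :
  (forall x, `|f x| <= `|g x|) -> rapid_decay g -> rapid_decay f.
Proof.
move=> fg H n; have [C HC] := H n; exists C => x; apply: le_trans (HC x).
by apply: ler_wpM2r => //; exact: weight_pow_ge0.
Qed.

Lemma rapid_decayD f g : rapid_decay f -> rapid_decay g ->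
  rapid_decay (fun x => f x + g x).
Proof.
move=> H H' n; have [C HC] := H n; have [D HD] := H' n.
exists (C + D) => x; apply: le_trans (lerD (HC x) (HD x)); rewrite -mulrDl.
by apply: ler_wpM2r; [exact: weight_pow_ge0|exact: ler_normD].
Qed.

Lemma rapid_decayM f g : rapid_decay f -> poly_growth g ->
  rapid_decay (fun x => f x * g x).
Proof.
move=> H [D [m [D0 HD]]] n; have [C HC] := H (m + n)%N.
exists (C * D) => x; apply: le_trans (_ : `|f x| * (1 + `|x|) ^+ (m + n) * D <= _).
  rewrite normrM exprD -!mulrA; apply: ler_wpM2l => //.
  rewrite [_ ^+ n * D]mulrC mulrA.
  by apply: ler_wpM2r; [exact: weight_pow_ge0|rewrite mulrC].
exact: ler_wpM2r.
Qed.

Lemma rapid_decayMl f g : poly_growth f -> rapid_decay g ->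
  rapid_decay (fun x => f x * g x).
Proof.
by move=> pf rg; under eq_fun do rewrite mulrC; exact: rapid_decayM.
Qed.

Lemma rapid_decayN f : rapid_decay f -> rapid_decay (fun x => - f x).
Proof. by apply: rapid_decay_le => x; rewrite normrN. Qed.

Lemma rapid_decayB f g : rapid_decay f -> rapid_decay g ->
  rapid_decay (fun x => f x - g x).
Proof. by move=> rf rg; apply: rapid_decayD => //; exact: rapid_decayN. Qed.

Lemma rapid_decay_norm f : rapid_decay f -> rapid_decay (fun x => `|f x|).
Proof. by apply: rapid_decay_le => x; rewrite normr_id. Qed.

Lemma rapid_decayZ (c : R) f : rapid_decay f -> rapid_decay (fun x => c * f x).
Proof. by apply: rapid_decayMl; exact: poly_growth_cst. Qed.

End Growth.

Section Integration.
Variable R : realType.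
Notation mu := (@lebesgue_measure R).
Implicit Types (f g : R -> R) (x : R).

Definition integrableR f := mu.-integrable setT (EFin \o f).

Definition integralR f : R := \int[mu]_x f x.

Lemma integralR_EFin f : integrableR f -> (\int[mu]_x (f x)%:E)%E = (integralR f)%:E.
Proof. by move=> fi; rewrite /integralR /Rintegral fineK // integrable_fin_num. Qed.

Lemma integrableR_le f g : measurable_fun setT f ->
  (forall x, `|f x| <= g x) -> integrableR g -> integrableR f.
Proof.
move=> mf fg; apply: le_integrable => //.
  exact/measurable_EFinP.
move=> x _ /=; rewrite lee_fin; apply: le_trans (fg x) _; exact: ler_norm.
Qed.

Lemma integrableRD f g : integrableR f -> integrableR g ->
  integrableR (fun x => f x + g x).
Proof. by move=> hf hg; exact: (integrableD measurableT hf hg). Qed.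

Lemma integrableRZ (c : R) f : integrableR f -> integrableR (fun x => c * f x).
Proof. by move=> hf; exact: (integrableZl measurableT c hf). Qed.

Lemma integrableRB f g : integrableR f -> integrableR g ->
  integrableR (fun x => f x - g x).
Proof. by move=> hf hg; exact: (integrableB measurableT hf hg). Qed.

Lemma integralRD f g : integrableR f -> integrableR g ->
  integralR (fun x => f x + g x) = integralR f + integralR g.
Proof. by move=> hf hg; exact: RintegralD. Qed.

Lemma integralRB f g : integrableR f -> integrableR g ->
  integralR (fun x => f x - g x) = integralR f - integralR g.
Proof. by move=> hf hg; exact: RintegralB. Qed.

Lemma integralRZ (c : R) f : integrableR f ->
  integralR (fun x => c * f x) = c * integralR f.
Proof. by move=> hf; exact: RintegralZl. Qed.

Lemma integralR_le f g : integrableR f -> integrableR g ->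
  (forall x, f x <= g x) -> integralR f <= integralR g.
Proof. by move=> hf hg fg; apply: le_Rintegral. Qed.

Lemma integralR_ge0 f : (forall x, 0 <= f x) -> 0 <= integralR f.
Proof. by move=> f0; apply: Rintegral_ge0. Qed.

Lemma dominated_convergenceR (f_ : nat -> R -> R) f g :
  (forall n, measurable_fun setT (f_ n)) -> measurable_fun setT f ->
  (forall x, f_ n x @[n --> \oo] --> f x) -> integrableR g ->
  (forall n x, `|f_ n x| <= g x) ->
  integralR (f_ n) @[n --> \oo] --> integralR f.
Proof.
move=> mf_ mf ff gi fg.
have [||||| fi _ h] := @dominated_convergence _ _ R mu setT measurableT
  (fun n => EFin \o f_ n) (EFin \o f) (EFin \o g).
- by move=> n; apply/measurable_EFinP; exact: mf_.
- exact/measurable_EFinP.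
- by apply: aeW => x _; apply: cvg_EFin; [exact: nearW|exact: ff].
- exact: gi.
- by apply: aeW => x n _ /=; rewrite lee_fin.
apply: fine_cvg; rewrite fineK //.
exact: integrable_fin_num.
Qed.

Lemma integrable_oneDsqrV : integrableR (fun x => (oneDsqr x)^-1).
Proof.
apply/integrableP; split.
  by apply/measurable_EFinP; apply: continuous_measurable_fun; exact: continuous_oneDsqrV.
under eq_integral do rewrite /= ger0_norm ?invr_ge0 ?(le_trans ler01 (oneDsqr_ge1 _))//.
rewrite ge0_symfun_integralT; last 3 first.
- by move=> x; rewrite invr_ge0 (le_trans ler01 (oneDsqr_ge1 _)).
- exact: continuous_oneDsqrV.
- by move=> x; rewrite /= /oneDsqr sqrrN.
have -> : [set x : R | 0 <= x] = `[0%R, +oo[%classic.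
  by apply/seteqP; split => x /=; rewrite in_itv /= andbT.
by rewrite integral0y_oneDsqr -EFinM ltry.
Qed.

(* The majorant is a multiple of 1 / (1 + x^2). *)
Lemma rapid_decay_bound f : rapid_decay f ->
  exists2 g, integrableR g & forall x, `|f x| <= g x.
Proof.
move=> /(_ 2%N)[C HC]; exists (fun x => C * (oneDsqr x)^-1).
  exact: integrableRZ integrable_oneDsqrV.
move=> x; have o0 : 0 < oneDsqr x by exact: lt_le_trans ltr01 (oneDsqr_ge1 _).
rewrite ler_pdivlMr //; apply: le_trans (HC x); apply: ler_wpM2l => //.
rewrite /oneDsqr -(real_normK (num_real x)) sqrrD expr1n mul1r.
by rewrite lerD2r lerDl mulrn_wge0.
Qed.

Lemma rapid_decay_integrable f :
  measurable_fun setT f -> rapid_decay f -> integrableR f.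
Proof. by move=> mf /rapid_decay_bound[g gi fg]; exact: integrableR_le mf fg gi. Qed.

Lemma continuous_rapid_integrable f :
  continuous f -> rapid_decay f -> integrableR f.
Proof.
by move=> cf; apply: rapid_decay_integrable; exact: continuous_measurable_fun.
Qed.

End Integration.

(** * Primitives and integrals of derivatives *)

Section Primitives.
Variable R : realType.
Notation mu := (@lebesgue_measure R).
Implicit Types (f g F : R -> R) (x y a b : R).

Lemma cvg0_le (u v : nat -> R) : (forall n, `|u n| <= v n) ->
  v n @[n --> \oo] --> 0 -> u n @[n --> \oo] --> 0.
Proof.
move=> uv v0; apply: (@squeeze_cvgr _ _ _ _ (fun n => - v n) v) => //.
  by apply: nearW => n; rewrite -ler_norml.
by rewrite -oppr0; exact: cvgN.
Qed.

Lemma integralR_itv_derivative F f a b : a < b -> continuous f ->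
  (forall x, is_derive x 1 F (f x)) -> \int[mu]_(x in `[a, b]) f x = F b - F a.
Proof.
move=> ab cf dF; rewrite /Rintegral (@continuous_FTC2 R f F) //.
- exact: continuous_subspaceT.
- have cF : continuous F.
    by move=> x; apply: differentiable_continuous; apply/derivable1_diffP; have [] := dF x.
  split.
  + by move=> x _; have [] := dF x.
  + by apply: cvg_at_right_filter; exact: cF.
  + by apply: cvg_at_left_filter; exact: cF.
- by move=> x _; rewrite derive1E; have [_ ->] := dF x.
Qed.

Lemma rapid_decay_harmonic F : rapid_decay F -> exists C : R,
  forall x (n : nat), n.+1%:R <= `|x| -> `|F x| <= C * n.+1%:R^-1.
Proof.
move=> /(_ 1%N)[C HC]; exists C => x n nx; rewrite ler_pdivlMr ?ltr0n //.
apply: le_trans (HC x); apply: ler_wpM2l => //.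
by rewrite expr1; apply: le_trans nx _; rewrite lerDr.
Qed.

(** The boundary terms of the integrals over [-n, n] vanish in the limit. *)
Lemma integralR_derivative0 F f : (forall x, is_derive x 1 F (f x)) ->
  continuous f -> integrableR f -> rapid_decay F -> integralR f = 0.
Proof.
move=> dF cf fi rF.
pose A (n : nat) := `[- n.+1%:R, n.+1%:R : R]%classic.
have h1 : integralR (f \_ (A n)) @[n --> \oo] --> integralR f.
  apply: (@dominated_convergenceR _ _ _ (fun x => `|f x|)).
  - move=> n; apply/(measurable_restrictT _ (measurable_itv _)).
    by apply: measurable_funTS; exact: continuous_measurable_fun.
  - exact: continuous_measurable_fun.
  - move=> x; apply: cvg_near_cst; near=> n.
    rewrite /patch mem_set // /A /= in_itv /= -ler_norml.
    apply: le_trans (_ : n%:R <= _); last by rewrite ler_nat.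
    by near: n; exact: nbhs_infty_ger.
  - exact: (integrable_norm fi).
  - by move=> n x; rewrite /patch; case: ifPn => // _; rewrite normr0.
have h2 : integralR (f \_ (A n)) @[n --> \oo] --> 0.
  have [C HC] := rapid_decay_harmonic rF.
  apply: (@cvg0_le _ (fun n => (C + C) * n.+1%:R^-1)).
    move=> n; rewrite /integralR -Rintegral_mkcond (@integralR_itv_derivative F) //.
      rewrite mulrDl; apply: le_trans (ler_normB _ _) _.
      by rewrite lerD // HC // ?normrN ger0_norm.
    by apply: lt_trans (_ : 0 < _); rewrite ?oppr_lt0 ltr0n.
  rewrite -[X in _ --> X](mulr0 (C + C)); apply: cvgM; first exact: cvg_cst.
  exact: cvg_harmonic.
by apply: cvg_unique h1 h2.
Unshelve. all: by end_near. Qed.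

Let itv_integrable f a b : continuous f -> mu.-integrable `[a, b] (EFin \o f).
Proof.
move=> cf; apply: continuous_compact_integrable; first exact: segment_compact.
exact: continuous_subspaceT.
Qed.

Let primitive_from f a : continuous f ->
  forall x, a < x -> is_derive x 1 (fun y => \int[mu]_(t in `[a, y]) f t) (f x).
Proof.
move=> cf x ax.
have xu : x < x + 1 by rewrite ltrDl.
have [d e] := continuous_FTC1_closed xu (itv_integrable a (x + 1) cf) ax (cf x).
split; first exact: d.
by rewrite -derive1E.
Qed.

Lemma primitive_exists f : continuous f ->
  exists F, (forall x, is_derive x 1 F (f x)) /\ F 0 = 0.
Proof.
move=> cf; pose J a y := \int[mu]_(t in `[a, y]) f t - \int[mu]_(t in `[a, 0%R]) f t.
have JE a b y : a <= b -> b < 0 -> b < y -> J a y = J b y.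
  move=> ab b0 bY.
  have split_at c z : c <= b -> b < z ->
      \int[mu]_(t in `[c, z]) f t = \int[mu]_(t in `[c, b]) f t + \int[mu]_(t in `]b, z]) f t.
    move=> cb bz; apply/eqP; rewrite addrC -subr_eq; apply/eqP.
    apply: Rintegral_itvB; rewrite ?bnd_simp ?(ltW bz) //; exact: itv_integrable.
  have Ea := split_at a y ab bY; have Ea0 := split_at a 0 ab b0.
  have Eb := split_at b y (lexx b) bY; have Eb0 := split_at b 0 (lexx b) b0.
  have cancel (p q r t : R) : (p + q) - (p + r) = (t + q) - (t + r) by ring.
  transitivity (\int[mu]_(t in `[a, b]) f t + \int[mu]_(t in `]b, y]) f t
    - (\int[mu]_(t in `[a, b]) f t + \int[mu]_(t in `]b, 0%R]) f t)).
    by congr (_ - _).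
  by rewrite (cancel _ _ _ (\int[mu]_(t in `[b, b]) f t)); congr (_ - _).
exists (fun y => J (- `|y| - 1) y); split; last by rewrite /J subrr.
move=> x.
apply: (@near_eq_is_derive _ _ _ (J (- `|x| - 2))).
  near=> y; apply: JE.
  - have := ler_distD x y 0; rewrite !subr0.
    have : `|y - x| < 1; last lra.
    by near: y; apply/nbhs_ballP; exists 1 => //= z; rewrite -ball_normE /= distrC.
  - have := normr_ge0 y; lra.
  - have := ler_norm (- y); rewrite normrN; lra.
have xx : - `|x| - 2 < x by have := ler_norm (- x); rewrite normrN; lra.
have := is_deriveB (primitive_from cf xx) (is_derive_cst (\int[mu]_(t in `[- `|x| - 2, 0]) f t) x 1).
by rewrite subr0.
Unshelve. all: by end_near. Qed.

(** The integral from 0, selected by its derivative so that no case distinction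
    on the order of the bounds is needed. *)
Definition primitive f : R -> R :=
  get [set F | (forall x, is_derive x 1 F (f x)) /\ F 0 = 0].

Lemma primitiveP f : continuous f ->
  (forall x, is_derive x 1 (primitive f) (f x)) /\ primitive f 0 = 0.
Proof.
by move=> cf; exact: (getPex (primitive_exists cf)).
Qed.

End Primitives.

(** * Conditions at infinity as global bounds *)

Section Vanishing.
Variable R : realType.
Implicit Types (f g : R -> R) (x : R).

Lemma bounded_on_segment f (M : R) : continuous f ->
  exists2 C, 0 <= C & forall x, `|x| <= M -> `|f x| <= C.
Proof.
move=> cf; have [M0|M0] := ltP M 0.
  by exists 0 => // x xM; have := le_lt_trans xM M0; rewrite normr_lt0.
have cn : {within `[- M, M], continuous (fun x => `|f x|)}.
  apply: continuous_subspaceT => x.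
  by apply: (@cvg_comp _ _ _ f (fun y => `|y|) (nbhs x) (nbhs (f x))); [exact: cf|exact: norm_continuous].
have MM : - M <= M by lra.
have [c cM H] := EVT_max MM cn.
by exists `|f c| => // x; rewrite ler_norml => xM; apply: H; rewrite in_itv.
Qed.

Lemma vanishes_eventually f : vanishes_at_infinity f ->
  exists2 M, 1 <= M & forall x, M <= `|x| -> `|f x| <= 1.
Proof.
move=> [fp fn].
move/cvgrPdist_le : fp => /(_ 1 ltr01)[A [_ HA]].
move/cvgrPdist_le : fn => /(_ 1 ltr01)[B [_ HB]].
exists (1 + `|A| + `|B|) => [|x]; first by rewrite -addrA lerDl addr_ge0.
have [x0|x0] := leP 0 x; [rewrite (ger0_norm x0)|rewrite (ltr0_norm x0)] => hx.
  rewrite -normrN -sub0r; apply: HA; apply: le_lt_trans (ler_norm _) _.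
  by have := normr_ge0 B; lra.
rewrite -normrN -sub0r; apply: HB.
have := ler_norm (- B); have := normr_ge0 A; rewrite normrN; lra.
Qed.

Lemma vanishes_of_decay f (C : R) :
  (forall x, 1 <= `|x| -> `|f x| <= C / `|x|) -> vanishes_at_infinity f.
Proof.
move=> H.
have key (e : R) : 0 < e -> forall x, 1 + `|C| / e <= `|x| -> `|0 - f x| <= e.
  move=> e0 x hx; have q0 : 0 <= `|C| / e by rewrite divr_ge0 // ltW.
  have x1 : 1 <= `|x| by lra.
  rewrite sub0r normrN; apply: le_trans (H _ x1) _.
  rewrite ler_pdivrMr; last lra.
  apply: le_trans (ler_norm C) _.
  have : `|C| / e <= `|x| by lra.
  by rewrite ler_pdivrMr // mulrC.
split; apply/cvgrPdist_le => e e0.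
  exists (1 + `|C| / e); split=> [|x hx]; first exact: num_real.
  apply: key => //; apply: le_trans (ltW hx) _; exact: ler_norm.
exists (- (1 + `|C| / e)); split=> [|x hx]; first exact: num_real.
by apply: key => //; apply: le_trans (_ : - x <= _); [lra|rewrite -normrN ler_norm].
Qed.

Lemma powR_le_weight (m : R) : 0 <= m ->
  exists n : nat, forall x, `|x| `^ m <= (1 + `|x|) ^+ n.
Proof.
move=> m0; exists (Num.truncn m).+1 => x.
rewrite -powR_mulrn ?weight_ge0 //.
apply: le_trans (_ : (1 + `|x|) `^ m <= _).
  by apply: ge0_ler_powR; rewrite ?nnegrE ?weight_ge0 // lerDr.
by apply: ler_powR; [exact: weight_ge1|apply: ltW; exact: truncnS_gt].
Qed.

(** Continuity controls the compact part of the line; near infinity, integer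
    powers of 1 + |x| do as well as real powers of |x|. *)
Lemma rapid_decayP f : continuous f ->
  (forall m : R, 0 < m -> vanishes_at_infinity (fun x => `|x| `^ m * f x)) <->
  rapid_decay f.
Proof.
move=> cf; split=> [H n|rf m m0].
  have [M M1 HM] := vanishes_eventually (H n.+1%:R (ltr0Sn _ _)).
  have [C C0 HC] := bounded_on_segment M cf.
  exists (2 ^+ n + C * (1 + M) ^+ n) => x.
  have M0 : 0 <= M by lra.
  have [xM|xM] := leP `|x| M.
    apply: le_trans (_ : C * (1 + M) ^+ n <= _); last by rewrite lerDr exprn_ge0.
    apply: ler_pM; [exact: normr_ge0|exact: weight_pow_ge0|exact: HC|].
    by apply: lerXn2r; rewrite ?nnegrE ?weight_ge0 ?lerD2l //; lra.
  apply: le_trans (_ : 2 ^+ n <= _); last by rewrite lerDl mulr_ge0 // exprn_ge0 //; lra.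
  have := HM x (ltW xM); rewrite normrM powR_mulrn // normrX normr_id => h.
  have x1 : 1 <= `|x| by lra.
  apply: le_trans (_ : `|f x| * (2 * `|x|) ^+ n <= _).
    apply: ler_wpM2l => //; apply: lerXn2r; rewrite ?nnegrE ?weight_ge0 ?mulr_ge0 //; lra.
  rewrite exprMn mulrCA -[leRHS]mulr1; apply: ler_wpM2l; first exact: exprn_ge0.
  apply: le_trans h; rewrite mulrC; apply: ler_wpM2r => //.
  by apply: ler_weXn2l.
have [n Hn] := powR_le_weight (ltW m0).
have [C HC] := rf n.+1.
apply: (@vanishes_of_decay _ C) => x x1.
rewrite ler_pdivlMr; last lra.
apply: le_trans (HC x); rewrite normrM ger0_norm ?powR_ge0 // exprSr -mulrA mulrCA.
apply: ler_wpM2l => //; apply: ler_pM; [exact: powR_ge0|exact: normr_ge0|exact: Hn|].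
by rewrite lerDr.
Qed.

(** Finitely many exponents have a common bound, which provides the power of
    |x| shared by all the functions. *)
Lemma poly_growthP (r : nat -> R -> R) (N : nat) :
  (forall j, (1 <= j <= N)%N -> continuous (r j)) ->
  (exists2 a : R, 0 < a & forall j, (1 <= j <= N)%N ->
     vanishes_at_infinity (fun x => `|x| `^ (- a) * r j x)) <->
  (forall j, (1 <= j <= N)%N -> poly_growth (r j)).
Proof.
move=> cr; split=> [[a a0 H] j jN|H].
  have [M M1 HM] := vanishes_eventually (H j jN).
  have [C C0 HC] := bounded_on_segment M (cr j jN).
  have [n Hn] := powR_le_weight (ltW a0).
  exists (1 + C), n; split=> [|x]; first exact: addr_ge0.
  have [xM|xM] := leP `|x| M.
    apply: le_trans (HC x xM) _; apply: le_trans (_ : C * 1 <= _).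
      by rewrite mulr1.
    by apply: ler_pM; rewrite ?lerDr // exprn_ege1 // weight_ge1.
  apply: le_trans (_ : 1 * (1 + `|x|) ^+ n <= _); last first.
    by apply: ler_wpM2r; [exact: weight_pow_ge0|rewrite lerDl].
  rewrite mul1r; apply: le_trans (Hn x).
  have := HM x (ltW xM); rewrite normrM ger0_norm ?powR_ge0 // powRN.
  by rewrite mulrC ler_pdivrMr ?mul1r // powR_gt0; lra.
have [n Hn] : exists n, forall j, (1 <= j <= N)%N ->
    exists C, forall x, `|r j x| <= C * (1 + `|x|) ^+ n.
  elim: N cr H => [|N IH] cr H; first by exists 0%N => -[].
  have [j jN|j jN|n Hn] := IH.
  - by apply: cr; case/andP: jN => -> /= /leqW.
  - by apply: H; case/andP: jN => -> /= /leqW.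
  have [C [m [C0 HC]]] := H N.+1 (leqnn _).
  exists (n + m)%N => j /andP[j1]; rewrite leq_eqVlt ltnS => /orP[/eqP ->|jN].
    exists C => x; apply: le_trans (HC x) _; apply: ler_wpM2l => //.
    by apply: ler_weXn2l; [exact: weight_ge1|exact: leq_addl].
  have [D HD] : exists C, forall x, `|r j x| <= C * (1 + `|x|) ^+ n by apply: Hn; rewrite j1.
  exists `|D| => x; apply: le_trans (HD x) _.
  apply: le_trans (_ : `|D| * (1 + `|x|) ^+ n <= _).
    by apply: ler_wpM2r; [exact: weight_pow_ge0|exact: ler_norm].
  apply: ler_wpM2l => //; by apply: ler_weXn2l; [exact: weight_ge1|exact: leq_addr].
exists n.+1%:R => [|j jN]; first exact: ltr0Sn.
have [C HC] := Hn j jN.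
apply: (@vanishes_of_decay _ (`|C| * 2 ^+ n)) => x x1.
have x0 : 0 < `|x| by lra.
rewrite normrM ger0_norm ?powR_ge0 // powRN powR_mulrn //.
rewrite mulrC ler_pdivrMr ?exprn_gt0 // exprSr.
rewrite -mulrA [_^-1 * _]mulrC -[X in _ <= _ * X]mulrA divff ?gt_eqF // mulr1.
apply: le_trans (HC x) _; rewrite -mulrA -exprMn.
apply: le_trans (_ : `|C| * (1 + `|x|) ^+ n <= _).
  by apply: ler_wpM2r; [exact: weight_pow_ge0|exact: ler_norm].
apply: ler_wpM2l => //; apply: lerXn2r; rewrite ?nnegrE ?weight_ge0 ?mulr_ge0 //; lra.
Qed.

End Vanishing.

(** * Densities and the derivatives of their logarithms *)

Section Towers.
Variable R : realType.
Implicit Types (f g p q : R -> R) (x : R).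

Lemma is_derive_continuous f (df : R -> R) :
  (forall x, is_derive x 1 f (df x)) -> continuous f.
Proof.
move=> dF x; apply: differentiable_continuous.
by apply/derivable1_diffP; have [] := dF x.
Qed.

(* Differentiation rules on abstractions, so that nested applications of them
   compute derivatives in readable form. *)
Lemma is_derive_add f g (df dg x : R) :
  is_derive x 1 f df -> is_derive x 1 g dg ->
  is_derive x 1 (fun y => f y + g y) (df + dg).
Proof. exact: is_deriveD. Qed.

Lemma is_derive_sub f g (df dg x : R) :
  is_derive x 1 f df -> is_derive x 1 g dg ->
  is_derive x 1 (fun y => f y - g y) (df - dg).
Proof. exact: is_deriveB. Qed.

Lemma is_derive_mul f g (df dg x : R) :
  is_derive x 1 f df -> is_derive x 1 g dg ->
  is_derive x 1 (fun y => f y * g y) (df * g x + f x * dg).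
Proof.
move=> hf hg; apply: is_derive_eq (is_deriveM hf hg) _.
by rewrite addrC; congr (_ + _); exact: mulrC.
Qed.

Lemma is_derive_scale (c : R) f (df x : R) :
  is_derive x 1 f df -> is_derive x 1 (fun y => c * f y) (c * df).
Proof. exact: is_deriveZ. Qed.

Lemma continuous_add f g : continuous f -> continuous g ->
  continuous (fun x => f x + g x).
Proof. by move=> cf cg x; exact: (cvgD (cf x) (cg x)). Qed.

Lemma continuous_sub f g : continuous f -> continuous g ->
  continuous (fun x => f x - g x).
Proof. by move=> cf cg x; exact: (cvgB (cf x) (cg x)). Qed.

Lemma continuous_mul f g : continuous f -> continuous g ->
  continuous (fun x => f x * g x).
Proof. by move=> cf cg x; exact: (cvgM (cf x) (cg x)). Qed.

Lemma continuous_cst (c : R) : continuous (fun _ : R => c).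
Proof. exact: cst_continuous. Qed.

(** The two classes of integrands: the second is a module over the first, and
    consists of integrable functions. *)
Definition tempered f := continuous f /\ poly_growth f.

Definition decaying f := continuous f /\ rapid_decay f.

Lemma tempered_cst (c : R) : tempered (fun=> c).
Proof. by split; [exact: continuous_cst|exact: poly_growth_cst]. Qed.

Lemma temperedD f g : tempered f -> tempered g -> tempered (fun x => f x + g x).
Proof. by move=> [? ?] [? ?]; split; [exact: continuous_add|exact: poly_growthD]. Qed.

Lemma temperedB f g : tempered f -> tempered g -> tempered (fun x => f x - g x).
Proof. by move=> [? ?] [? ?]; split; [exact: continuous_sub|exact: poly_growthB]. Qed.

Lemma temperedM f g : tempered f -> tempered g -> tempered (fun x => f x * g x).
Proof. by move=> [? ?] [? ?]; split; [exact: continuous_mul|exact: poly_growthM]. Qed.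

Lemma decayingD f g : decaying f -> decaying g -> decaying (fun x => f x + g x).
Proof. by move=> [? ?] [? ?]; split; [exact: continuous_add|exact: rapid_decayD]. Qed.

Lemma decayingB f g : decaying f -> decaying g -> decaying (fun x => f x - g x).
Proof. by move=> [? ?] [? ?]; split; [exact: continuous_sub|exact: rapid_decayB]. Qed.

Lemma decayingM f g : tempered f -> decaying g -> decaying (fun x => f x * g x).
Proof. by move=> [? ?] [? ?]; split; [exact: continuous_mul|exact: rapid_decayMl]. Qed.

Lemma decaying_integrable f : decaying f -> integrableR f.
Proof. by case; exact: continuous_rapid_integrable. Qed.

Lemma is_derive_div f g (df dg x : R) : g x != 0 ->
  is_derive x 1 f df -> is_derive x 1 g dg ->
  is_derive x 1 (fun y => f y / g y) (df / g x - f x / g x * (dg / g x)).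
Proof.
move=> gx fx [dg1 dg2].
have gV : is_derive x 1 (fun y => (g y)^-1) (- (g x) ^- 2 *: dg).
  by split; [exact: derivableV|rewrite deriveV // dg2].
apply: is_derive_eq (is_derive_mul fx gV) _.
by rewrite /GRing.scale /= expr2 invfM; ring.
Qed.

(** Iterated derivatives are computed, and their continuity obtained, by
    exhibiting the whole chain: below those of ln p, exp P and combinations. *)
Lemma derive1n_chain n (D : nat -> R -> R) :
  (forall j x, (j < n)%N -> is_derive x 1 (D j) (D j.+1 x)) ->
  forall j, (j <= n)%N -> derive1n j (D 0%N) = D j.
Proof.
move=> dD; elim=> [|j IH] jn; first by [].
rewrite derive1nS IH ?(ltnW jn) //; apply/funext => x.
by rewrite derive1E; have [_ ->] := dD j x jn.
Qed.

Lemma cont_derivatives_chain n (D : nat -> R -> R) :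
  (forall j x, (j < n)%N -> is_derive x 1 (D j) (D j.+1 x)) ->
  continuous (D n) -> cont_derivatives n (D 0%N).
Proof.
move=> dD cD; have E := derive1n_chain dD.
split=> [j x jn|j]; first by rewrite E ?(ltnW jn) //; have [] := dD j x jn.
rewrite leq_eqVlt => /orP[/eqP ->|jn]; first by rewrite E.
rewrite E ?(ltnW jn) //; apply: (@is_derive_continuous _ (D j.+1)) => x; exact: dD.
Qed.

Lemma cont_derivatives_is_derive n f j x : cont_derivatives n f -> (j < n)%N ->
  is_derive x 1 (derive1n j f) (derive1n j.+1 f x).
Proof. by move=> [df _] jn; split; [exact: df|rewrite derive1nS derive1E]. Qed.

End Towers.

Section Admissible.
Variable R : realType.
Implicit Types (f g p q : R -> R) (x : R).

(** The class of densities without its normalization, and with the two asymptotic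
    conditions turned into global bounds: a convex cone. *)
Definition admissible p := [/\ forall x, 0 < p x, cont_derivatives 4 p,
  forall j, (j <= 4)%N -> rapid_decay (derive1n j p) &
  forall j, (1 <= j <= 4)%N -> poly_growth (fun x => derive1n j p x / p x)].

Definition ratio p (j : nat) x := derive1n j p x / p x.

Lemma admissible_continuous p j : admissible p -> (j <= 4)%N -> continuous (derive1n j p).
Proof. by case=> _ [_ H] _ _ /H. Qed.

Lemma admissible_decaying p j : admissible p -> (j <= 4)%N -> decaying (derive1n j p).
Proof.
by move=> ap j4; split; [exact: admissible_continuous|case: ap => _ _ /(_ j j4)].
Qed.

Lemma admissible_integrable p : admissible p -> integrableR p.
Proof. by move=> ap; exact: (decaying_integrable (admissible_decaying ap (leq0n 4))). Qed.

Lemma ratio_continuous p j : admissible p -> (j <= 4)%N -> continuous (ratio p j).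
Proof.
move=> ap j4 x; have [p0 _ _ _] := ap; apply: cvgM.
  exact: (admissible_continuous ap j4).
apply: cvgV; first by rewrite gt_eqF.
exact: (admissible_continuous ap (leq0n 4)).
Qed.

Lemma classPE p : classP R p <-> admissible p /\ integralR p = 1.
Proof.
have E : (\int[lebesgue_measure]_x (p x)%:E = 1)%E -> integralR p = 1.
  by move=> h; rewrite /integralR /Rintegral h.
split=> [[[mp p0 ip] pp cp vp gp]|[ap ip]].
  split; last exact: E.
  split=> // [j j4|]; first by apply/rapid_decayP => [|m m0]; [case: cp => _; exact|exact: vp].
  apply/poly_growthP => // j /andP[_ j4] x; apply: cvgM.
    by case: cp => _; exact.
  by apply: cvgV; [rewrite gt_eqF|case: cp => _ /(_ 0%N isT); exact].
have [p0 cp rp gp] := ap.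
split=> //.
- split.
  + by apply: continuous_measurable_fun; exact: (admissible_continuous ap (leq0n 4)).
  + by move=> x; exact: ltW.
  + by rewrite (integralR_EFin (admissible_integrable ap)) ip.
- move=> m j m0 j4; apply: (rapid_decayP _).2 => //; last exact: rp.
  exact: (admissible_continuous ap j4).
- apply/(@poly_growthP _ (ratio p)) => //.
  by move=> j /andP[_ j4]; exact: ratio_continuous.
Qed.

Lemma is_derive_ratio p j x : admissible p -> (j < 4)%N ->
  is_derive x 1 (ratio p j) (ratio p j.+1 x - ratio p j x * ratio p 1 x).
Proof.
move=> [p0 cp _ _] j4; apply: is_derive_div.
- by rewrite gt_eqF.
- exact: cont_derivatives_is_derive cp j4.
- exact: (@cont_derivatives_is_derive _ 4 p 0%N).
Qed.

(** Derivatives of ln p as polynomials in the ratios p^(j)/p. *)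
Definition log_derivative p (j : nat) : R -> R :=
  match j with
  | 0 => fun x => ln (p x)
  | 1 => ratio p 1
  | 2 => fun x => ratio p 2 x - ratio p 1 x * ratio p 1 x
  | 3 => fun x => ratio p 3 x - 3 * (ratio p 1 x * ratio p 2 x)
           + 2 * (ratio p 1 x * (ratio p 1 x * ratio p 1 x))
  | _ => fun x => ratio p 4 x - 4 * (ratio p 1 x * ratio p 3 x)
           - 3 * (ratio p 2 x * ratio p 2 x)
           + 12 * (ratio p 1 x * (ratio p 1 x * ratio p 2 x))
           - 6 * (ratio p 1 x * (ratio p 1 x * (ratio p 1 x * ratio p 1 x)))
  end.

Lemma is_derive_log_derivative p j x : admissible p -> (j < 4)%N ->
  is_derive x 1 (log_derivative p j) (log_derivative p j.+1 x).
Proof.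
move=> ap; have [p0 cp _ _] := ap.
have d1 := is_derive_ratio x ap (isT : (1 < 4)%N).
have d2 := is_derive_ratio x ap (isT : (2 < 4)%N).
have d3 := is_derive_ratio x ap (isT : (3 < 4)%N).
case: j => [|[|[|[|//]]]] _ /=.
- have dp := @cont_derivatives_is_derive _ 4 p 0%N x cp isT.
  rewrite /ratio mulrC; apply: (@is_derive1_comp _ (@ln R) p) => //.
  exact: is_derive1_ln.
- exact: d1.
- apply: is_derive_eq (is_derive_sub d2 (is_derive_mul d1 d1)) _.
  move: (ratio p 1 x) (ratio p 2 x) (ratio p 3 x) => r1 r2 r3; ring.
- have d12 := is_derive_mul d1 d2; have d111 := is_derive_mul d1 (is_derive_mul d1 d1).
  apply: is_derive_eq (is_derive_add (is_derive_sub d3 (is_derive_scale 3 d12))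
    (is_derive_scale 2 d111)) _.
  by move: (ratio p 1 x) (ratio p 2 x) (ratio p 3 x) (ratio p 4 x) => *; ring.
Qed.

Lemma log_derivativeE p j : admissible p -> (j <= 4)%N ->
  derive1n j (fun x => ln (p x)) = log_derivative p j.
Proof.
move=> ap; apply: (@derive1n_chain _ 4 (log_derivative p)) => i x.
exact: is_derive_log_derivative.
Qed.

Lemma ratio_tempered p j : admissible p -> (1 <= j <= 4)%N -> tempered (ratio p j).
Proof.
move=> ap j4; split; last by case: ap => _ _ _; exact.
by apply: ratio_continuous => //; case/andP: j4.
Qed.

Lemma log_derivative_tempered p j : admissible p -> (j <= 4)%N ->
  tempered (log_derivative p j).
Proof.
move=> ap; have g i : (1 <= i <= 4)%N -> tempered (ratio p i) by exact: ratio_tempered.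
have k (a : R) : tempered (fun=> a) by exact: tempered_cst.
have g1 := g 1 isT; have g2 := g 2 isT; have g3 := g 3 isT; have g4 := g 4 isT.
have m11 := temperedM g1 g1; have m12 := temperedM g1 g2; have m111 := temperedM g1 m11.
case: j => [|[|[|[|[|//]]]]] _; last first.
- exact: (temperedB (temperedD (temperedB (temperedB g4
    (temperedM (k 4) (temperedM g1 g3))) (temperedM (k 3) (temperedM g2 g2)))
    (temperedM (k 12) (temperedM g1 m12))) (temperedM (k 6) (temperedM g1 m111))).
- exact: (temperedD (temperedB g3 (temperedM (k 3) m12)) (temperedM (k 2) m111)).
- exact: (temperedB g2 m11).
- exact: g1.
split; first by apply: is_derive_continuous => x; exact: is_derive_log_derivative.
have [_ [C [n [C0 HC]]]] := g1.
apply: (@poly_growth_le _ _ (fun x => `|ln (p 0)| + C * (1 + `|x|) ^+ n * `|x|)); last first.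
  have w := poly_growth_norm (poly_growth_id R).
  have [_ kC] := k C; have [_ k1] := k 1; have [_ kp] := k `|ln (p 0)|.
  exact: (poly_growthD kp (poly_growthM (poly_growthM kC (poly_growthX n (poly_growthD k1 w))) w)).
move=> x; have [th th01] := @mean_value _ (log_derivative p 0) (ratio p 1) 0 x
  (fun th _ => @is_derive_log_derivative _ 0 _ ap isT).
rewrite subr0 add0r /= => /eqP; rewrite subr_eq => /eqP ->.
have w0 : 0 <= C * (1 + `|x|) ^+ n * `|x| by rewrite !mulr_ge0 // exprn_ge0 // weight_ge0.
rewrite [leRHS]ger0_norm ?addr_ge0 // addrC.
apply: le_trans (ler_normD _ _) _; rewrite lerD2l normrM; apply: ler_wpM2r => //.
apply: le_trans (HC _) _; apply: ler_wpM2l => //.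
apply: lerXn2r; rewrite ?nnegrE ?weight_ge0 // lerD2l normrM.
by case/andP: th01 => t0 t1; rewrite ger0_norm // ler_piMl.
Qed.

End Admissible.

(** * Differentiation under the integral sign *)

Section DifferenceQuotient.
Variable R : realType.

Definition step (n : nat) : R := n.+2%:R^-1.

Lemma step_gt0 n : 0 < step n. Proof. by rewrite invr_gt0 ltr0n. Qed.

Lemma step_le n : step n <= 2^-1.
Proof. by rewrite lef_pV2 ?posrE ?ltr0n // ler_nat. Qed.

Lemma cvg_step : step n @[n --> \oo] --> 0.
Proof.
have := @cvg_harmonic R; rewrite -(cvg_shiftS (@harmonic R)) /=.
by apply: cvg_trans; apply: near_eq_cvg; near=> n.
Unshelve. all: by end_near. Qed.

Lemma cvg_quotient (g : R -> R) (dg : R) : is_derive (0 : R) 1 g dg ->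
  (g (step n) - g 0) / step n @[n --> \oo] --> dg.
Proof.
move=> [dg1 dg2].
have h : h^-1 *: (g (h *: (1 : R) + 0) - g 0) @[h --> 0^'] --> dg.
  by rewrite -dg2; exact: dg1.
have s : step n @[n --> \oo] --> (0 : R)^'.
  move=> A A0.
  have H : \forall n \near \oo, step n != 0 -> A (step n) := cvg_step A0.
  have {}H : \forall n \near \oo, A (step n).
    by apply: filterS H => n; apply; exact: (lt0r_neq0 (step_gt0 n)).
  exact: H.
have := cvg_comp _ _ s h; apply: cvg_trans; apply: near_eq_cvg; near=> n.
by rewrite /= addr0 [step n *: 1]mulr1 /GRing.scale /= mulrC.
Unshelve. all: by end_near. Qed.

(** One-sided differentiation under the integral sign at 0: the difference
    quotients are dominated by the mean value theorem. *)
Lemma cvg_difference_quotient (G dG : R -> R -> R) (w D : R -> R) :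
  (forall t x : R, 0 <= t <= 2^-1 -> is_derive t 1 (fun s => G s x) (dG t x)) ->
  (forall t : R, 0 <= t <= 2^-1 -> integrableR (fun x => G t x * w x)) ->
  measurable_fun setT (fun x => dG 0 x * w x) ->
  integrableR D ->
  (forall t x : R, 0 <= t <= 2^-1 -> `|dG t x * w x| <= D x) ->
  (integralR (fun x => G (step n) x * w x) - integralR (fun x => G 0 x * w x))
    / step n @[n --> \oo] --> integralR (fun x => dG 0 x * w x).
Proof.
move=> dGE iG mdG iD dD.
have s01 n : 0 <= step n <= 2^-1 by rewrite (ltW (step_gt0 n)) step_le.
have z01 : 0 <= (0 : R) <= 2^-1 by rewrite lexx invr_ge0 ler0n.
pose Q n x := (step n)^-1 * (G (step n) x * w x - G 0 x * w x).
have iQ n : integrableR (Q n).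
  by apply: integrableRZ; apply: integrableRB; exact: iG.
have QE n : integralR (Q n) = (integralR (fun x => G (step n) x * w x)
    - integralR (fun x => G 0 x * w x)) / step n.
  rewrite mulrC -(integralRB (iG _ (s01 n)) (iG _ z01)) integralRZ //.
  exact: (integrableRB (iG _ (s01 n)) (iG _ z01)).
under eq_fun do rewrite -QE.
apply: (@dominated_convergenceR _ _ _ D) => //.
- move=> n; have /integrableP[h _] := iQ n; exact/measurable_EFinP.
- move=> x.
  have -> : (fun n => Q n x) = (fun n => (G (step n) x - G 0 x) / step n * w x).
    by apply/funext => n; rewrite /Q; ring.
  apply: cvgM; last exact: cvg_cst.
  exact: (cvg_quotient (dGE 0 x z01)).
- move=> n x; rewrite /Q.
  have inner th : 0 <= th <= 1 -> 0 <= 0 + th * (step n - 0) <= 2^-1.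
    case/andP=> t0 t1; rewrite subr0 add0r mulr_ge0 ?(ltW (step_gt0 n)) //=.
    apply: le_trans (step_le n); rewrite -[leRHS]mul1r.
    by rewrite ler_wpM2r ?(ltW (step_gt0 n)).
  have [th th01] := @mean_value _ (fun s => G s x) (fun s => dG s x) 0 (step n)
    (fun th h => dGE _ x (inner th h)).
  rewrite -mulrBl => ->; have := dD _ x (inner th th01).
  rewrite subr0 add0r => h.
  have sn : step n != 0 by rewrite gt_eqF // step_gt0.
  by rewrite (_ : _^-1 * _ = dG (th * step n) x * w x) //; field.
Unshelve. all: by end_near. Qed.

End DifferenceQuotient.

(** * Combinations of densities *)

Section RowGrowth.
Variable R : realType.

(** The bound is stated for every majorant h of the coordinates, so that it
    composes with pointwise bounds on jets. *)
Definition row_growth n (f : 'rV[R]_n -> R) := exists (C : R) (N : nat),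
  0 <= C /\ forall (v : 'rV[R]_n) (h : R), (forall i, `|v 0 i| <= h) -> `|f v| <= C * (1 + h) ^+ N.

Lemma classR_growth k (K : 'rV[R]_k.+2 -> R) s :
  classR R k K -> (size s <= 2 * k)%N -> row_growth (partials s K).
Proof.
move=> [_ [C [r [C0 r0 H]]]] sk.
exists C, (k.+2 * (Num.truncn r).+1)%N; split=> [|v h vh]; first exact: ltW.
have h0 : 0 <= h by exact: le_trans (normr_ge0 _) (vh ord0).
have P1 : 1 <= 1 + h by rewrite lerDl.
have P0 : 0 <= 1 + h by exact: le_trans ler01 P1.
apply: le_trans (H s v sk) _; apply: ler_wpM2l; first exact: ltW.
have pr : \prod_(i < k.+2) (1 + `|v 0 i|) <= (1 + h) ^+ k.+2.
  have := @ler_prod R 'I_k.+2 (index_enum _) predT (fun i => 1 + `|v 0 i|) (fun=> 1 + h).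
  rewrite prodr_const card_ord; apply => i _.
  by rewrite weight_ge0 lerD2l vh.
have pr0 : 0 <= \prod_(i < k.+2) (1 + `|v 0 i|).
  by apply: prodr_ge0 => i _; exact: weight_ge0.
apply: le_trans (_ : ((1 + h) ^+ k.+2) `^ r <= _).
  by apply: ge0_ler_powR; rewrite ?nnegrE ?exprn_ge0 // ltW.
rewrite exprM -[leRHS]powR_mulrn ?exprn_ge0 //; apply: ler_powR.
  exact: exprn_ege1.
by apply: ltW; exact: truncnS_gt.
Qed.

Lemma poly_growth_sum n (f : 'I_n -> R -> R) :
  (forall i, poly_growth (f i)) -> poly_growth (fun x => \sum_i f i x).
Proof.
elim: n f => [f _|n IH f Hf].
  by under eq_fun do rewrite big_ord0; exact: poly_growth_cst.
under eq_fun do rewrite big_ord_recl.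
by apply: poly_growthD => //; exact: IH.
Qed.

Lemma row_growth_comp n (f : 'rV[R]_n -> R) (g : R -> 'rV[R]_n) :
  row_growth f -> (forall i, poly_growth (fun x => g x 0 i)) ->
  poly_growth (fun x => f (g x)).
Proof.
move=> [C [N [C0 H]]] gi.
apply: (@poly_growth_le _ _ (fun x => C * (1 + \sum_i `|g x 0 i|) ^+ N)).
  move=> x; apply: le_trans (H (g x) (\sum_i `|g x 0 i|) _) (ler_norm _).
  move=> i; rewrite (bigD1 i) //= lerDl; exact: sumr_ge0.
apply: poly_growthM; first exact: poly_growth_cst.
apply: poly_growthX; apply: poly_growthD; first exact: poly_growth_cst.
by apply: poly_growth_sum => i; exact: poly_growth_norm.
Qed.

Lemma continuous_row n (g : R -> 'rV[R]_n) :
  (forall i, continuous (fun x => g x 0 i)) -> continuous g.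
Proof.
move=> gc x; apply/cvgrPdist_le => e e0.
have H i : \forall y \near nbhs x, `|g x 0 i - g y 0 i| <= e.
  have c : {for x, continuous (fun y => g y 0 i)} by exact: gc.
  by move/cvgrPdist_le : c; exact.
have {}H : \forall y \near nbhs x, forall i, `|g x 0 i - g y 0 i| <= e.
  by apply: filter_forall.
near=> y; apply: norm_row_le => [|i]; first exact: ltW.
by rewrite !mxE; move: i; near: y.
Unshelve. all: by end_near. Qed.

Lemma continuous_comp_row n (f : 'rV[R]_n -> R) (g : R -> 'rV[R]_n) :
  continuous f -> (forall i, continuous (fun x => g x 0 i)) ->
  continuous (fun x => f (g x)).
Proof.
move=> cf cg x; apply: (@cvg_comp _ _ _ g f (nbhs x) (nbhs (g x))).
  exact: (continuous_row cg).
exact: cf.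
Qed.

End RowGrowth.

Section Combination.
Variable R : realType.
Implicit Types (p q : R -> R) (x : R).

Lemma derive1n_comb (a b : R) p q j : cont_derivatives 4 p -> cont_derivatives 4 q ->
  (j <= 4)%N -> derive1n j (fun x => a * p x + b * q x) =
  fun x => a * derive1n j p x + b * derive1n j q x.
Proof.
move=> cp cq; apply: (@derive1n_chain _ 4 (fun j x => a * derive1n j p x + b * derive1n j q x)).
by move=> i x i4; apply: is_derive_add; apply: is_derive_scale;
    [exact: cont_derivatives_is_derive cp i4|exact: cont_derivatives_is_derive cq i4].
Qed.

Lemma comb_gt0 (a b : R) p q x : 0 <= a -> 0 <= b -> 0 < a + b -> 0 < p x -> 0 < q x ->
  0 < a * p x + b * q x.
Proof.
rewrite le_eqVlt => /orP[/eqP <-|a0] b0 ab px qx.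
  by rewrite mul0r add0r mulr_gt0 //; rewrite add0r in ab.
by apply: ltr_wpDr; [exact: mulr_ge0 (ltW _)|exact: mulr_gt0].
Qed.

(** The ratios of a combination are weighted means of those of p and q. *)
Lemma ratio_comb_le (a b : R) p q j x : 0 <= a -> 0 <= b -> 0 < a + b ->
  admissible p -> admissible q -> (j <= 4)%N ->
  `|ratio (fun x => a * p x + b * q x) j x| <= `|ratio p j x| + `|ratio q j x|.
Proof.
move=> a0 b0 ab [p0 cp _ _] [q0 cq _ _] j4.
have c0 := comb_gt0 a0 b0 ab (p0 x) (q0 x).
rewrite /ratio derive1n_comb // normrM normfV (gtr0_norm c0) ler_pdivrMr //.
rewrite !normrM !normfV (gtr0_norm (p0 x)) (gtr0_norm (q0 x)).
apply: le_trans (ler_normD _ _) _; rewrite !normrM (ger0_norm a0) (ger0_norm b0).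
have P0 := p0 x; have Q0 := q0 x.
have := normr_ge0 (derive1n j p x); have := normr_ge0 (derive1n j q x).
have pn : p x != 0 by rewrite gt_eqF.
have qn : q x != 0 by rewrite gt_eqF.
move: (`|derive1n j p x|) (`|derive1n j q x|) (p x) (q x) P0 Q0 pn qn {c0} => A B P Q P0 Q0 pn qn B0 A0.
have -> : (A / P + B / Q) * (a * P + b * Q) = a * A + b * B + (A / P * (b * Q) + B / Q * (a * P)).
  by field; rewrite pn qn.
rewrite lerDl addr_ge0 // mulr_ge0 // ?divr_ge0 ?mulr_ge0 //; exact: ltW.
Qed.

Lemma admissible_comb (a b : R) p q : 0 <= a -> 0 <= b -> 0 < a + b ->
  admissible p -> admissible q -> admissible (fun x => a * p x + b * q x).
Proof.
move=> a0 b0 ab ap aq; have [p0 cp rp gp] := ap; have [q0 cq rq gq] := aq.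
split.
- by move=> x; exact: comb_gt0.
- apply: (@cont_derivatives_chain _ 4 (fun j x => a * derive1n j p x + b * derive1n j q x)).
    by move=> i x i4; apply: is_derive_add; apply: is_derive_scale;
    [exact: cont_derivatives_is_derive cp i4|exact: cont_derivatives_is_derive cq i4].
  by apply: continuous_add; apply: continuous_mul; (try exact: continuous_cst);
    exact: admissible_continuous.
- move=> j j4; rewrite derive1n_comb //.
  by apply: rapid_decayD; apply: rapid_decayZ; [exact: rp|exact: rq].
- move=> j /andP[j1 j4].
  apply: (@poly_growth_le _ _ (fun x => `|ratio p j x| + `|ratio q j x|)).
    move=> x; rewrite [leRHS]ger0_norm ?addr_ge0 //.
    exact: ratio_comb_le.
  by apply: poly_growthD; apply: poly_growth_norm; apply: (ratio_tempered _ _).2; rewrite ?j1.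
Qed.

Lemma mixtureE (t : R) p q : mixture t p q = fun x => t * p x + (1 - t) * q x.
Proof. by []. Qed.

Lemma classP_comb (a b : R) p q : 0 <= a -> 0 <= b -> 0 < a + b ->
  admissible p -> admissible q -> a * integralR p + b * integralR q = 1 ->
  classP R (fun x => a * p x + b * q x).
Proof.
move=> a0 b0 ab ap aq i1; apply/classPE; split; first exact: admissible_comb.
have ip := admissible_integrable ap; have iq := admissible_integrable aq.
by rewrite integralRD ?integralRZ //; exact: integrableRZ.
Qed.

Lemma classP_mixture (t : R) p q : 0 <= t <= 1 -> classP R p -> classP R q ->
  classP R (mixture t p q).
Proof.
move=> /andP[t0 t1] /classPE[ap ip] /classPE[aq iq].
by apply: classP_comb; rewrite ?subr_ge0 // ?ip ?iq; lra.
Qed.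

Lemma admissible_mixture (t : R) p q : 0 <= t <= 1 -> admissible p -> admissible q ->
  admissible (mixture t p q).
Proof.
by move=> /andP[t0 t1] ap aq; apply: admissible_comb; rewrite ?subr_ge0 //; lra.
Qed.

Lemma ln_mixture_le (t : R) p q x : 0 <= t <= 1 -> 0 < p x -> 0 < q x ->
  `|ln (mixture t p q x)| <= `|ln (p x)| + `|ln (q x)|.
Proof.
move=> /andP[t0 t1] p0 q0; rewrite /mixture.
move: (p x) (q x) p0 q0 => P Q P0 Q0; set c := t * P + _.
have c0 : 0 < c by rewrite /c; nra.
have lnle (a b : R) : 0 < a -> 0 < b -> a <= b -> ln a <= ln b.
  by move=> a0 b0 ab; rewrite ler_ln ?posrE.
have := ler_norm (ln P); have := ler_norm (- ln P); have := ler_norm (ln Q).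
have := ler_norm (- ln Q); rewrite !normrN ler_norml.
have [PQ|QP] := leP P Q.
  have := lnle _ _ P0 c0 (_ : P <= c); have := lnle _ _ c0 Q0 (_ : c <= Q).
  rewrite /c; move=> /(_ ltac:(nra)) h1 /(_ ltac:(nra)) h2; lra.
have := lnle _ _ Q0 c0 (_ : Q <= c); have := lnle _ _ c0 P0 (_ : c <= P).
rewrite /c; move=> /(_ ltac:(nra)) h1 /(_ ltac:(nra)) h2; lra.
Qed.

End Combination.

(** * Jets of mixtures *)

Section Jets.
Variable R : realType.
Implicit Types (p q : R -> R) (x t : R).

Definition log_jet k p x : 'rV[R]_k.+2 :=
  \row_(i < k.+2) if (i : nat) is j.+1 then log_derivative p j x else x.

Lemma jetE k p x : admissible p -> (k <= 4)%N -> jet k p x = log_jet k p x.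
Proof.
move=> ap k4; apply/rowP => i; rewrite !mxE; case: i => -[//|j] /= jk.
by rewrite (log_derivativeE ap) //; apply: leq_trans k4.
Qed.

Lemma log_jet_tempered k p i : admissible p -> (k <= 4)%N ->
  tempered (fun x => log_jet k p x 0 i).
Proof.
move=> ap k4; under eq_fun do rewrite mxE; case: i => -[|j] /= jk.
  by split; [move=> x; exact: cvg_id|exact: poly_growth_id].
by apply: log_derivative_tempered => //; apply: leq_trans k4.
Qed.

Lemma comp_jet_tempered k (f : 'rV[R]_k.+2 -> R) p : admissible p -> (k <= 4)%N ->
  continuous f -> row_growth f -> tempered (fun x => f (log_jet k p x)).
Proof.
move=> ap k4 cf gf; have l i := log_jet_tempered i ap k4; split.
  by apply: continuous_comp_row => // i; have [] := l i.
by apply: row_growth_comp => // i; have [] := l i.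
Qed.

Lemma comp_jet_integrable k (f : 'rV[R]_k.+2 -> R) p w : admissible p -> (k <= 4)%N ->
  continuous f -> row_growth f -> decaying w ->
  integrableR (fun x => f (log_jet k p x) * w x).
Proof. by move=> ap k4 cf gf dw; exact: decaying_integrable (decayingM (comp_jet_tempered _ _ _ _) dw). Qed.

(** Uniformity in t is what dominates the integrands when t varies. *)
Lemma mixture_jet_bound k p q : (k <= 2)%N -> admissible p -> admissible q ->
  exists h : R -> R, [/\ poly_growth h, forall x, 0 <= h x &
    forall t x i, 0 <= t <= 1 -> `|log_jet k (mixture t p q) x 0 i| <= h x].
Proof.
move=> k2 ap aq.
pose r1 x := `|ratio p 1 x| + `|ratio q 1 x|; pose r2 x := `|ratio p 2 x| + `|ratio q 2 x|.
pose l x := `|log_derivative p 0 x| + `|log_derivative q 0 x|.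
have g1 : poly_growth r1.
  by apply: poly_growthD; apply: poly_growth_norm; apply: (ratio_tempered _ _).2.
have g2 : poly_growth r2.
  by apply: poly_growthD; apply: poly_growth_norm; apply: (ratio_tempered _ _).2.
have gl : poly_growth l.
  by apply: poly_growthD; apply: poly_growth_norm; apply: (log_derivative_tempered _ _).2.
have l0 x : 0 <= l x by exact: addr_ge0.
have r10 x : 0 <= r1 x by exact: addr_ge0.
have r20 x : 0 <= r2 x by exact: addr_ge0.
exists (fun x => `|x| + l x + r1 x + r2 x + r1 x * r1 x); split.
- exact: (poly_growthD (poly_growthD (poly_growthD (poly_growthD
    (poly_growth_norm (poly_growth_id R)) gl) g1) g2) (poly_growthM g1 g1)).
- by move=> x; rewrite !addr_ge0 // mulr_ge0.
move=> t x i t01; have [p0 _ _ _] := ap; have [q0 _ _ _] := aq.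
have m0 : 0 <= r1 x * r1 x by rewrite mulr_ge0.
have n0 := normr_ge0 x; have L0 := l0 x; have R1 := r10 x; have R2 := r20 x.
have h0 : `|log_derivative (mixture t p q) 0 x| <= l x by exact: ln_mixture_le.
have [t0 t1] := andP t01.
have hr j : (j <= 4)%N -> `|ratio (mixture t p q) j x| <= `|ratio p j x| + `|ratio q j x|.
  by move=> j4; apply: ratio_comb_le; rewrite ?subr_ge0 //; lra.
have h1 : `|ratio (mixture t p q) 1 x| <= r1 x by exact: hr.
have h2 : `|ratio (mixture t p q) 2 x| <= r2 x by exact: hr.
have h3 : `|ratio (mixture t p q) 2 x - ratio (mixture t p q) 1 x * ratio (mixture t p q) 1 x|
    <= r2 x + r1 x * r1 x.
  apply: le_trans (ler_normB _ _) _; apply: lerD => //; rewrite normrM.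
  exact: ler_pM.
rewrite mxE; case: i => -[|[|[|[|j]]]] /= jk.
- clear -m0 n0 L0 R1 R2; lra.
- apply: le_trans h0 _; clear -m0 n0 L0 R1 R2; lra.
- apply: le_trans h1 _; clear -m0 n0 L0 R1 R2; lra.
- apply: le_trans h3 _; clear -m0 n0 L0 R1 R2; lra.
- by have := leq_trans jk (_ : (k.+2 <= 4)%N); rewrite !ltnS => /(_ k2).
Qed.

(** The derivatives in t of ln m, (ln m)', (ln m)'' for m = mixture t p q, when
    c is the value of m and r gives its ratios m^(i)/m; with c = 1 they are
    multiplied by the density m. *)
Definition jet_velocity (c : R) p q (r : nat -> R) (j : nat) x : R :=
  let h i := derive1n i p x - derive1n i q x in
  match j with
  | 0 => h 0%N
  | 1 => h 1%N - r 1%N * h 0%N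
  | _ => h 2%N - r 2%N * h 0%N - (r 1%N + r 1%N) * (h 1%N - r 1%N * h 0%N)
  end / c.

Lemma derive1n_mixture t p q j x : cont_derivatives 4 p -> cont_derivatives 4 q ->
  (j <= 4)%N -> derive1n j (mixture t p q) x = t * derive1n j p x + (1 - t) * derive1n j q x.
Proof. by move=> cp cq j4; rewrite mixtureE derive1n_comb. Qed.

Lemma is_derive_affine t (a b : R) :
  is_derive t 1 (fun s => s * a + (1 - s) * b) (a - b).
Proof.
have h1 := is_derive_mul (@is_derive_id R R t 1) (@is_derive_cst R R R a t 1).
have h2 := is_derive_mul (is_derive_sub (@is_derive_cst R R R 1 t 1) (@is_derive_id R R t 1))
  (@is_derive_cst R R R b t 1).
apply: is_derive_eq (is_derive_add h1 h2) _; rewrite /cst /=; ring.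
Qed.

Lemma is_derive_mixture_ratio p q j x t : cont_derivatives 4 p -> cont_derivatives 4 q ->
  (j <= 4)%N -> 0 < mixture t p q x ->
  is_derive t 1 (fun s => ratio (mixture s p q) j x)
   ((derive1n j p x - derive1n j q x - ratio (mixture t p q) j x * (p x - q x)) / mixture t p q x).
Proof.
move=> cp cq j4 c0.
have E : (fun s => ratio (mixture s p q) j x) =
    (fun s => (s * derive1n j p x + (1 - s) * derive1n j q x) / (s * p x + (1 - s) * q x)).
  by apply/funext => s; rewrite /ratio derive1n_mixture.
have lin := is_derive_affine t.
rewrite E; have cn : t * p x + (1 - t) * q x != 0 by exact: lt0r_neq0.
have h := @is_derive_div R (fun s => s * derive1n j p x + (1 - s) * derive1n j q x)
  (fun s => s * p x + (1 - s) * q x) _ _ t cn (lin _ _) (lin _ _).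
apply: is_derive_eq h _; rewrite /ratio derive1n_mixture // /mixture.
move: (t * p x + _) cn => c cn.
by move: (derive1n j p x) (derive1n j q x) (p x) (q x) => A B P Q; field.
Qed.

Lemma is_derive_mixture_log p q j x t : cont_derivatives 4 p -> cont_derivatives 4 q ->
  (j <= 2)%N -> 0 < mixture t p q x ->
  is_derive t 1 (fun s => log_derivative (mixture s p q) j x)
   (jet_velocity (mixture t p q x) p q (fun i => ratio (mixture t p q) i x) j x).
Proof.
move=> cp cq j2 c0.
have d1 := is_derive_mixture_ratio cp cq (isT : (1 <= 4)%N) c0.
have d2 := is_derive_mixture_ratio cp cq (isT : (2 <= 4)%N) c0.
case: j j2 => [|[|[|//]]] _ /=.
- have h := @is_derive1_comp _ (@ln R) (fun s => mixture s p q x) t _ _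
    (is_derive1_ln c0) (is_derive_affine t (p x) (q x)).
  by apply: is_derive_eq h _; rewrite /jet_velocity /= mulrC.
- exact: d1.
- apply: is_derive_eq (is_derive_sub d2 (is_derive_mul d1 d1)) _.
  rewrite /jet_velocity /=.
  move: (ratio _ 1 x) (mixture t p q x)^-1 => r c.
  rewrite [RHS]mulrBl; congr (_ - _).
  by move: (derive1n 1 p x - _ - _) => b; ring.
Qed.

End Jets.

(** * First variation of an expectation *)

Section Variation.
Variable R : realType.
Implicit Types (p q : R -> R) (x t : R).

Lemma mixture0 p q : mixture 0 p q = q.
Proof. by apply/funext => x; rewrite /mixture mul0r add0r subr0 mul1r. Qed.

Lemma jet_velocity_bound p q : admissible p -> admissible q ->
  exists B : R -> R, [/\ rapid_decay B, forall x, 0 <= B x &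
    forall t x j, 0 <= t <= 2^-1 -> (j <= 2)%N ->
      `|jet_velocity (mixture t p q x) p q (fun i => ratio (mixture t p q) i x) j x
        * q x| <= B x].
Proof.
move=> ap aq; have [p0 cp rp gp] := ap; have [q0 cq rq gq] := aq.
pose r i x := `|ratio p i x| + `|ratio q i x|.
pose d i x := `|derive1n i p x| + `|derive1n i q x|.
have rg i : (1 <= i <= 4)%N -> poly_growth (r i).
  by move=> i4; apply: poly_growthD; apply: poly_growth_norm; apply: (ratio_tempered _ _).2.
have dr i : (i <= 4)%N -> rapid_decay (d i).
  by move=> i4; apply: rapid_decayD; apply: rapid_decay_norm; [exact: rp|exact: rq].
have r0 i x : 0 <= r i x by exact: addr_ge0.
have d0 i x : 0 <= d i x by exact: addr_ge0.
pose e x := d 1%N x + r 1%N x * d 0%N x.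
pose B x := 2 * (d 0%N x + e x + (d 2%N x + r 2%N x * d 0%N x) + (r 1%N x + r 1%N x) * e x).
have re : rapid_decay e.
  by apply: rapid_decayD; [exact: dr|apply: rapid_decayMl; [exact: rg|exact: dr]].
have e0 x : 0 <= e x by rewrite addr_ge0 // mulr_ge0.
exists B; split.
- apply: rapid_decayZ.
  exact: (rapid_decayD (rapid_decayD (rapid_decayD (dr 0%N isT) re)
    (rapid_decayD (dr 2%N isT) (rapid_decayMl (rg 2%N isT) (dr 0%N isT))))
    (rapid_decayMl (poly_growthD (rg 1%N isT) (rg 1%N isT)) re)).
- by move=> x; rewrite mulr_ge0 // !addr_ge0 // !mulr_ge0 // addr_ge0.
move=> t x j /andP[t0 t1] j2.
have t01 : 0 <= t <= 1 by rewrite t0 /=; lra.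
have qc : q x <= 2 * mixture t p q x.
  by have := p0 x; have := q0 x; rewrite /mixture; clear -t0 t1; move: (p x) (q x) => P Q; nra.
have c0 : 0 < mixture t p q x by have := q0 x; lra.
have hr i : (i <= 4)%N -> `|ratio (mixture t p q) i x| <= r i x.
  by move=> i4; apply: ratio_comb_le; rewrite ?subr_ge0 //; clear -t0 t1; lra.
have hd i : `|derive1n i p x - derive1n i q x| <= d i x by exact: ler_normB.
have scale (a b : R) : 0 <= b -> `|a| <= b -> `|a / mixture t p q x * q x| <= 2 * b.
  move=> b0 ab; rewrite !normrM normfV (gtr0_norm c0) (gtr0_norm (q0 x)).
  rewrite mulrAC ler_pdivrMr // -mulrA [b * _]mulrC mulrA.
  by apply: le_trans (ler_pM (normr_ge0 a) (ltW (q0 x)) ab qc) _; rewrite mulrC.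
have h1 : `|derive1n 1 p x - derive1n 1 q x
    - ratio (mixture t p q) 1 x * (p x - q x)| <= e x.
  apply: le_trans (ler_normB _ _) _; apply: lerD; first exact: hd.
  by rewrite normrM; apply: ler_pM; [exact: normr_ge0|exact: normr_ge0|exact: hr|exact: (hd 0%N)].
have D0 := d0 0%N x; have D2 := d0 2%N x; have E0 := e0 x; have R1 := r0 1%N x.
have RD : 0 <= r 2%N x * d 0%N x by rewrite mulr_ge0.
have RE : 0 <= (r 1%N x + r 1%N x) * e x by rewrite mulr_ge0 // addr_ge0.
suff [b b0 [hb bB]] : exists2 b, 0 <= b &
    `|jet_velocity (mixture t p q x) p q (fun i => ratio (mixture t p q) i x) j x * q x|
      <= 2 * b /\ b <= B x / 2.
  by apply: le_trans hb _; move: bB; rewrite ler_pdivlMr // mulrC.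
have BE : B x / 2 = d 0%N x + e x + (d 2%N x + r 2%N x * d 0%N x) + (r 1%N x + r 1%N x) * e x.
  by rewrite /B mulrC mulKf.
rewrite BE; case: j j2 => [|[|[|//]]] _.
- exists (d 0%N x) => //; split; last by clear -D2 E0 RD RE; lra.
  by apply: scale => //; exact: (hd 0%N).
- exists (e x) => //; split; last by clear -D0 D2 RD RE; lra.
  by apply: scale.
- exists (d 2%N x + r 2%N x * d 0%N x + (r 1%N x + r 1%N x) * e x).
    by rewrite !addr_ge0.
  split; last by clear -D0 E0; lra.
  apply: scale; first by rewrite !addr_ge0.
  apply: le_trans (ler_normB _ _) _; apply: lerD.
    apply: le_trans (ler_normB _ _) _; apply: lerD; first exact: hd.
    by rewrite normrM; apply: ler_pM; [exact: normr_ge0|exact: normr_ge0|exact: hr|exact: (hd 0%N)].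
  rewrite normrM; apply: ler_pM; [exact: normr_ge0|exact: normr_ge0| |exact: h1].
  by apply: le_trans (ler_normD _ _) _; apply: lerD; exact: hr.
Qed.

Lemma jet_velocity_continuous p q j : admissible p -> admissible q -> (j <= 2)%N ->
  continuous (fun x => jet_velocity 1 p q (fun i => ratio q i x) j x).
Proof.
move=> ap aq j2.
have h i : (i <= 4)%N -> continuous (fun x => derive1n i p x - derive1n i q x).
  by move=> i4; apply: continuous_sub; exact: admissible_continuous.
have r i : (i <= 4)%N -> continuous (ratio q i) by exact: ratio_continuous.
have e : continuous (fun x => derive1n 1 p x - derive1n 1 q x - ratio q 1 x * (p x - q x)).
  exact: (continuous_sub (h 1%N isT) (continuous_mul (r 1%N isT) (h 0%N isT))).
under eq_fun do rewrite /jet_velocity divr1.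
case: j j2 => [|[|[|//]]] _.
- exact: (h 0%N isT).
- exact: e.
- exact: (continuous_sub (continuous_sub (h 2%N isT) (continuous_mul (r 2%N isT) (h 0%N isT)))
    (continuous_mul (continuous_add (r 1%N isT) (r 1%N isT)) e)).
Qed.

(** The weight q cancels the density in the denominators of the velocities,
    since q <= 2 mixture t p q for t <= 1/2; this keeps the derivatives dominated
    by one rapidly decreasing function. *)
Lemma first_variation k (f : 'rV[R]_k.+2 -> R) p q : (k <= 2)%N ->
  cont_partials 1 f -> row_growth f -> (forall i, row_growth (partial i f)) ->
  admissible p -> admissible q ->
  (integralR (fun x => f (log_jet k (mixture (step R n) p q) x) * q x)
     - integralR (fun x => f (log_jet k q x) * q x)) / step R n @[n --> \oo] -->
  integralR (fun x => \sum_(i < k.+1)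
    jet_velocity 1 p q (fun i => ratio q i x) i x * partial (lift ord0 i) f (log_jet k q x)).
Proof.
move=> k2 cf gf gpf ap aq; have [p0 cp rp gp] := ap; have [q0 cq rq gq] := aq.
have k4 : (k <= 4)%N by exact: leq_trans k2 _.
have [B [rB B0 HB]] := jet_velocity_bound ap aq.
have [h [gh h0 Hh]] := mixture_jet_bound k2 ap aq.
pose v t x (i : 'I_k.+2) := if (i : nat) is j.+1 then
  jet_velocity (mixture t p q x) p q (fun i => ratio (mixture t p q) i x) j x else 0.
pose G t x := f (log_jet k (mixture t p q) x).
pose dG t x := \sum_i v t x i * partial i f (log_jet k (mixture t p q) x).
have half (t : R) : 0 <= t <= 2^-1 -> 0 <= t <= 1.
  by case/andP=> t0 t1; rewrite t0 /=; lra.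
have mpos (t : R) x : 0 <= t <= 2^-1 -> 0 < mixture t p q x.
  by move=> /half t01; have [m0 _ _ _] := admissible_mixture t01 ap aq.
have vE x (i : 'I_k.+1) : v 0 x (lift ord0 i) * q x =
    jet_velocity 1 p q (fun i => ratio q i x) i x.
  rewrite /v /= mixture0 /jet_velocity divr1 divfK //; exact: lt0r_neq0.
have E0 : (fun x => dG 0 x * q x) = (fun x => \sum_(i < k.+1)
    jet_velocity 1 p q (fun i => ratio q i x) i x * partial (lift ord0 i) f (log_jet k q x)).
  apply/funext => x; rewrite /dG big_ord_recl {1}/v /= mul0r add0r mulr_suml.
  by apply: eq_bigr => i _; rewrite -vE mixture0 mulrAC.
rewrite -E0.
have -> : (fun x => f (log_jet k q x) * q x) = (fun x => G 0 x * q x).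
  by apply/funext => x; rewrite /G mixture0.
have [C [N [C0 HC]]] : exists (C : 'I_k.+2 -> R) (N : 'I_k.+2 -> nat),
    (forall i, 0 <= C i) /\ forall i t x, 0 <= t <= 1 ->
    `|partial i f (log_jet k (mixture t p q) x)| <= C i * (1 + h x) ^+ N i.
  have [c Hc] := choice gpf; have [n Hn] := choice Hc.
  exists c, n; split=> [i|i t x t01]; first by have [] := Hn i.
  by have [_ H] := Hn i; apply: H => j; exact: Hh.
pose D x := B x * \sum_i C i * (1 + h x) ^+ N i.
have rD : rapid_decay D.
  apply: rapid_decayM => //; apply: poly_growth_sum => i; apply: poly_growthM.
    exact: poly_growth_cst.
  by apply: poly_growthX; apply: poly_growthD => //; exact: poly_growth_cst.
have [E iE DE] := rapid_decay_bound rD.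
apply: (@cvg_difference_quotient R G dG q E) => //.
- move=> t x t01; apply: (is_derive_curve (g := fun s => log_jet k (mixture s p q) x) (dg := v t x)) => //.
  move=> i; under eq_fun do rewrite mxE.
  rewrite /v; case: i => -[|j] /= jk.
    exact: is_derive_cst.
  apply: is_derive_mixture_log => //; last exact: mpos.
  by rewrite !ltnS in jk; exact: leq_trans jk k2.
- move=> t t01; apply: comp_jet_integrable => //.
  + by apply: admissible_mixture => //; exact: half.
  + exact: (cf.2 [::]).
  + exact: (admissible_decaying aq (leq0n 4)).
- rewrite E0; apply: continuous_measurable_fun.
  apply: continuous_big => [|i _]; first exact: add_continuous.
  apply: continuous_mul.
    apply: jet_velocity_continuous => //.
    by apply: leq_trans k2; rewrite -ltnS.
  apply: (comp_jet_tempered aq k4 _ _).1 => //; exact: (cf.2 [:: _]).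
- move=> t x t01; apply: le_trans (DE x).
  apply: le_trans (ler_norm _); rewrite /dG mulr_suml /D mulr_sumr.
  apply: le_trans (ler_norm_sum _ _ _) _; apply: ler_sum => i _.
  rewrite mulrAC normrM; apply: ler_pM => //; last exact: (HC _ _ _ (half _ t01)).
  rewrite /v; case: i => -[|j] /= jk; first by rewrite mul0r normr0.
  apply: HB => //.
  by rewrite !ltnS in jk; exact: leq_trans jk k2.
Qed.

End Variation.

(** * The score of a kernel *)

Lemma rowvecE (R : realType) n (t : n.-tuple R) i : rowvec t 0 i = nth 0 t i.
Proof. by rewrite mxE (tnth_nth 0). Qed.

Ltac rowvec_shift :=
  apply/rowP; case=> -[|[|[|[|?]]]] ? //; rewrite [LHS]mxE !rowvecE !mxE //=;
  rewrite ?mulr1 ?mulr0 ?add0r.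

Section Congruence.
Variable R : realType.

(** Transfers derivatives between functions on spaces of different dimensions,
    such as K and K_0. *)
Lemma partial_congr n m (f : 'rV[R]_n.+1 -> R) (g : 'rV[R]_m.+1 -> R) i j v w :
  (forall h : R, f (h *: delta_mx 0 i + v) - f v = g (h *: delta_mx 0 j + w) - g w) ->
  partial i f v = partial j g w.
Proof.
move=> E; rewrite /partial /derive.
suff -> : (fun h : R => h^-1 *: ((f \o shift v) (h *: delta_mx 0 i) - f v)) =
    (fun h => h^-1 *: ((g \o shift w) (h *: delta_mx 0 j) - g w)) by [].
by apply/funext => h; congr (_ *: _); exact: E.
Qed.

Lemma rowvec2_shift0 (h x y : R) :
  h *: delta_mx 0 0 + rowvec [tuple x; y] = rowvec [tuple h + x; y].
Proof. by rowvec_shift. Qed.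

Lemma rowvec2_shift1 (h x y : R) :
  h *: delta_mx 0 1 + rowvec [tuple x; y] = rowvec [tuple x; h + y].
Proof. by rowvec_shift. Qed.

Lemma rowvec3_shift0 (h x y z : R) :
  h *: delta_mx 0 0 + rowvec [tuple x; y; z] = rowvec [tuple h + x; y; z].
Proof. by rowvec_shift. Qed.

Lemma rowvec3_shift1 (h x y z : R) :
  h *: delta_mx 0 1 + rowvec [tuple x; y; z] = rowvec [tuple x; h + y; z].
Proof. by rowvec_shift. Qed.

Lemma rowvec3_shift2 (h x y z : R) :
  h *: delta_mx 0 2 + rowvec [tuple x; y; z] = rowvec [tuple x; y; h + z].
Proof. by rowvec_shift. Qed.

Lemma rowvec3_eta (v : 'rV[R]_3) : v = rowvec [tuple v 0 0; v 0 1; v 0 2].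
Proof.
by apply/rowP => i; rewrite rowvecE; case: i => -[|[|[|m]]] im //=; congr (v _ _);
  apply/val_inj.
Qed.

Lemma sum_ord3 (F : 'I_3 -> R) : \sum_i F i = F 0 + F 1 + F 2.
Proof.
rewrite !big_ord_recl big_ord0 addr0 addrA.
by congr (F _ + F _ + F _); apply/val_inj.
Qed.

Lemma sum_ord4 (F : 'I_4 -> R) : \sum_i F i = F 0 + F 1 + F 2 + F 3.
Proof.
rewrite !big_ord_recl big_ord0 addr0 !addrA.
by congr (F _ + F _ + F _ + F _); apply/val_inj.
Qed.

End Congruence.

Section KernelScore.
Variables (R : realType) (c : R) (K0 : 'rV[R]_2 -> R) (K : 'rV[R]_3 -> R).
Variable s : 'rV[R]_4 -> R.
Hypotheses (KE : kernel_form c K0 K) (KR : classR R 1 K) (sE : score_form c K0 s).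
Implicit Types (p q : R -> R) (x t : R).

Let K_partials : cont_partials 2 K. Proof. by have [] := KR. Qed.

Let partial1_K0 x y0 y1 :
  partial 1 K0 (rowvec [tuple x; y1]) = partial 2 K (rowvec [tuple x; y0; y1]).
Proof.
apply: partial_congr => h; rewrite rowvec2_shift1 rowvec3_shift2 !KE; ring.
Qed.

Lemma kernel_partial1 v : partial 1 K v = c.
Proof.
have -> : c = partial (1 : 'I_3) (fun v => c * v 0 1) v.
  rewrite /partial deriveMl; last by have [] := is_derive_coord v (delta_mx 0 1) 1.
  have [_ ->] := is_derive_coord v (delta_mx 0 1) 1.
  by rewrite mxE eqxx /GRing.scale /= mulr1.
apply: partial_congr => h; rewrite (rowvec3_eta v) rowvec3_shift1 !KE !rowvecE /=; ring.
Qed.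

Lemma kernel_partial12 v : partial 1 (partial 2 K) v = 0.
Proof.
rewrite -[RHS](_ : partial (1 : 'I_3) (fun=> 0) v = 0); last by rewrite partial_cst.
apply: partial_congr => h; rewrite (rowvec3_eta v) rowvec3_shift1.
by rewrite -!partial1_K0 !subrr.
Qed.

Lemma scoreE x y0 y1 y2 : s (rowvec [tuple x; y0; y1; y2]) =
  K (rowvec [tuple x; y0; y1]) - y1 * partial 2 K (rowvec [tuple x; y0; y1])
  - (partial 0 (partial 2 K) (rowvec [tuple x; y0; y1])
     + y1 * partial 1 (partial 2 K) (rowvec [tuple x; y0; y1])
     + y2 * partial 2 (partial 2 K) (rowvec [tuple x; y0; y1])).
Proof.
rewrite kernel_partial12 mulr0 addr0 sE KE (partial1_K0 x y0 y1).
have -> : partial 0 (partial 1 K0) (rowvec [tuple x; y1]) =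
    partial 0 (partial 2 K) (rowvec [tuple x; y0; y1]).
  apply: partial_congr => h; rewrite rowvec2_shift0 rowvec3_shift0.
  by rewrite !(partial1_K0 _ y0).
have -> : partial 1 (partial 1 K0) (rowvec [tuple x; y1]) =
    partial 2 (partial 2 K) (rowvec [tuple x; y0; y1]).
  apply: partial_congr => h; rewrite rowvec2_shift1 rowvec3_shift2.
  by rewrite !(partial1_K0 _ y0).
move: (partial 2 (partial 2 K) _) (partial 0 (partial 2 K) _) (partial 2 K _) (K0 _).
by move=> *; ring.
Qed.

Let P2 p x := partial 2 K (log_jet 1 p x).
Let DP2 p x := partial 0 (partial 2 K) (log_jet 1 p x)
  + log_derivative p 1 x * partial 1 (partial 2 K) (log_jet 1 p x)
  + log_derivative p 2 x * partial 2 (partial 2 K) (log_jet 1 p x).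

Let is_derive_P2 p x : admissible p -> is_derive x 1 (P2 p) (DP2 p x).
Proof.
move=> ap; have c1 : cont_partials 1 (partial 2 K) by exact: cont_partials_partial.
pose d (i : 'I_3) := if (i : nat) is j.+1 then log_derivative p j.+1 x else 1.
have h := @is_derive_curve R 2 (partial 2 K) (log_jet 1 p) d x c1.
apply: is_derive_eq (h _) _.
  move=> i; under eq_fun do rewrite mxE.
  rewrite /d; case: i => -[|j] /= jk; first exact: is_derive_id.
  by apply: is_derive_log_derivative => //; rewrite ltnS in jk; exact: leq_trans jk _.
by apply: etrans (sum_ord3 _) _; congr (_ + _ + _); exact: mul1r.
Qed.

Let s_jet p x : s (log_jet 2 p x) =
  K (log_jet 1 p x) - log_derivative p 1 x * P2 p x - DP2 p x.
Proof.
have -> : log_jet 2 p x = rowvec [tuple x; log_derivative p 0 x; log_derivative p 1 x;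
    log_derivative p 2 x].
  by apply/rowP => i; rewrite rowvecE mxE; case: i => -[|[|[|[|m]]]] im.
rewrite scoreE /P2 /DP2.
suff -> : log_jet 1 p x = rowvec [tuple x; log_derivative p 0 x; log_derivative p 1 x] by [].
by apply/rowP => i; rewrite rowvecE mxE; case: i => -[|[|[|m]]] im.
Qed.

Let K_growth : row_growth K. Proof. exact: (@classR_growth R 1 K [::] KR isT). Qed.
Let K1_growth i : row_growth (partial i K).
Proof. exact: (@classR_growth R 1 K [:: i] KR isT). Qed.
Let P2_tempered p : admissible p -> tempered (P2 p).
Proof.
by move=> ap; apply: comp_jet_tempered => //; exact: (K_partials.2 [:: 2]).
Qed.

Let DP2_tempered p : admissible p -> tempered (DP2 p).
Proof.
move=> ap; have t i : tempered (fun x => partial i (partial 2 K) (log_jet 1 p x)).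
  apply: comp_jet_tempered => //; first exact: (K_partials.2 [:: i; 2]).
  exact: (@classR_growth R 1 K [:: i; 2] KR isT).
exact: (temperedD (temperedD (t 0)
  (temperedM (log_derivative_tempered ap (isT : (1 <= 4)%N)) (t 1)))
  (temperedM (log_derivative_tempered ap (isT : (2 <= 4)%N)) (t 2))).
Qed.

Lemma kernel_jet_tempered p : admissible p -> tempered (fun x => K (log_jet 1 p x)).
Proof. by move=> ap; apply: comp_jet_tempered => //; exact: (K_partials.2 [::]). Qed.

Lemma score_jet_tempered p : admissible p -> tempered (fun x => s (log_jet 2 p x)).
Proof.
move=> ap; under eq_fun do rewrite s_jet.
exact: (temperedB (temperedB (kernel_jet_tempered ap)
  (temperedM (log_derivative_tempered ap (isT : (1 <= 4)%N)) (P2_tempered ap))) (DP2_tempered ap)).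
Qed.

(** Integrating the total derivative in the score by parts removes the second
    derivative of ln q. *)
Lemma integral_score p q : admissible p -> admissible q ->
  integralR (fun x => s (log_jet 2 q x) * p x) =
  integralR (fun x => K (log_jet 1 q x) * p x)
  + integralR (fun x => partial 2 K (log_jet 1 q x) *
      (derive1n 1 p x - ratio q 1 x * p x)).
Proof.
move=> ap aq; have [_ cp _ _] := ap.
have d0 := admissible_decaying ap (isT : (0 <= 4)%N).
have d1 := admissible_decaying ap (isT : (1 <= 4)%N).
have tP := P2_tempered aq.
have iK := decaying_integrable (decayingM (kernel_jet_tempered aq) d0).
have iP := decaying_integrable (decayingM tP
  (decayingB d1 (decayingM (ratio_tempered aq (isT : (1 <= 1 <= 4)%N)) d0))).
have dD : decaying (fun x => DP2 q x * p x + P2 q x * derive1n 1 p x).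
  exact: (decayingD (decayingM (DP2_tempered aq) d0) (decayingM tP d1)).
have iD := decaying_integrable dD.
have Z : integralR (fun x => DP2 q x * p x + P2 q x * derive1n 1 p x) = 0.
  apply: (@integralR_derivative0 _ (fun x => P2 q x * p x) _ _ dD.1 iD).
    move=> x; apply: is_derive_mul; first exact: is_derive_P2.
    exact: (@cont_derivatives_is_derive _ 4 p 0%N).
  exact: (decayingM tP d0).2.
have iS := decaying_integrable (decayingM (score_jet_tempered aq) d0).
rewrite -[LHS]addr0 -[X in _ + X]Z -(integralRD iS iD) -(integralRD iK iP).
congr integralR; apply/funext => x.
rewrite s_jet -/(P2 q x) /=.
by move: (P2 q x) (DP2 q x) (ratio q 1 x) (derive1n 1 p x) (K _) => *; ring.
Qed.

Lemma Phi_jet p : admissible p -> Phi 1 K p = integralR (fun x => K (log_jet 1 p x) * p x).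
Proof.
by move=> ap; rewrite /Phi /integralR; under eq_Rintegral do rewrite jetE //.
Qed.

Lemma integral_score_diag p : admissible p ->
  integralR (fun x => s (log_jet 2 p x) * p x) = Phi 1 K p.
Proof.
move=> ap; have [p0 _ _ _] := ap; rewrite integral_score // Phi_jet //.
rewrite [X in _ + X](_ : _ = 0) ?addr0 //.
rewrite -[RHS](mul0r (integralR p)) -integralRZ; last exact: admissible_integrable.
congr integralR; apply/funext => x; rewrite /ratio divfK ?subrr ?mulr0 ?mul0r //.
exact: lt0r_neq0.
Qed.

End KernelScore.

(** * Concave kernels have proper scores *)

Section ExpectedScore.
Variables (R : realType) (s : 'rV[R]_4 -> R).
Implicit Types (p q : R -> R).

Lemma expected_scoreE p q : admissible q ->
  integrableR (fun x => s (log_jet 2 q x) * p x) ->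
  expected_score (local_score 2 s) p q = (integralR (fun x => s (log_jet 2 q x) * p x))%:E.
Proof.
move=> aq i; rewrite -(integralR_EFin i) /expected_score /local_score.
by apply: eq_integral => x _; rewrite jetE // EFinM.
Qed.

Lemma representsP : (forall q, admissible q -> continuous (fun x => s (log_jet 2 q x))) ->
  (forall p q, admissible p -> admissible q -> integrableR (fun x => s (log_jet 2 q x) * p x)) ->
  represents_local_score 2 s.
Proof.
move=> cs is_ q /classPE[aq _].
have E : (local_score 2 s) ^~ q = EFin \o (fun x => s (log_jet 2 q x)).
  by apply/funext => x /=; rewrite /local_score jetE.
rewrite E; split=> [|p /classPE[ap _]].
  by apply/measurable_EFinP; apply: continuous_measurable_fun; exact: cs.
left; have := integral_funepos_lt_pinfty measurableT (is_ p q ap aq).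
have [p0 _ _ _] := ap.
rewrite (_ : (\int[_]_x _)%E = (\int[@lebesgue_measure R]_x
  ((fun y => (s (log_jet 2 q y) * p y)%:E : \bar R)%R^\+ x))%E) //.
apply: eq_integral => x _.
rewrite !funeposE /= -!EFin_max -EFinM; congr _%:E.
by rewrite maxr_pMl ?mul0r //; exact: ltW.
Qed.

End ExpectedScore.

Section Concavity.
Variable R : realType.
Implicit Types (p q : R -> R) (F : (R -> R) -> R).

Lemma mixture_same (t : R) p : mixture t p p = p.
Proof. by apply/funext => x; rewrite /mixture; ring. Qed.

Lemma strictly_concave_concave (Q : set (R -> R)) F :
  strictly_concave_on Q F -> concave_on Q F.
Proof.
move=> cF p q t Qp Qq /andP[t0 t1].
have [<-|pq] := pselect (p = q); first by rewrite mixture_same -mulrDl addrC subrK mul1r.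
move: t0; rewrite le_eqVlt => /orP[/eqP <-|t0].
  by rewrite mixture0 mul0r add0r subr0 mul1r.
move: t1; rewrite le_eqVlt => /orP[/eqP ->|t1].
  have -> : mixture 1 p q = p by apply/funext => x; rewrite /mixture; ring.
  by rewrite subrr mul0r addr0 mul1r.
by apply: ltW; apply: cF => //; rewrite t0.
Qed.

Lemma concave_slope_ge (Q : set (R -> R)) F p q n : concave_on Q F -> Q p -> Q q ->
  F p - F q <= (F (mixture (step R n) p q) - F q) / step R n.
Proof.
move=> cF Qp Qq; have s0 := step_gt0 R n; have s1 := step_le R n.
have s01 : 0 <= step R n <= 1 by rewrite (ltW s0) /=; lra.
rewrite ler_pdivlMr //; have := cF p q _ Qp Qq s01; lra.
Qed.

(** Slopes of a concave function decrease along a segment, so that a strict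
    inequality between p and q persists at the end [q]. *)
Lemma strictly_concave_slope_gt F p q : strictly_concave_on (classP R) F ->
  classP R p -> classP R q -> p <> q ->
  exists2 d, F p - F q < d & forall n, d <= (F (mixture (step R n) p q) - F q) / step R n.
Proof.
move=> cF Pp Pq pq; have h01 : 0 < (2^-1 : R) < 1 by rewrite invr_gt0 ltr0n /=; lra.
have h01' : 0 <= (2^-1 : R) <= 1 by case/andP: h01 => /ltW -> /ltW ->.
have h := cF p q _ Pp Pq pq h01.
have Pm : classP R (mixture 2^-1 p q) by exact: classP_mixture.
exists ((F (mixture 2^-1 p q) - F q) * 2); first by clear -h; lra.
move=> n; have s0 := step_gt0 R n; have s1 := step_le R n.
have s01 : 0 <= step R n * 2 <= 1 by rewrite mulr_ge0 ?(ltW s0) //=; lra.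
have := strictly_concave_concave cF Pm Pq s01.
have -> : mixture (step R n * 2) (mixture 2^-1 p q) q = mixture (step R n) p q.
  by apply/funext => x; rewrite /mixture; field.
rewrite ler_pdivlMr // => H; clear -H; lra.
Qed.

Lemma le_cvg_const (u : nat -> R) (a l : R) : (forall n, a <= u n) ->
  u n @[n --> \oo] --> l -> a <= l.
Proof.
move=> au ul; have <- : lim (u n @[n --> \oo]) = l by exact/cvg_lim.
by apply: limr_ge; [apply/cvg_ex; exists l|exact: nearW].
Qed.

End Concavity.

Section KernelToScore.
Variables (R : realType) (c : R) (K0 : 'rV[R]_2 -> R) (K : 'rV[R]_3 -> R).
Variable s : 'rV[R]_4 -> R.
Hypotheses (KE : kernel_form c K0 K) (KR : classR R 1 K) (sE : score_form c K0 s).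
Implicit Types (p q : R -> R) (x t : R).

Lemma kernel_score_integrable p q : admissible p -> admissible q ->
  integrableR (fun x => s (log_jet 2 q x) * p x).
Proof.
move=> ap aq; apply: decaying_integrable.
exact: (decayingM (score_jet_tempered KE KR sE aq) (admissible_decaying ap (leq0n 4))).
Qed.

Lemma kernel_represents : represents_local_score 2 s.
Proof.
apply: representsP => [q aq|p q]; first exact: (score_jet_tempered KE KR sE aq).1.
exact: kernel_score_integrable.
Qed.

Let K_partials : cont_partials 2 K. Proof. by have [] := KR. Qed.
Let K_growth : row_growth K. Proof. exact: (@classR_growth R 1 K [::] KR isT). Qed.
Let K1_growth i : row_growth (partial i K).
Proof. exact: (@classR_growth R 1 K [:: i] KR isT). Qed.

Let cvg_weighted p q : admissible p -> admissible q ->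
  integralR (fun x => K (log_jet 1 (mixture (step R n) p q) x) * (p x - q x)) @[n --> \oo]
  --> integralR (fun x => K (log_jet 1 q x) * (p x - q x)).
Proof.
move=> ap aq; have [p0 cp _ _] := ap; have [q0 cq _ _] := aq.
have [cpq rpq] : decaying (fun x => p x - q x).
  exact: (decayingB (admissible_decaying ap (leq0n 4)) (admissible_decaying aq (leq0n 4))).
have s01 n : 0 <= step R n <= 1.
  by rewrite (ltW (step_gt0 R n)) /=; have := step_le R n; lra.
have [h [gh h0 Hh]] := mixture_jet_bound (isT : (1 <= 2)%N) ap aq.
have [C [N [C0 HC]]] := K_growth.
have rD : rapid_decay (fun x => (C * (1 + h x) ^+ N) * (p x - q x)).
  apply: rapid_decayMl => //; apply: poly_growthM; first exact: poly_growth_cst.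
  by apply: poly_growthX; apply: poly_growthD => //; exact: poly_growth_cst.
have [E iE DE] := rapid_decay_bound rD.
apply: (dominated_convergenceR (g := E)) => //.
- move=> n; apply: continuous_measurable_fun; apply: continuous_mul => //.
  by apply: (kernel_jet_tempered KR _).1; exact: admissible_mixture.
- apply: continuous_measurable_fun; apply: continuous_mul => //.
  exact: (kernel_jet_tempered KR aq).1.
- move=> x; pose g (t : R) : R := K (log_jet 1 (mixture t p q) x).
  have m0 : 0 < mixture 0 p q x by rewrite mixture0.
  pose v (i : 'I_3) := if (i : nat) is j.+1 then
    jet_velocity (mixture 0 p q x) p q (fun i => ratio (mixture 0 p q) i x) j x else 0.
  have dg := @is_derive_curve R 2 K (fun t => log_jet 1 (mixture t p q) x) v 0
    (cont_partialsW (isT : (1 <= 2)%N) K_partials).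
  have cg : {for 0, continuous g}.
    apply: differentiable_continuous; apply/derivable1_diffP.
    have [] := dg _; last by [].
    move=> i; under eq_fun do rewrite mxE.
    rewrite /v; case: i => -[|j] /= jk; first exact: is_derive_cst.
    by apply: is_derive_mixture_log => //; exact: ltnW.
  have -> : K (log_jet 1 q x) = g 0 by rewrite /g mixture0.
  have H : g (step R n) @[n --> \oo] --> g 0.
    exact: (@cvg_comp nat R R (step R) g \oo (nbhs (0 : R)) (nbhs (g 0)) (cvg_step (R := R)) cg).
  exact: (cvgM H (cvg_cst (p x - q x))).
- move=> n x; apply: le_trans (DE x).
  rewrite normrM (normrM (C * _)); apply: ler_wpM2r => //.
  apply: le_trans (HC _ (h x) _) _; first by move=> i; exact: Hh.
  by rewrite [leRHS]ger0_norm ?mulr_ge0 // ?ler_norm // exprn_ge0 // addr_ge0.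
Qed.

(** The score is the supergradient of the functional: the first variation of the
    kernel and the change of the weight add up to the expected score, by the
    integration by parts of [integral_score]. *)
Lemma cvg_Phi_quotient p q : admissible p -> admissible q -> integralR p = integralR q ->
  (Phi 1 K (mixture (step R n) p q) - Phi 1 K q) / step R n @[n --> \oo] -->
  integralR (fun x => s (log_jet 2 q x) * p x) - Phi 1 K q.
Proof.
move=> ap aq ipq; have [p0 cp _ _] := ap; have [q0 cq _ _] := aq.
have ip := admissible_integrable ap; have iq := admissible_integrable aq.
have dp := admissible_decaying ap (isT : (0 <= 4)%N).
have dq := admissible_decaying aq (isT : (0 <= 4)%N).
have s01 n : 0 <= step R n <= 1.
  by rewrite (ltW (step_gt0 R n)) /=; have := step_le R n; lra.
have iK m w : admissible m -> decaying w -> integrableR (fun x => K (log_jet 1 m x) * w x).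
  by move=> am dw; exact: (decaying_integrable (decayingM (kernel_jet_tempered KR am) dw)).
have am n : admissible (mixture (step R n) p q) by exact: admissible_mixture.
have QE n : (Phi 1 K (mixture (step R n) p q) - Phi 1 K q) / step R n =
    (integralR (fun x => K (log_jet 1 (mixture (step R n) p q) x) * q x)
       - integralR (fun x => K (log_jet 1 q x) * q x)) / step R n
    + integralR (fun x => K (log_jet 1 (mixture (step R n) p q) x) * (p x - q x)).
  rewrite !Phi_jet //.
  have -> : (fun x => K (log_jet 1 (mixture (step R n) p q) x) * mixture (step R n) p q x)
      = (fun x => K (log_jet 1 (mixture (step R n) p q) x) * q x
        + step R n * (K (log_jet 1 (mixture (step R n) p q) x) * (p x - q x))).
    by apply/funext => x; rewrite /mixture; move: (K _) => k; ring.
  have i1 := iK _ _ (am n) dq; have i2 := iK _ _ (am n) (decayingB dp dq).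
  rewrite (integralRD i1 (integrableRZ _ i2)) (integralRZ _ i2).
  have := lt0r_neq0 (step_gt0 R n).
  by move: (integralR _) (integralR _) (integralR _) => A B D sn; field.
rewrite (funext QE).
have V := @first_variation R 1 K p q isT (cont_partialsW (isT : (1 <= 2)%N) K_partials)
  K_growth K1_growth ap aq.
have H := cvgD V (cvg_weighted ap aq).
suff <- : integralR (fun x => \sum_(i < 2) jet_velocity 1 p q (fun i => ratio q i x) i x *
      partial (lift ord0 i) K (log_jet 1 q x))
    + integralR (fun x => K (log_jet 1 q x) * (p x - q x))
    = integralR (fun x => s (log_jet 2 q x) * p x) - Phi 1 K q by exact: H.
have tP : tempered (fun x => partial 2 K (log_jet 1 q x)).
  by apply: comp_jet_tempered => //; exact: (K_partials.2 [:: 2]).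
have iWp := decaying_integrable (decayingM tP (decayingB (admissible_decaying ap (isT : (1 <= 4)%N))
  (decayingM (ratio_tempered aq (isT : (1 <= 1 <= 4)%N)) dp))).
have iKp := iK q p aq dp; have iKq := iK q q aq dq.
have E1 : integralR (fun x => \sum_(i < 2) jet_velocity 1 p q (fun i => ratio q i x) i x *
      partial (lift ord0 i) K (log_jet 1 q x)) =
    integralR (fun x => partial 2 K (log_jet 1 q x) * (derive1n 1 p x - ratio q 1 x * p x)).
  have -> : (fun x => \sum_(i < 2) jet_velocity 1 p q (fun i => ratio q i x) i x *
      partial (lift ord0 i) K (log_jet 1 q x)) =
      (fun x => c * (p x - q x) + partial 2 K (log_jet 1 q x) *
        (derive1n 1 p x - ratio q 1 x * p x)).
    apply/funext => x; rewrite !big_ord_recl big_ord0 addr0.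
    have -> : lift ord0 ord0 = 1 :> 'I_3 by apply/val_inj.
    have -> : lift ord0 (lift ord0 ord0) = 2 :> 'I_3 by apply/val_inj.
    rewrite (kernel_partial1 KE) /jet_velocity /= !divr1 mulrC; congr (_ + _).
    rewrite mulrC; congr (_ * _).
    have -> : derive1 q x = ratio q 1 x * q x by rewrite /ratio divfK // lt0r_neq0.
    by move: (ratio q 1 x) (derive1 p x) => *; ring.
  have ipq' := integrableRB ip iq.
  rewrite (integralRD (integrableRZ c ipq') iWp) (integralRZ c ipq') (integralRB ip iq).
  by rewrite ipq subrr mulr0 add0r.
rewrite E1 (integral_score KE KR sE ap aq) (Phi_jet K aq).
have -> : (fun x => K (log_jet 1 q x) * (p x - q x)) =
    (fun x => K (log_jet 1 q x) * p x - K (log_jet 1 q x) * q x).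
  by apply/funext => x; rewrite mulrBr.
by rewrite (integralRB iKp iKq) addrA; congr (_ - _); exact: addrC.
Qed.

Lemma kernel_expected_score p q : classP R p -> classP R q ->
  expected_score (local_score 2 s) p q =
  (integralR (fun x => s (log_jet 2 q x) * p x))%:E.
Proof.
move=> /classPE[ap _] /classPE[aq _].
by apply: expected_scoreE => //; exact: kernel_score_integrable.
Qed.

Lemma kernel_proper : concave_on (classP R) (Phi 1 K) -> proper_score (local_score 2 s).
Proof.
move=> cF p q Pp Pq; rewrite !kernel_expected_score // lee_fin.
have /classPE[ap ip] := Pp; have /classPE[aq iq] := Pq.
rewrite (integral_score_diag KE KR sE ap) -(lerD2r (- Phi 1 K q)).
apply: (le_cvg_const _ (cvg_Phi_quotient ap aq _)); last by rewrite ip iq.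
by move=> n; exact: (concave_slope_ge n cF Pp Pq).
Qed.

Lemma kernel_strictly_proper : strictly_concave_on (classP R) (Phi 1 K) ->
  strictly_proper_score (local_score 2 s).
Proof.
move=> cF; split; first exact/kernel_proper/strictly_concave_concave.
move=> p q Pp Pq; split=> [|->] //; rewrite !kernel_expected_score // => -[E].
apply: contrapT => qp; have pq : p <> q by move=> e; exact: qp.
have /classPE[ap ip] := Pp; have /classPE[aq iq] := Pq.
have [d dlt dle] := strictly_concave_slope_gt cF Pp Pq pq.
have := le_cvg_const dle (cvg_Phi_quotient ap aq (etrans ip (esym iq))).
rewrite -E (integral_score_diag KE KR sE ap) => h.
by have := lt_le_trans dlt h; rewrite ltxx.
Qed.

End KernelToScore.

(** * Functions of moderate growth *)

Section Moderate.
Variables (R : realType) (n : nat).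
Implicit Types (f g : 'rV[R]_n.+1 -> R) (i j : 'I_n.+1).

Lemma row_growth_cst (c : R) : row_growth (fun _ : 'rV[R]_n.+1 => c).
Proof. by exists `|c|, 0%N; split=> // v h _; rewrite expr0 mulr1. Qed.

Lemma row_growth_coord j : row_growth (fun v : 'rV[R]_n.+1 => v 0 j).
Proof.
by exists 1, 1%N; split=> // v h H; rewrite expr1 mul1r; apply: le_trans (H j) _; rewrite lerDr.
Qed.

Let bound_ge1 (v : 'rV[R]_n.+1) (h : R) : (forall i, `|v 0 i| <= h) -> 1 <= 1 + h.
Proof. by move=> /(_ ord0) H; rewrite lerDl; exact: le_trans (normr_ge0 _) H. Qed.

Lemma row_growthD f g : row_growth f -> row_growth g -> row_growth (fun v => f v + g v).
Proof.
move=> [C [N [C0 H]]] [D [M [D0 H']]]; exists (C + D), (N + M)%N.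
split=> [|v h vh]; first exact: addr_ge0.
have h1 := bound_ge1 vh.
apply: le_trans (ler_normD _ _) _; rewrite mulrDl; apply: lerD.
  apply: le_trans (H v h vh) _; apply: ler_wpM2l => //.
  by apply: ler_weXn2l; [exact: h1|exact: leq_addr].
apply: le_trans (H' v h vh) _; apply: ler_wpM2l => //.
by apply: ler_weXn2l; [exact: h1|exact: leq_addl].
Qed.

Lemma row_growthM f g : row_growth f -> row_growth g -> row_growth (fun v => f v * g v).
Proof.
move=> [C [N [C0 H]]] [D [M [D0 H']]]; exists (C * D), (N + M)%N.
split=> [|v h vh]; first exact: mulr_ge0.
by rewrite normrM exprD mulrACA ler_pM // ?H ?H'.
Qed.

(** C^m functions with polynomially bounded derivatives: the class [classR]
    for any order of differentiation. *)
Definition moderate m f := cont_partials m f /\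
  forall s : seq 'I_n.+1, (size s <= m)%N -> row_growth (partials s f).

Lemma moderateS m f : moderate m.+1 f <->
  [/\ continuous f, forall v i, derivable f v (delta_mx 0 i), row_growth f &
      forall i, moderate m (partial i f)].
Proof.
have E s i : partials s (partial i f) = partials (rcons s i) f.
  by rewrite /partials foldr_rcons.
split=> [[cf gf]|[cf df gf pf]].
  have /cont_partialsS[c d p] := cf; split=> //; first exact: (gf [::] isT).
  by move=> i; split=> // s sm; rewrite E; apply: gf; rewrite size_rcons.
split; first by apply/cont_partialsS; split=> // i; have [] := pf i.
move=> s; case/lastP: s => [|s i] // sm.
by rewrite -E; have [_ h] := pf i; apply: h; rewrite size_rcons in sm.
Qed.

Lemma moderate0 f : moderate 0 f <-> continuous f /\ row_growth f.
Proof.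
split=> [[/cont_partials0 cf gf]|[cf gf]]; first by split=> //; exact: (gf [::] isT).
split; first exact/cont_partials0.
by move=> s; rewrite leqn0 size_eq0 => /eqP ->.
Qed.

Lemma moderateW m k f : (m <= k)%N -> moderate k f -> moderate m f.
Proof.
move=> mk [cf gf]; split; first exact: cont_partialsW cf.
by move=> s sm; apply: gf; exact: leq_trans mk.
Qed.

Lemma moderate_partial m f i : moderate m.+1 f -> moderate m (partial i f).
Proof. by case/moderateS. Qed.

Lemma moderate_growth m f : moderate m f -> row_growth f.
Proof. by case=> _ /(_ [::] isT). Qed.

Lemma moderate_continuous m f : moderate m f -> continuous f.
Proof. by case=> /cont_partials_continuous. Qed.

Lemma moderate_cst m (c : R) : moderate m (fun=> c).
Proof.
have cc (d : R) : continuous (fun _ : 'rV[R]_n.+1 => d).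
  by move=> v; exact: cst_continuous.
elim: m c => [|m IH] c.
  by apply/moderate0; split; [exact: cc|exact: row_growth_cst].
apply/moderateS; split.
- exact: cc.
- by move=> v i; have [] := @is_derive_cst R _ _ c v (delta_mx 0 i).
- exact: row_growth_cst.
- by move=> i; rewrite partial_cst.
Qed.

Lemma moderate_coord m j : moderate m (fun v : 'rV[R]_n.+1 => v 0 j).
Proof.
have cj : continuous (fun v : 'rV[R]_n.+1 => v 0 j) by exact: coord_continuous.
case: m => [|m].
  by apply/moderate0; split; [exact: cj|exact: row_growth_coord].
apply/moderateS; split.
- exact: cj.
- by move=> v i; have [] := is_derive_coord v (delta_mx 0 i) j.
- exact: row_growth_coord.
- by move=> i; rewrite partial_coord; exact: moderate_cst.
Qed.

Lemma moderateD m f g : moderate m f -> moderate m g -> moderate m (fun v => f v + g v).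
Proof.
elim: m f g => [|m IH] f g.
  move=> /moderate0[cf gf] /moderate0[cg gg]; apply/moderate0; split; last exact: row_growthD.
  by move=> v; exact: (cvgD (cf v) (cg v)).
move=> /moderateS[cf df gf pf] /moderateS[cg dg gg pg]; apply/moderateS; split.
- by move=> v; exact: (cvgD (cf v) (cg v)).
- by move=> v i; exact: derivableD.
- exact: row_growthD.
- by move=> i; rewrite partialD //; apply: IH.
Qed.

Lemma moderateM m f g : moderate m f -> moderate m g -> moderate m (fun v => f v * g v).
Proof.
elim: m f g => [|m IH] f g.
  move=> /moderate0[cf gf] /moderate0[cg gg]; apply/moderate0; split; last exact: row_growthM.
  by move=> v; exact: (cvgM (cf v) (cg v)).
move=> mf mg; have [cf df gf pf] := (moderateS m f).1 mf.
have [cg dg gg pg] := (moderateS m g).1 mg; apply/moderateS; split.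
- by move=> v; exact: (cvgM (cf v) (cg v)).
- by move=> v i; exact: derivableM.
- exact: row_growthM.
- move=> i; rewrite partialM //; apply: moderateD; apply: IH => //.
    exact: moderateW mg.
  exact: moderateW mf.
Qed.

Lemma moderateB m f g : moderate m f -> moderate m g -> moderate m (fun v => f v - g v).
Proof.
move=> mf mg.
have -> : (fun v => f v - g v) = (fun v => f v + (-1) * g v).
  by apply/funext => v; rewrite mulN1r.
by apply: moderateD => //; apply: moderateM => //; exact: moderate_cst.
Qed.

End Moderate.

Lemma classR_moderate (R : realType) k (K : 'rV[R]_k.+2 -> R) :
  classR R k K -> moderate (2 * k) K.
Proof. by move=> KR; split; [have [] := KR|move=> s sk; exact: classR_growth KR sk]. Qed.

Lemma moderate_bound (R : realType) n m (f : 'rV[R]_n.+1 -> R) : moderate m f ->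
  exists (C : R) (N : nat), 0 <= C /\ forall s : seq 'I_n.+1, (size s <= m)%N ->
    forall (v : 'rV[R]_n.+1) (h : R), (forall i, `|v 0 i| <= h) ->
      `|partials s f v| <= C * (1 + h) ^+ N.
Proof.
elim: m f => [|m IH] f mf.
  have [C [N [C0 H]]] := moderate_growth mf; exists C, N; split=> // s.
  by rewrite leqn0 size_eq0 => /eqP ->; exact: H.
have [C0 [N0 [C00 H0]]] := moderate_growth mf.
have H i : exists CN : R * nat, 0 <= CN.1 /\ forall s : seq 'I_n.+1, (size s <= m)%N ->
    forall (v : 'rV[R]_n.+1) (h : R), (forall i, `|v 0 i| <= h) ->
      `|partials s (partial i f) v| <= CN.1 * (1 + h) ^+ CN.2.
  by have [C [N h]] := IH _ (moderate_partial i mf); exists (C, N).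
have [c Hc] := choice H.
exists (C0 + \sum_i (c i).1), (N0 + \max_i (c i).2)%N; split.
  by rewrite addr_ge0 // sumr_ge0 // => i _; have [] := Hc i.
have c0 j : 0 <= \sum_(i | i != j) (c i).1 by apply: sumr_ge0 => i _; have [] := Hc i.
have cs : 0 <= \sum_i (c i).1 by apply: sumr_ge0 => i _; have [] := Hc i.
move=> s sm v h vh.
have h1 : 1 <= 1 + h by rewrite lerDl; exact: le_trans (normr_ge0 _) (vh ord0).
have pw k N : (k <= N)%N -> 0 <= (1 + h) ^+ k <= (1 + h) ^+ N.
  by move=> kN; rewrite exprn_ge0 ?(le_trans ler01) // ler_weXn2l.
case/lastP: s sm => [|s i] sm.
  have /andP[w0 w1] := pw N0 (N0 + \max_i (c i).2)%N (leq_addr _ _).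
  by apply: le_trans (H0 v h vh) _; apply: ler_pM => //; rewrite lerDl.
have -> : partials (rcons s i) f = partials s (partial i f) by rewrite /partials foldr_rcons.
have [ci Hi] := Hc i; rewrite size_rcons in sm.
have /andP[w0 w1] := pw (c i).2 (N0 + \max_i (c i).2)%N
  (leq_trans (leq_bigmax i) (leq_addl _ _)).
apply: le_trans (Hi s sm v h vh) _; apply: ler_pM => //.
by rewrite (bigD1 i) //= addrCA lerDl addr_ge0.
Qed.

Lemma moderate_classR (R : realType) k (K : 'rV[R]_k.+2 -> R) :
  moderate (2 * k) K -> classR R k K.
Proof.
move=> mK; have [C [N [C0 H]]] := moderate_bound mK; split; first exact: mK.1.
exists (C + 1), N.+1%:R; split; [by rewrite ltr_wpDl|by rewrite ltr0n|].
move=> s v sk; set P := \prod_(i < k.+2) _.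
have P1 : 1 <= P.
  apply: (big_ind (fun y : R => 1 <= y)) => // [y z y1 z1|i _]; last exact: weight_ge1.
  by rewrite -[1]mulr1 ler_pM.
have vP i : `|v 0 i| <= P - 1.
  rewrite lerBrDl /P (bigD1 i) //= -[leLHS]mulr1; apply: ler_wpM2l; first exact: weight_ge0.
  apply: (big_ind (fun y : R => 1 <= y)) => // [y z y1 z1|j _]; last exact: weight_ge1.
  by rewrite -[1]mulr1 ler_pM.
apply: le_trans (H s sk v _ vP) _; rewrite addrC subrK powR_mulrn ?(le_trans ler01) //.
apply: ler_pM => //; [by rewrite exprn_ge0 // (le_trans ler01)|by rewrite lerDl|].
by apply: ler_weXn2l.
Qed.

(** * The Euler-Lagrange expression of a score *)

Section EulerExpression.
Variables (R : realType) (s : 'rV[R]_4 -> R).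
Implicit Types (p q : R -> R) (x t : R) (f : 'rV[R]_4 -> R) (v : 'rV[R]_4).

(** Total derivative in x of a function of (x, ln q, (ln q)', (ln q)''), the
    third derivative of ln q being [y3]. *)
Definition total_derivative f v (y3 : R) : R :=
  partial 0 f v + v 0 2 * partial 1 f v + v 0 3 * partial 2 f v + y3 * partial 3 f v.

(** The part of D s_2 + y_1 s_2 - s_1 free of third derivatives; here s_j is
    the derivative of the score in y_j, that is [partial j.+1 s]. *)
Definition flux v : R :=
  partial 0 (partial 3 s) v + v 0 2 * partial 1 (partial 3 s) v
  + v 0 3 * partial 2 (partial 3 s) v + v 0 2 * partial 3 s v - partial 2 s v.

(** The Euler-Lagrange expression s_0 + (D + y_1) G of the functional p -> S(q, p)
    at q, where G = D s_2 + y_1 s_2 - s_1 = y_3 s_22 + flux. *)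
Definition euler v (y3 y4 : R) : R :=
  partial 1 s v + y4 * partial 3 (partial 3 s) v
  + y3 * total_derivative (partial 3 (partial 3 s)) v y3
  + total_derivative flux v y3
  + v 0 2 * (y3 * partial 3 (partial 3 s) v + flux v).

Lemma is_derive_total q f x : moderate 1 f -> admissible q ->
  is_derive x 1 (fun x => f (log_jet 2 q x))
    (total_derivative f (log_jet 2 q x) (log_derivative q 3 x)).
Proof.
move=> mf aq.
pose d (i : 'I_4) := if (i : nat) is j.+1 then log_derivative q j.+1 x else 1.
have h := @is_derive_curve R 3 f (log_jet 2 q) d x mf.1.
apply: is_derive_eq (h _) _.
  move=> i; under eq_fun do rewrite mxE.
  rewrite /d; case: i => -[|j] /= jk; first exact: is_derive_id.
  by apply: is_derive_log_derivative => //; rewrite ltnS in jk; exact: leq_trans jk _.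
apply: etrans (sum_ord4 _) _; rewrite /total_derivative !mxE.
by congr (_ + _ + _ + _); exact: mul1r.
Qed.

Hypothesis sm : moderate 4 s.

Lemma flux_moderate : moderate 2 flux.
Proof.
have s3 : moderate 3 (partial 3 s) by exact: moderate_partial.
have m3 i : moderate 2 (partial i (partial 3 s)) by exact: moderate_partial.
have c j : moderate 2 (fun v : 'rV[R]_4 => v 0 j) by exact: moderate_coord.
have s2 : moderate 2 (partial 2 s) by exact: (moderateW (isT : (2 <= 3)%N) (moderate_partial 2 sm)).
have s3' : moderate 2 (partial 3 s) by exact: (moderateW (isT : (2 <= 3)%N) s3).
exact: (moderateB (moderateD (moderateD (moderateD (m3 0) (moderateM (c 2) (m3 1)))
  (moderateM (c 3) (m3 2))) (moderateM (c 2) s3')) s2).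
Qed.

Let s33_moderate : moderate 2 (partial 3 (partial 3 s)).
Proof. by apply: moderate_partial; exact: moderate_partial. Qed.

Let total_tempered q f : moderate 1 f -> admissible q ->
  tempered (fun x => total_derivative f (log_jet 2 q x) (log_derivative q 3 x)).
Proof.
move=> mf aq; have c i : tempered (fun x => partial i f (log_jet 2 q x)).
  have mi := moderate_partial i mf.
  by apply: comp_jet_tempered => //; [exact: moderate_continuous mi|exact: moderate_growth mi].
have l i : tempered (fun x => log_jet 2 q x 0 i) by exact: log_jet_tempered.
have l3 : tempered (log_derivative q 3) by exact: log_derivative_tempered.
exact: (temperedD (temperedD (temperedD (c 0) (temperedM (l 2) (c 1)))
  (temperedM (l 3) (c 2))) (temperedM l3 (c 3))).
Qed.

Definition euler_of q x := euler (log_jet 2 q x) (log_derivative q 3 x) (log_derivative q 4 x).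

Let jet_tempered q f m : moderate m f -> admissible q -> tempered (fun x => f (log_jet 2 q x)).
Proof.
move=> mf aq; apply: comp_jet_tempered => //.
  exact: moderate_continuous mf.
exact: moderate_growth mf.
Qed.

Let s1_moderate i : moderate 3 (partial i s). Proof. exact: moderate_partial. Qed.

Lemma euler_tempered q : admissible q -> tempered (euler_of q).
Proof.
move=> aq.
have l i : (i <= 4)%N -> tempered (log_derivative q i) by exact: log_derivative_tempered.
have l2 : tempered (fun x => log_jet 2 q x 0 2) by exact: log_jet_tempered.
have c33 := jet_tempered s33_moderate aq; have cf := jet_tempered flux_moderate aq.
have t33 := total_tempered (moderateW (isT : (1 <= 2)%N) s33_moderate) aq.
have tf := total_tempered (moderateW (isT : (1 <= 2)%N) flux_moderate) aq.
have c1 := jet_tempered (s1_moderate 1) aq.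
exact: (temperedD (temperedD (temperedD (temperedD c1
  (temperedM (l 4 isT) c33)) (temperedM (l 3 isT) t33)) tf)
  (temperedM l2 (temperedD (temperedM (l 3 isT) c33) cf))).
Qed.

(** The first variation integrated by parts: s_2 (W' - u' W) - G h has the
    difference of both integrands as derivative, with h = p - q and
    W = h' - u' h, u = ln q. *)
Lemma integral_euler p q : admissible p -> admissible q ->
  integralR (fun x => \sum_(i < 3)
    jet_velocity 1 p q (fun i => ratio q i x) i x * partial (lift ord0 i) s (log_jet 2 q x)) =
  integralR (fun x => euler_of q x * (p x - q x)).
Proof.
move=> ap aq; have [p0 cp _ _] := ap; have [q0 cq _ _] := aq.
pose h i x := derive1n i p x - derive1n i q x.
pose u i := log_derivative q i.
pose J := log_jet 2 q.
have hd i : (i <= 4)%N -> decaying (h i).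
  by move=> i4; apply: decayingB; exact: admissible_decaying.
have dh i x : (i < 4)%N -> is_derive x 1 (h i) (h i.+1 x).
  by move=> i4; apply: is_derive_sub; [exact: cont_derivatives_is_derive cp i4|
    exact: cont_derivatives_is_derive cq i4].
have ut i : (i <= 4)%N -> tempered (u i) by exact: log_derivative_tempered.
have du i x : (i < 4)%N -> is_derive x 1 (u i) (u i.+1 x) by exact: is_derive_log_derivative.
pose W x := h 1%N x - u 1%N x * h 0%N x.
pose W' x := h 2%N x - (u 2%N x * h 0%N x + u 1%N x * h 1%N x).
have dW x : is_derive x 1 W (W' x).
  exact: (is_derive_sub (dh 1%N x isT) (is_derive_mul (du 1%N x isT) (dh 0%N x isT))).
have Wd : decaying W := decayingB (hd 1%N isT) (decayingM (ut 1%N isT) (hd 0%N isT)).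
have W'd : decaying W'.
  exact: (decayingB (hd 2%N isT) (decayingD (decayingM (ut 2%N isT) (hd 0%N isT))
    (decayingM (ut 1%N isT) (hd 1%N isT)))).
have m3 : moderate 1 (partial 3 s) by exact: (moderateW (isT : (1 <= 3)%N) (s1_moderate 3)).
have m33 := moderateW (isT : (1 <= 2)%N) s33_moderate.
have mf := moderateW (isT : (1 <= 2)%N) flux_moderate.
pose a i x := partial i s (J x).
pose b x := partial 3 (partial 3 s) (J x).
pose db x := total_derivative (partial 3 (partial 3 s)) (J x) (u 3 x).
pose g x := flux (J x).
pose dg x := total_derivative flux (J x) (u 3 x).
pose da x := total_derivative (partial 3 s) (J x) (u 3 x).
pose G x := u 3 x * b x + g x.
have ta i : tempered (a i) by exact: (jet_tempered (s1_moderate i) aq).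
have tb : tempered b by exact: (jet_tempered s33_moderate aq).
have tg : tempered g by exact: (jet_tempered flux_moderate aq).
have tda : tempered da by exact: total_tempered.
have tdb : tempered db by exact: total_tempered.
have tdg : tempered dg by exact: total_tempered.
have dG x : is_derive x 1 G (u 4 x * b x + u 3 x * db x + dg x).
  exact: (is_derive_add (is_derive_mul (du 3 x isT) (is_derive_total x m33 aq))
    (is_derive_total x mf aq)).
have GE x : G x = da x + u 1%N x * a 3 x - a 2 x.
  rewrite /G /da /g /b /flux /total_derivative /a.
  have -> : J x 0 2 = u 1%N x by rewrite mxE.
  have -> : J x 0 3 = u 2%N x by rewrite mxE.
  move: (partial 3 (partial 3 s) _) (partial 0 _ _) (partial 1 _ _) (partial 2 (partial 3 s) _)
    (partial 3 s _) (partial 2 s _) (u 1%N x) (u 2%N x) (u 3 x) => *; ring.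
pose F x := a 3 x * W x - G x * h 0%N x.
pose dF x := (da x * W x + a 3 x * W' x)
   - ((u 4 x * b x + u 3 x * db x + dg x) * h 0%N x + G x * h 1%N x).
have dFE x : is_derive x 1 F (dF x).
  exact: (is_derive_sub (is_derive_mul (is_derive_total x m3 aq) (dW x))
    (is_derive_mul (dG x) (dh 0%N x isT))).
have tG : tempered G := temperedD (temperedM (ut 3 isT) tb) tg.
have [cdF rdF] : decaying dF.
  exact: (decayingB (decayingD (decayingM tda Wd) (decayingM (ta 3) W'd))
    (decayingD (decayingM (temperedD (temperedD (temperedM (ut 4 isT) tb)
      (temperedM (ut 3 isT) tdb)) tdg) (hd 0%N isT)) (decayingM tG (hd 1%N isT)))).
have [_ rF] : decaying F := decayingB (decayingM (ta 3) Wd) (decayingM tG (hd 0%N isT)).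
have iF := continuous_rapid_integrable cdF rdF.
have Z := integralR_derivative0 dFE cdF iF rF.
have iE := decaying_integrable (decayingM (euler_tempered aq) (hd 0%N isT)).
have -> : integralR (fun x => euler_of q x * (p x - q x)) =
    integralR (fun x => euler_of q x * h 0%N x) + integralR dF by rewrite Z addr0.
rewrite -(integralRD iE iF); congr integralR; apply/funext => x.
transitivity (a 1 x * h 0%N x + a 2 x * W x + a 3 x * (W' x - u 1%N x * W x)).
  have l0 : lift ord0 (0 : 'I_3) = 1 :> 'I_4 by apply/val_inj.
  have l1 : lift ord0 (1 : 'I_3) = 2 :> 'I_4 by apply/val_inj.
  have l2 : lift ord0 (2 : 'I_3) = 3 :> 'I_4 by apply/val_inj.
  apply: etrans (sum_ord3 _) _; rewrite l0 l1 l2.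
  rewrite ![_ * partial _ _ _]mulrC; congr (_ * _ + _ * _ + _ * _).
  - by rewrite /jet_velocity divr1.
  - by rewrite /jet_velocity divr1.
  - transitivity (h 2%N x - ratio q 2 x * h 0%N x
      - (ratio q 1 x + ratio q 1 x) * (h 1%N x - ratio q 1 x * h 0%N x)).
      by rewrite /jet_velocity divr1.
    have u1 : u 1%N x = ratio q 1 x by [].
    have u2 : u 2%N x = ratio q 2 x - ratio q 1 x * ratio q 1 x by [].
    rewrite /W' /W u1 u2.
    by move: (ratio q 1 x) (ratio q 2 x) (h 0%N x) (h 1%N x) (h 2%N x) => *; ring.
have -> : euler_of q x = a 1 x + u 4 x * b x + u 3 x * db x + dg x + u 1%N x * G x.
  rewrite /euler_of /euler.
  by have -> : log_jet 2 q x 0 2 = u 1%N x by rewrite mxE.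
rewrite /dF GE /W.
move: (a 1 x) (a 2 x) (a 3 x) (b x) (da x) (db x) (dg x) (W' x) (h 0%N x) (h 1%N x)
  (u 1%N x) (u 3 x) (u 4 x) => *; ring.
Qed.

(** If q is the best forecast for itself, the one-sided derivative of the expected
    score under q is nonnegative in every direction p - q. *)
Lemma proper_euler_ge0 p q : proper_score (local_score 2 s) -> classP R p -> classP R q ->
  0 <= integralR (fun x => euler_of q x * (p x - q x)).
Proof.
move=> pr Pp Pq; have /classPE[ap ip] := Pp; have /classPE[aq iq] := Pq.
have m1 := moderateW (isT : (1 <= 4)%N) sm.
rewrite -integral_euler //.
have V := @first_variation R 2 s p q isT m1.1 (moderate_growth m1)
  (fun i => moderate_growth (moderate_partial i m1)) ap aq.
apply: (le_cvg_const _ V) => n.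
have s0 := step_gt0 R n; have s1 := step_le R n.
have s01 : 0 <= step R n <= 1 by rewrite (ltW s0) /=; lra.
have Pm := classP_mixture s01 Pp Pq; have /classPE[am _] := Pm.
have ii m : admissible m -> integrableR (fun x => s (log_jet 2 m x) * q x).
  move=> ma; apply: comp_jet_integrable => //; [exact: moderate_continuous sm|
    exact: moderate_growth sm|exact: (admissible_decaying aq (leq0n 4))].
have := pr q _ Pq Pm; rewrite !expected_scoreE ?lee_fin; [|exact: am|exact: ii|exact: aq|exact: ii].
by move=> H; apply: divr_ge0; [rewrite subr_ge0|exact: ltW].
Qed.

End EulerExpression.

(** * Exponentials of polynomials and concentration *)

Section ExpPolynomials.
Variable R : realType.
Implicit Types (P : {poly R}) (x : R).

Lemma horner_growth P : poly_growth (horner P).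
Proof.
elim/poly_ind: P => [|P c IH].
  by rewrite horner0_ext; exact: poly_growth_cst.
have -> : horner (P * 'X + c%:P) = (fun x => P.[x] * x + c).
  by apply/funext => x; rewrite !hornerE.
apply: poly_growthD; last exact: poly_growth_cst.
by apply: poly_growthM => //; exact: poly_growth_id.
Qed.

Definition quadratic_decay P := exists e C : R, 0 < e /\ forall x, P.[x] <= C - e * x ^+ 2.

Lemma expR_poly_rapid P : quadratic_decay P -> rapid_decay (fun x => expR P.[x]).
Proof.
move=> [e [C [e0 H]]] n; pose m : R := n.+1%:R.
have m0 : 0 < m by rewrite ltr0n.
pose K := 2 + m / e; exists (expR C * K ^+ n.+1) => x.
have y0 : 0 <= e * x ^+ 2 by rewrite mulr_ge0 ?sqr_ge0 // ltW.
have me0 : 0 <= m / e by rewrite divr_ge0 // ltW.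
have x2 : `|x| <= 1 + x ^+ 2.
  have := sqr_ge0 (`|x| - 1); rewrite -(real_normK (num_real x)).
  by have := normr_ge0 x; move: (`|x|) => y ? ?; nra.
have h1 : 1 + `|x| <= K * (1 + e * x ^+ 2 / m).
  have -> : K * (1 + e * x ^+ 2 / m) = 2 + x ^+ 2 + (m / e + 2 * (e * x ^+ 2 / m)).
    by rewrite /K; field; rewrite !gt_eqF.
  have : 0 <= 2 * (e * x ^+ 2 / m) by rewrite mulr_ge0 // divr_ge0 // ltW.
  move: x2 me0; clear; move: (`|x|) (x ^+ 2) (m / e) (e * x ^+ 2 / m) => d c b a.
  lra.
have b0 : 0 <= 1 + e * x ^+ 2 / m by rewrite addr_ge0 // divr_ge0 // ltW.
have h2 : (1 + e * x ^+ 2 / m) ^+ n.+1 <= expR (e * x ^+ 2).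
  apply: le_trans (_ : expR (e * x ^+ 2 / m) ^+ n.+1 <= _).
    apply: lerXn2r; rewrite ?nnegrE ?expR_ge0 //; exact: expR_ge1Dx.
  by rewrite -expRM_natl mulrC divfK // gt_eqF.
rewrite ger0_norm ?expR_ge0 //.
apply: le_trans (_ : expR (C - e * x ^+ 2) * (1 + `|x|) ^+ n.+1 <= _).
  apply: ler_pM; rewrite ?expR_ge0 ?weight_pow_ge0 //; first by rewrite ler_expR.
  by apply: ler_weXn2l; [exact: weight_ge1|exact: leqnSn].
rewrite expRD -mulrA; apply: ler_wpM2l; first exact: expR_ge0.
rewrite expRN mulrC ler_pdivrMr ?expR_gt0 //.
apply: le_trans (_ : (K * (1 + e * x ^+ 2 / m)) ^+ n.+1 <= _).
  by apply: lerXn2r; rewrite ?nnegrE ?weight_ge0 // mulr_ge0 // /K addr_ge0.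
rewrite exprMn; apply: ler_wpM2l => //; apply: exprn_ge0.
by rewrite /K addr_ge0.
Qed.

(** The polynomial factor of the j-th derivative of exp P. *)
Fixpoint exp_numerator P (j : nat) : {poly R} :=
  if j is i.+1 then (exp_numerator P i)^`() + exp_numerator P i * P^`() else 1.

Lemma is_derive_expR_poly P x : is_derive x 1 (fun y => expR P.[y]) (expR P.[x] * P^`().[x]).
Proof. exact: (@is_derive1_comp _ (@expR R) (horner P) x _ _ (is_derive_expR _) (is_derive_poly P x)). Qed.

Lemma continuous_expR_poly P : continuous (fun x => expR P.[x]).
Proof. exact: (is_derive_continuous (is_derive_expR_poly P)). Qed.

Lemma is_derive_exp_numerator P j x :
  is_derive x 1 (fun y => (exp_numerator P j).[y] * expR P.[y])
    ((exp_numerator P j.+1).[x] * expR P.[x]).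
Proof.
apply: is_derive_eq (is_derive_mul (is_derive_poly (exp_numerator P j) x)
  (is_derive_expR_poly P x)) _.
rewrite [exp_numerator P j.+1]/= hornerD hornerM.
by move: (expR P.[x]) (exp_numerator P j)^`().[x] (exp_numerator P j).[x] P^`().[x] => *; ring.
Qed.

Lemma exp_chain P j : derive1n j (fun x => expR P.[x]) = fun x => (exp_numerator P j).[x] * expR P.[x].
Proof.
have E : (fun x => expR P.[x]) = (fun x => (exp_numerator P 0).[x] * expR P.[x]).
  by apply/funext => x; rewrite /= hornerE mul1r.
rewrite {1}E; apply: (@derive1n_chain _ j (fun j x => (exp_numerator P j).[x] * expR P.[x])) => //.
by move=> i x _; exact: is_derive_exp_numerator.
Qed.

Lemma exp_ratio P j x : ratio (fun x => expR P.[x]) j x = (exp_numerator P j).[x].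
Proof. by rewrite /ratio exp_chain mulfK // gt_eqF // expR_gt0. Qed.

Lemma exp_admissible P : quadratic_decay P -> admissible (fun x => expR P.[x]).
Proof.
move=> dP; have rP := expR_poly_rapid dP; split.
- by move=> x; exact: expR_gt0.
- have E : (fun x => expR P.[x]) = (fun x => (exp_numerator P 0).[x] * expR P.[x]).
    by apply/funext => x; rewrite /= hornerE mul1r.
  rewrite E; apply: (@cont_derivatives_chain _ 4 (fun j x => (exp_numerator P j).[x] * expR P.[x])).
    by move=> i x _; exact: is_derive_exp_numerator.
  by apply: is_derive_continuous => x; exact: is_derive_exp_numerator.
- by move=> j _; rewrite exp_chain; apply: rapid_decayMl => //; exact: horner_growth.
- move=> j _; have -> : (fun x => derive1n j (fun x => expR P.[x]) x / expR P.[x]) = horner (exp_numerator P j).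
    by apply/funext => x; exact: exp_ratio.
  exact: horner_growth.
Qed.

End ExpPolynomials.

Section Concentration.
Variable R : realType.
Notation mu := (@lebesgue_measure R).
Implicit Types (f g M p q : R -> R) (x : R).

Lemma integralR_ge_itv f (a b e : R) : integrableR f -> (forall x, 0 <= f x) -> a <= b ->
  (forall x, a <= x <= b -> e <= f x) -> e * (b - a) <= integralR f.
Proof.
move=> fi f0 ab fe.
have ci : integrableR (fun x => e * \1_`[a, b] x).
  apply: integrableRZ; exact: integrable_indic_itv.
have -> : e * (b - a) = integralR (fun x => e * \1_`[a, b] x).
  rewrite integralRZ; last exact: integrable_indic_itv.
  congr (_ * _); rewrite /integralR /Rintegral integral_indic // setIT.
  rewrite /= lebesgue_measure_itv /= lte_fin; case: ifPn => //; rewrite -leNgt => ba.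
  have -> : a = b by apply/le_anti; rewrite ab ba.
  by rewrite subrr.
apply: integralR_le => // x; rewrite indicE; have [xab|] := boolP (x \in _).
  by rewrite mulr1; apply: fe; move: xab; rewrite inE /= in_itv.
by rewrite mulr0.
Qed.

Lemma integralR_eq0 f : continuous f -> integrableR f -> (forall x, 0 <= f x) ->
  integralR f = 0 -> forall x, f x = 0.
Proof.
move=> cf fi f0 i0 x; apply/eqP; rewrite eq_le f0 andbT leNgt; apply/negP => fx.
have e0 : 0 < f x / 2 by rewrite divr_gt0.
have cx : {for x, continuous f} by exact: cf.
move/cvgrPdist_le : cx => /(_ _ e0) /nbhs_ballP[d /= d0 H].
have : f x / 2 * ((x + d / 2) - (x - d / 2)) <= integralR f.
  apply: integralR_ge_itv => // [|y /andP[y1 y2]]; first lra.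
  have : `|f x - f y| <= f x / 2.
    by apply: H; rewrite -ball_normE /= ltr_norml; apply/andP; split; lra.
  by rewrite ler_norml => /andP[h1 h2]; lra.
rewrite i0; have : 0 < f x / 2 * d by rewrite mulr_gt0.
have -> : x + d / 2 - (x - d / 2) = d by field.
by move=> h1 h2; lra.
Qed.

Definition gauss_poly (n : nat) (x1 : R) : {poly R} := - n.+1%:R *: ('X - x1%:P) ^+ 2.

Lemma gauss_polyE n x1 x : (gauss_poly n x1).[x] = - n.+1%:R * (x - x1) ^+ 2.
Proof. by rewrite /gauss_poly !hornerE. Qed.

Lemma gauss_decay n x1 : quadratic_decay (gauss_poly n x1).
Proof.
exists 2^-1, (x1 ^+ 2); split=> [|x]; first by rewrite invr_gt0.
rewrite gauss_polyE; have n1 : 1 <= n.+1%:R :> R by rewrite ler1n.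
have := sqr_ge0 (x - 2 * x1); have := sqr_ge0 (x - x1).
move: (n.+1%:R) n1 => N n1 h1 h2.
by have : N * (x - x1) ^+ 2 >= (x - x1) ^+ 2; [rewrite ler_peMl|nra].
Qed.

(** Narrow Gaussian kernels concentrate: if M were negative near x1, that
    neighbourhood would outweigh the rest of the line. *)
Lemma gauss_ge0 M x1 : continuous M -> poly_growth M ->
  (forall n, 0 <= integralR (fun x => M x * expR (gauss_poly n x1).[x])) -> 0 <= M x1.
Proof.
move=> cM gM H; rewrite leNgt; apply/negP => M1.
pose e := - M x1 / 2; have e0 : 0 < e by rewrite /e; lra.
have cx : {for x1, continuous M} by exact: cM.
move/cvgrPdist_le : cx => /(_ _ e0) /nbhs_ballP[d /= d0 Hd].
pose r := d / 2; have r0 : 0 < r by rewrite divr_gt0.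
have Me x : `|x - x1| <= r -> M x <= - e.
  move=> xr; have : `|M x1 - M x| <= e.
    by apply: Hd; rewrite -ball_normE /= distrC; apply: le_lt_trans xr _; rewrite /r; lra.
  by rewrite ler_norml /e => /andP[h1 h2]; lra.
(* The kernel rescaled to the value 1 at distance r from its centre: outside
   that distance it tends to 0, inside it is at least 1. *)
pose k n x := expR (n.+1%:R * r ^+ 2) * expR (gauss_poly n x1).[x].
have kE n x : k n x = expR (n.+1%:R * (r ^+ 2 - (x - x1) ^+ 2)).
  by rewrite /k gauss_polyE -expRD; congr expR; ring.
pose A := `[x1 - r, x1 + r]%classic.
have AP x : (x \in A) = (`|x - x1| <= r).
  by rewrite mem_setE /A in_itv /= ler_distl.
have mA : measurable A by exact: measurable_itv.
have ik n : integrableR (fun x => M x * expR (gauss_poly n x1).[x]).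
  apply: continuous_rapid_integrable.
    by apply: continuous_mul => //; exact: continuous_expR_poly.
  by apply: rapid_decayMl => //; apply: expR_poly_rapid; exact: gauss_decay.
have le1 n x : `|x - x1| <= r -> 1 <= k n x.
  move=> xr; rewrite kE -expR0 ler_expR mulr_ge0 // subr_ge0.
  by rewrite -(real_normK (num_real (x - x1))); apply: lerXn2r; rewrite ?nnegrE // ltW.
pose f n x := `|M x| * k n x * \1_(~` A) x.
have notA x : \1_(~` A) x = (if `|x - x1| <= r then 0 else 1) :> R.
  rewrite indicE in_setC AP; by case: ifP.
have mind : measurable_fun setT (\1_(~` A) : R -> R).
  by apply: measurable_indic; exact: measurableC.
have ck n : continuous (k n).
  apply: continuous_mul; first exact: continuous_cst.
  exact: continuous_expR_poly.
have cabs : continuous (fun x => `|M x|).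
  by move=> x; apply: (@cvg_comp _ _ _ M (fun y => `|y|) (nbhs x) (nbhs (M x))); [exact: cM|exact: norm_continuous].
have mf n : measurable_fun setT (f n).
  apply: measurable_funM => //; apply: continuous_measurable_fun.
  exact: continuous_mul.
have ig : integrableR (fun x => `|M x| * k 0%N x).
  apply: continuous_rapid_integrable; first exact: continuous_mul.
  apply: rapid_decayMl; first exact: poly_growth_norm.
  by apply: rapid_decayZ; apply: expR_poly_rapid; exact: gauss_decay.
have fg n x : `|f n x| <= `|M x| * k 0%N x.
  have k0 m : 0 <= k m x by rewrite kE expR_ge0.
  rewrite /f notA; case: (leP `|x - x1| r) => xr; first by rewrite mulr0 normr0 mulr_ge0.
  rewrite mulr1 ger0_norm ?mulr_ge0 //; apply: ler_wpM2l => //.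
  rewrite !kE ler_expR; apply: ler_wnM2r; last by rewrite ler1n.
  rewrite subr_le0 -(real_normK (num_real (x - x1))); by apply: lerXn2r; rewrite ?nnegrE //; exact: ltW.
have f0 x : f n x @[n --> \oo] --> 0.
  rewrite /f; under eq_fun do rewrite notA.
  case: (leP `|x - x1| r) => xr.
    by under eq_fun do rewrite mulr0; exact: cvg_cst.
  under eq_fun do rewrite mulr1 kE.
  pose b := expR (r ^+ 2 - (x - x1) ^+ 2).
  have b1 : `|b| < 1.
    rewrite ger0_norm ?expR_ge0 // -expR0 ltr_expR subr_lt0.
    by rewrite -(real_normK (num_real (x - x1))); apply: ltrXn2r; rewrite ?nnegrE ?ltW.
  have -> : (fun n : nat => `|M x| * expR (n.+1%:R * (r ^+ 2 - (x - x1) ^+ 2))) =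
      (fun n => `|M x| * b * b ^+ n).
    by apply/funext => n; rewrite expRM_natl exprS mulrA.
  have := cvgM (cvg_cst (`|M x| * b)) (cvg_expr b1).
  by rewrite mulr0; exact.
have lim0 : integralR (f n) @[n --> \oo] --> 0.
  have -> : (0 : R) = integralR (fun=> 0) by rewrite /integralR /Rintegral integral0.
  apply: (dominated_convergenceR (g := fun x => `|M x| * k 0%N x)) => //.
have iA : integrableR (\1_A : R -> R) by exact: integrable_indic_itv.
have ifn n : integrableR (f n).
  by apply: (integrableR_le (mf n) (fg n)).
have bound n : 2 * r * e <= integralR (f n).
  have ikn : integrableR (fun x => M x * k n x).
    have -> : (fun x => M x * k n x) = (fun x => expR (n.+1%:R * r ^+ 2) * (M x * expR (gauss_poly n x1).[x])).
      by apply/funext => x; rewrite /k mulrCA.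
    exact: integrableRZ.
  have kp : 0 <= integralR (fun x => M x * k n x).
    have -> : (fun x => M x * k n x) = (fun x => expR (n.+1%:R * r ^+ 2) * (M x * expR (gauss_poly n x1).[x])).
      by apply/funext => x; rewrite /k mulrCA.
    by rewrite integralRZ // mulr_ge0 // expR_ge0.
  have : integralR (fun x => M x * k n x + e * \1_A x) <= integralR (f n).
    apply: integralR_le => //; first exact: integrableRD (ikn) (integrableRZ _ iA).
    move=> x; rewrite /f notA indicE AP; case: (leP `|x - x1| r) => xr.
      have h1 := Me x xr; have h2 := le1 n x xr; rewrite mulr0 mulr1.
      by move: (M x) (k n x) h1 h2 => m kk h1 h2; nra.
    rewrite mulr0 addr0 mulr1; apply: ler_wpM2r; [by rewrite kE expR_ge0|exact: ler_norm].
  rewrite integralRD ?integralRZ //; last exact: integrableRZ.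
  have -> : integralR (\1_A : R -> R) = 2 * r.
    rewrite /integralR /Rintegral integral_indic // setIT /= lebesgue_measure_itv /= lte_fin.
    by rewrite ifT; [rewrite /=; ring|lra].
  by move=> h; clear -h kp; lra.
have := le_cvg_const bound lim0.
have re0 : 0 < 2 * r * e by apply: mulr_gt0 => //; apply: mulr_gt0.
by move=> h; have := lt_le_trans re0 h; rewrite ltxx.
Qed.

End Concentration.

(** * Constancy along a density and interpolation of jets *)

Section EulerConstant.
Variables (R : realType) (s : 'rV[R]_4 -> R).
Hypothesis sm : moderate 4 s.
Hypothesis pr : proper_score (local_score 2 s).
Implicit Types (p q : R -> R) (x t : R).

Lemma admissible_mass_gt0 p : admissible p -> 0 < integralR p.
Proof.
move=> ap; have [p0 _ _ _] := ap; have pge x : 0 <= p x by exact: ltW.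
rewrite lt_neqAle integralR_ge0 // andbT eq_sym; apply/eqP => i0.
have h : p 0 = 0.
  exact: (integralR_eq0 (admissible_continuous ap (leq0n 4)) (admissible_integrable ap) pge i0 0).
by have := p0 0; rewrite h ltxx.
Qed.

Lemma classP_normalize p : admissible p -> classP R (fun x => (integralR p)^-1 * p x).
Proof.
move=> ap; have Z0 := admissible_mass_gt0 ap.
have -> : (fun x => (integralR p)^-1 * p x) = (fun x => (integralR p)^-1 * p x + 0 * p x).
  by apply/funext => x; rewrite mul0r addr0.
apply: classP_comb => //; rewrite ?addr0 ?mul0r ?addr0 ?mulVf ?invr_gt0 ?gt_eqF //.
by rewrite invr_ge0 ltW.
Qed.

(** First-order optimality at [q] in every direction p - q, with p narrow
    around any point, bounds the Euler-Lagrange expression from below by its mean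
    under q, hence makes it constant. *)
Lemma euler_constant q : classP R q -> forall x,
  euler_of s q x = integralR (fun x => euler_of s q x * q x).
Proof.
move=> Pq; have /classPE[aq iq] := Pq; have [q0 _ _ _] := aq.
have q_ge x : 0 <= q x by exact: ltW.
have tE := euler_tempered sm aq.
have dq := admissible_decaying aq (isT : (0 <= 4)%N).
set l := integralR _.
pose M x := euler_of s q x - l.
have tM : tempered M by exact: (temperedB tE (tempered_cst l)).
have iE w : decaying w -> integrableR (fun x => euler_of s q x * w x).
  by move=> dw; exact: (decaying_integrable (decayingM tE dw)).
have M0 x : 0 <= M x.
  apply: gauss_ge0 => [||n]; [exact: tM.1|exact: tM.2|].
  pose ga y := expR (gauss_poly n x).[y].
  have aga : admissible ga by apply: exp_admissible; exact: gauss_decay.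
  have Z0 := admissible_mass_gt0 aga.
  have dga := admissible_decaying aga (isT : (0 <= 4)%N).
  have iga := admissible_integrable aga.
  have := proper_euler_ge0 sm pr (classP_normalize aga) Pq.
  have -> : (fun y => euler_of s q y * ((integralR ga)^-1 * ga y - q y)) =
      (fun y => (integralR ga)^-1 * (euler_of s q y * ga y) - euler_of s q y * q y).
    by apply/funext => y; rewrite mulrBr mulrCA.
  have i1 := iE _ dga; have i2 := iE _ dq.
  rewrite (integralRB (integrableRZ _ i1) i2) (integralRZ _ i1) -/l subr_ge0.
  rewrite mulrC ler_pdivlMr // => h.
  have -> : (fun y => M y * expR (gauss_poly n x).[y]) = (fun y => euler_of s q y * ga y - l * ga y).
    by apply/funext => y; rewrite /M mulrBl.
  by rewrite (integralRB i1 (integrableRZ l iga)) (integralRZ l iga) subr_ge0.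
have iM : integralR (fun x => M x * q x) = 0.
  have -> : (fun y => M y * q y) = (fun y => euler_of s q y * q y - l * q y).
    by apply/funext => y; rewrite /M mulrBl.
  have i2 := iE _ dq; have iqq := admissible_integrable aq.
  by rewrite (integralRB i2 (integrableRZ l iqq)) (integralRZ l iqq) iq mulr1 subrr.
move=> x.
have dMq := decayingM tM dq.
have pos y : 0 <= M y * q y by exact: mulr_ge0.
have /eqP := integralR_eq0 dMq.1 (decaying_integrable dMq) pos iM x.
by rewrite mulf_eq0 (gt_eqF (q0 x)) orbF subr_eq0 => /eqP.
Qed.

End EulerConstant.

Section TwoPointJets.
Variable R : realType.
Implicit Types (P Q A B T : {poly R}) (x : R).

Lemma derivn_comp_XsubC (P : {poly R}) (c : R) n :
  (P \Po ('X - c%:P))^`(n) = P^`(n) \Po ('X - c%:P).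
Proof.
elim: n => [|n IH]; first by rewrite !derivn0.
by rewrite derivnS IH deriv_comp derivXsubC mulr1 -derivnS.
Qed.

Lemma poly_with_jet (c : R) (a : nat -> R) (N : nat) :
  exists P, forall j, (j < N)%N -> P^`(j).[c] = a j.
Proof.
exists ((\poly_(i < N) (a i / (i`!)%:R)) \Po ('X - c%:P)) => j jN.
rewrite derivn_comp_XsubC horner_comp !hornerE subrr horner_coef0 coef_derivn.
rewrite addn0 ffactnn coef_poly jN -[LHS]mulr_natr divfK //.
Qed.

Lemma dvdp_deriv (d A : {poly R}) k : d ^+ k.+1 %| A -> d ^+ k %| A^`().
Proof.
move=> /dvdpP[B ->]; rewrite derivM deriv_exp /= exprS -[_ *+ k.+1]mulr_natr.
have -> : B^`() * (d * d ^+ k) + B * (d^`() * d ^+ k * k.+1%:R)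
    = (B^`() * d + B * d^`() * k.+1%:R) * d ^+ k by ring.
exact: dvdp_mull.
Qed.

Lemma dvdp_derivn_root (c : R) (A : {poly R}) N j : ('X - c%:P) ^+ N %| A -> (j < N)%N ->
  A^`(j).[c] = 0.
Proof.
move=> dA jN; have H k : (k <= N)%N -> ('X - c%:P) ^+ (N - k) %| A^`(k).
  elim: k => [|k IH] kN; first by rewrite subn0 derivn0.
  by rewrite derivnS; apply: dvdp_deriv; rewrite subnSK //; exact/IH/ltnW.
have := H j (ltnW jN); rewrite -(subnSK jN) exprS => h.
have : ('X - c%:P) %| A^`(j) by exact: dvdp_trans (dvdp_mulr _ (dvdpp _)) h.
by rewrite dvdp_XsubCl => /rootP.
Qed.

(** Hermite interpolation at two points, by Bezout's identity for powers of the
    two linear factors. *)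
Lemma poly_with_two_jets (x1 x2 : R) (a b : nat -> R) N : x1 != x2 ->
  exists T, forall j, (j < N)%N -> T^`(j).[x1] = a j /\ T^`(j).[x2] = b j.
Proof.
move=> x12; have [A HA] := poly_with_jet x1 a N; have [B HB] := poly_with_jet x2 b N.
have cop : coprimep (('X - x1%:P) ^+ N) (('X - x2%:P) ^+ N).
  by apply: coprimep_expl; apply: coprimep_expr; rewrite coprimep_XsubC root_XsubC eq_sym.
have [[U V] /= e] := Bezout_eq1_coprimepP _ _ cop.
have e' : U * ('X - x1%:P) ^+ N + V * ('X - x2%:P) ^+ N = 1 by exact: e.
exists (A + (B - A) * (U * ('X - x1%:P) ^+ N)) => j jN; split.
  rewrite derivnD hornerD HA // (_ : _^`(j).[x1] = 0) ?addr0 //.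
  by apply: dvdp_derivn_root jN; rewrite mulrA dvdp_mull.
have -> : A + (B - A) * (U * ('X - x1%:P) ^+ N) = B - (B - A) * (V * ('X - x2%:P) ^+ N).
  have -> : U * ('X - x1%:P) ^+ N = 1 - V * ('X - x2%:P) ^+ N by rewrite -e' addrK.
  by ring.
rewrite derivnB hornerD hornerN HB // (_ : _^`(j).[x2] = 0) ?subr0 //.
by apply: dvdp_derivn_root jN; rewrite mulrA dvdp_mull.
Qed.

(** Polynomials that agree to high order at the roots of d have exponentials with
    the same jets there, up to the value. *)
Lemma exp_numerator_congr (d A B : {poly R}) N j : d ^+ N.+1 %| A - B -> (j <= N)%N ->
  d ^+ (N.+1 - j) %| exp_numerator A j - exp_numerator B j.
Proof.
move=> dAB; elim: j => [|j IH] jN; first by rewrite subrr dvdp0.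
have h := IH (ltnW jN).
have -> : exp_numerator A j.+1 - exp_numerator B j.+1 =
    (exp_numerator A j - exp_numerator B j)^`()
    + ((exp_numerator A j - exp_numerator B j) * A^`()
    + exp_numerator B j * (A - B)^`()) by rewrite /= !derivB; ring.
rewrite subSS; apply: dvdp_add; [|apply: dvdp_add].
- by apply: dvdp_deriv; rewrite -subSn // ltnW.
- by apply: dvdp_mulr; apply: dvdp_trans h; apply: dvdp_exp2l; rewrite leq_sub2r.
- apply: dvdp_mull; apply: dvdp_trans (dvdp_deriv dAB); apply: dvdp_exp2l.
  exact: leq_subr.
Qed.

End TwoPointJets.

(** * Wells: adjusting the mass away from two points *)

Section TwoPointDensities.
Variables (R : realType) (x1 x2 : R).
Implicit Types (P T S : {poly R}) (x : R).

(** A nonnegative polynomial vanishing to high order exactly at the two points: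
    subtracting it changes the mass of exp T but not the jets there. *)
Definition well (M : nat) : {poly R} := (('X - x1%:P) * ('X - x2%:P)) ^+ (2 * M).

Lemma wellE M x : (well M).[x] = (((x - x1) * (x - x2)) ^+ 2) ^+ M.
Proof. by rewrite /well !hornerE exprM. Qed.

Lemma well_ge0 M x : 0 <= (well M).[x].
Proof. by rewrite wellE exprn_ge0 // sqr_ge0. Qed.

Lemma well_dvd1 M : (3 <= M)%N -> ('X - x1%:P) ^+ 5 %| well M.
Proof.
move=> M3; rewrite /well exprMn; apply: dvdp_mulr; apply: dvdp_exp2l.
by apply: leq_trans (_ : (2 * 3 <= _)%N); rewrite ?leq_mul2l.
Qed.

Lemma well_dvd2 M : (3 <= M)%N -> ('X - x2%:P) ^+ 5 %| well M.
Proof.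
move=> M3; rewrite /well exprMn; apply: dvdp_mull; apply: dvdp_exp2l.
by apply: leq_trans (_ : (2 * 3 <= _)%N); rewrite ?leq_mul2l.
Qed.

(** The well has degree 4 (N + 3), which exceeds the growth exponent N of S. *)
Lemma well_dominates S (A k : R) N : (forall x, `|S.[x]| <= A * (1 + `|x|) ^+ N) ->
  0 < k -> quadratic_decay (S - k *: well N.+3).
Proof.
move=> HS k0; set M := N.+3.
pose B := `|A| * 2 ^+ N + 1.
have B0 : 0 <= B by rewrite addr_ge0 // mulr_ge0 // exprn_ge0.
pose R0 := 1 + 2 * `|x1| + 2 * `|x2| + B * 16 ^+ M / k.
have Bk0 : 0 <= B * 16 ^+ M / k by rewrite divr_ge0 ?(ltW k0) // mulr_ge0 // exprn_ge0.
have far x : R0 <= `|x| -> S.[x] + x ^+ 2 <= k * (well M).[x].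
  rewrite /R0 => hx; have n1 := normr_ge0 x1; have n2 := normr_ge0 x2.
  have y1 : 1 <= `|x| by lra.
  have yk : B * 16 ^+ M <= `|x| * k.
    by rewrite -ler_pdivrMr //; lra.
  have half z : 2 * `|z| <= `|x| -> `|x| / 2 <= `|x - z|.
    by move=> hz; have := ler_distD z x 0; rewrite !subr0; lra.
  have h1 : `|x| / 2 <= `|x - x1| by apply: half; lra.
  have h2 : `|x| / 2 <= `|x - x2| by apply: half; lra.
  have x2E : x ^+ 2 = `|x| ^+ 2 by rewrite real_normK // num_real.
  have lower : `|x| ^+ (4 * M) <= 16 ^+ M * (well M).[x].
    rewrite wellE exprM -exprMn; apply: lerXn2r; rewrite ?nnegrE ?exprn_ge0 //.
      by rewrite mulr_ge0 // sqr_ge0.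
    have -> : `|x| ^+ 4 = 16 * ((`|x| / 2) * (`|x| / 2)) ^+ 2 by field.
    rewrite ler_pM2l // -[X in _ <= X](real_normK (num_real _)) normrM.
    have p0 : 0 <= `|x| / 2 by rewrite divr_ge0.
    apply: lerXn2r; rewrite ?nnegrE ?mulr_ge0 //.
    exact: ler_pM.
  have upper : S.[x] + x ^+ 2 <= B * `|x| ^+ (N + 2).
    rewrite /B mulrDl mul1r; apply: lerD; last first.
      by rewrite x2E; apply: ler_weXn2l => //; exact: leq_addl.
    apply: le_trans (ler_norm _) _; apply: le_trans (HS x) _.
    apply: le_trans (_ : `|A| * (1 + `|x|) ^+ N <= _).
      by apply: ler_wpM2r; [exact: weight_pow_ge0|exact: ler_norm].
    rewrite -mulrA; apply: ler_wpM2l => //.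
    apply: le_trans (_ : (2 * `|x|) ^+ N <= _).
      by apply: lerXn2r; rewrite ?nnegrE ?weight_ge0 ?mulr_ge0 //; lra.
    rewrite exprMn; apply: ler_wpM2l; first exact: exprn_ge0.
    by apply: ler_weXn2l => //; exact: leq_addr.
  apply: le_trans upper _.
  have p16 : 0 < 16 ^+ M :> R by rewrite exprn_gt0.
  rewrite -(ler_pM2l p16) mulrCA [X in _ <= X]mulrCA mulrA.
  apply: le_trans (_ : k * `|x| ^+ (4 * M) <= _); last by rewrite ler_pM2l.
  apply: le_trans (_ : `|x| * k * `|x| ^+ (N + 2) <= _).
    by apply: ler_wpM2r; [exact: exprn_ge0|exact: yk].
  rewrite mulrAC -exprS mulrC; apply: ler_wpM2l; first exact: ltW.
  by apply: ler_weXn2l => //; rewrite addn2 leq_pmull.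
have cf : continuous (horner (S + 'X ^+ 2 - k *: well M)) by exact: continuous_horner.
have [C C0 HC] := bounded_on_segment R0 cf.
exists 1, C; split=> // x; rewrite hornerD hornerN hornerZ mul1r lerBrDr.
have [xR|xR] := leP R0 `|x|.
  by have := far x xR; move: (S.[x]) (x ^+ 2) (k * _) => a b d h; lra.
have := le_trans (ler_norm _) (HC x (ltW xR)).
by rewrite !hornerD hornerN hornerZ hornerXn; move: (S.[x]) (x ^+ 2) (k * _) => a b d h; lra.
Qed.

Lemma horner_weight_bound P : exists A N, forall x, `|P.[x]| <= A * (1 + `|x|) ^+ N.
Proof. by have [A [N [_ H]]] := horner_growth P; exists A, N. Qed.

(** Deep wells make the mass small: the integrals tend to 0, as the exponent
    tends to minus infinity off two points. *)
Lemma small_mass T A N : (forall x, `|T.[x]| <= A * (1 + `|x|) ^+ N) ->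
  exists k, 0 < k /\ integralR (fun x => expR (T - k *: well N.+3).[x]) <= 1.
Proof.
move=> HT; set D := well N.+3.
pose f (n : nat) x := expR (T - n.+1%:R *: D).[x].
have dec n : quadratic_decay (T - n.+1%:R *: D).
  by apply: (well_dominates HT); rewrite ltr0n.
have fi n : integrableR (f n).
  exact: admissible_integrable (exp_admissible (dec n)).
have fE n x : f n x = expR T.[x] * expR (- D.[x]) ^+ n.+1.
  by rewrite /f hornerD hornerN hornerZ expRD -expRM_natl mulrN.
have lim : integralR (f n) @[n --> \oo] --> 0.
  have [||||| _ _ h] := @dominated_convergence _ _ R (@lebesgue_measure R) setT measurableT
    (fun n => EFin \o f n) (EFin \o (fun=> 0)) (EFin \o f 0%N).
  - by move=> n; exact: measurable_int (fi n).
  - by apply/measurable_EFinP; exact: measurable_cst.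
  - have N0 : (@lebesgue_measure R).-negligible [set x | D.[x] == 0].
      have N12 : (@lebesgue_measure R).-negligible ([set x1] `|` [set x2]).
        by apply: negligibleU; apply/negligibleP => //; exact: lebesgue_measure_set1.
      apply: negligibleS N12 => x /= /eqP; rewrite wellE => /eqP.
      rewrite expf_eq0 sqrf_eq0 mulf_eq0 !subr_eq0 => /andP[_ /orP[/eqP ->|/eqP ->]].
        by left.
      by right.
    apply: negligibleS N0 => x /= h; apply: contrapT => /negP Dx; apply: h => _.
    have b1 : `|expR (- D.[x])| < 1.
      rewrite ger0_norm ?expR_ge0 // -expR0 ltr_expR oppr_lt0 lt_neqAle eq_sym Dx.
      exact: well_ge0.
    have fx : f n x @[n --> \oo] --> 0.
      have -> : (fun n => f n x) = (fun n => expR T.[x] * expR (- D.[x]) * expR (- D.[x]) ^+ n).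
        by apply/funext => n; rewrite fE exprS mulrA.
      have := cvgM (cvg_cst (expR T.[x] * expR (- D.[x]))) (cvg_expr b1).
      by rewrite mulr0; exact.
    by apply: cvg_EFin; [exact: nearW|exact: fx].
  - exact: fi.
  - apply: aeW => x n _ /=; rewrite lee_fin ger0_norm ?expR_ge0 //.
    rewrite ler_expR !hornerD !hornerN !hornerZ lerD2l lerN2.
    by apply: ler_wpM2r; [exact: well_ge0|rewrite ler1n].
  have E : (\int[@lebesgue_measure R]_x (EFin \o (fun=> 0%R)) x)%E = 0%:E by exact: integral0.
  by rewrite E in h; apply: fine_cvg; exact: h.
have [n Hn] : exists n, integralR (f n) <= 1.
  move/cvgrPdist_le : lim => /(_ 1 ltr01) [n _ Hn]; exists n.
  have := Hn n (leqnn n); rewrite /= sub0r normrN; exact: le_trans (ler_norm _).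
by exists n.+1%:R; split; [rewrite ltr0n|exact: Hn].
Qed.

(** Adding a bump that vanishes at the two points makes the mass large. *)
Lemma large_mass T : exists A N k, [/\
  forall x, `|(T + k *: well 3).[x]| <= A * (1 + `|x|) ^+ N &
  1 <= integralR (fun x => expR (T + k *: well 3 - well N.+3).[x])].
Proof.
have [A [N HT]] := horner_weight_bound T; have [A' [N' HD]] := horner_weight_bound (well 3).
pose N2 := (N + N')%N.
have cf : continuous (horner (T - well N2.+3)) by exact: continuous_horner.
pose c := 1 + `|x1| + `|x2|.
have [C C0 HC] := bounded_on_segment (c + 1) cf.
have growth k x : `|(T + k *: well 3).[x]| <= (`|A| + `|k| * `|A'|) * (1 + `|x|) ^+ N2.
  rewrite hornerD hornerZ; apply: le_trans (ler_normD _ _) _; rewrite mulrDl normrM.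
  apply: lerD.
    apply: le_trans (HT x) _; apply: le_trans (_ : `|A| * (1 + `|x|) ^+ N <= _).
      by apply: ler_wpM2r; [exact: weight_pow_ge0|exact: ler_norm].
    by apply: ler_wpM2l => //; apply: ler_weXn2l; [exact: weight_ge1|exact: leq_addr].
  rewrite -mulrA; apply: ler_wpM2l => //; apply: le_trans (HD x) _.
  apply: le_trans (_ : `|A'| * (1 + `|x|) ^+ N' <= _).
    by apply: ler_wpM2r; [exact: weight_pow_ge0|exact: ler_norm].
  by apply: ler_wpM2l => //; apply: ler_weXn2l; [exact: weight_ge1|exact: leq_addl].
(* On [c, c + 1], to the right of both points, the bump [well 3] is at least 1
   and T - well N2.+3 is at least - C, so that the exponent is nonnegative. *)
exists (`|A| + `|C| * `|A'|), N2, C; split; first exact: growth.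
have dec : quadratic_decay (T + C *: well 3 - 1 *: well N2.+3).
  by apply: (well_dominates (growth C)).
rewrite scale1r in dec.
have := @integralR_ge_itv R (fun x => expR (T + C *: well 3 - well N2.+3).[x]) c (c + 1) 1
  (admissible_integrable (exp_admissible dec)) (fun x => expR_ge0 _).
rewrite [c + 1]addrC addrK mulr1; apply; first by rewrite lerDr.
move=> x /andP[cx xc]; rewrite -expR0 ler_expR.
have c0 : 0 <= c by rewrite /c !addr_ge0.
have w1 : 1 <= (well 3).[x].
  have a1 : 1 <= x - x1 by have := ler_norm x1; have := normr_ge0 x2; rewrite /c in cx; lra.
  have a2 : 1 <= x - x2 by have := ler_norm x2; have := normr_ge0 x1; rewrite /c in cx; lra.
  by rewrite wellE; apply: exprn_ege1; apply: exprn_ege1; rewrite -[leLHS]mulr1 ler_pM.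
have := HC x; rewrite ger0_norm; last exact: le_trans cx.
move=> /(_ _); rewrite addrC => /(_ xc); rewrite ler_norml => /andP[h _].
move: h; rewrite !hornerD !hornerN hornerZ.
have Cw : C <= C * (well 3).[x] by rewrite -[leLHS]mulr1; apply: ler_wpM2l.
by move: (T.[x]) (well N2.+3).[x] (C * _) Cw => a b d Cw h; lra.
Qed.

End TwoPointDensities.

(** * Densities with prescribed jets *)

Section DensityWithJets.
Variable R : realType.
Implicit Types (p q : R -> R) (x : R) (P T : {poly R}).

Lemma log_derivative_exp P j x : quadratic_decay P -> (j <= 4)%N ->
  log_derivative (fun x => expR P.[x]) j x = P^`(j).[x].
Proof.
move=> dP j4; rewrite -(log_derivativeE (exp_admissible dP) j4).
have -> : (fun x => ln (expR P.[x])) = horner P^`(0).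
  by apply/funext => y; rewrite expRK derivn0.
by rewrite (@derive1n_chain _ 4 (fun j => horner P^`(j))).
Qed.

Lemma log_derivative_congr p q x : p x = q x ->
  (forall j, (1 <= j <= 4)%N -> ratio p j x = ratio q j x) ->
  forall j, (j <= 4)%N -> log_derivative p j x = log_derivative q j x.
Proof.
move=> pq H; have r1 := H 1%N isT; have r2 := H 2%N isT; have r3 := H 3%N isT; have r4 := H 4%N isT.
case=> [|[|[|[|[|j]]]]] // _; rewrite /log_derivative.
- by rewrite pq.
- by rewrite r1 r2.
- by rewrite r1 r2 r3.
- by rewrite r1 r2 r3 r4.
Qed.

(** Jets of order 4 at two distinct points can be prescribed: exp of an
    interpolating polynomial, corrected by terms flat at both points so that the
    mass is at most 1, resp. at least 1; mixing both versions normalizes without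
    affecting the jets. *)
Lemma density_with_two_jets (x1 x2 : R) (a b : nat -> R) : x1 != x2 ->
  exists2 p, classP R p & forall j, (j <= 4)%N ->
    log_derivative p j x1 = a j /\ log_derivative p j x2 = b j.
Proof.
move=> x12; have [T HT] := poly_with_two_jets a b 5 x12.
have [A [N [k [HA large]]]] := large_mass x1 x2 T.
have [A' [N' HA']] := horner_weight_bound T.
have [k' [k'0 small]] := small_mass x1 x2 HA'.
set P1 := _ - _ in large; set P2 := _ - _ in small.
have d1 : quadratic_decay P1.
  by rewrite /P1 -[well _ _ N.+3]scale1r; exact: (well_dominates x1 x2 HA ltr01).
have d2 : quadratic_decay P2 by exact: (well_dominates x1 x2 HA' k'0).
have a1 := exp_admissible d1; have a2 := exp_admissible d2.
have flat1 (c : R) : x1 = c \/ x2 = c -> ('X - c%:P) ^+ 5 %| P1 - T /\ ('X - c%:P) ^+ 5 %| P2 - T.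
  have E1 : P1 - T = k *: well x1 x2 3 - well x1 x2 N.+3.
    by rewrite /P1 -!mul_polyC; ring.
  have E2 : P2 - T = - (k' *: well x1 x2 N'.+3).
    by rewrite /P2 -!mul_polyC; ring.
  move=> cc; have dv M : (3 <= M)%N -> ('X - c%:P) ^+ 5 %| well x1 x2 M.
    by case: cc => <-; [exact: well_dvd1|exact: well_dvd2].
  rewrite E1 E2 -scaleNr -!mul_polyC; split; last by apply: dvdp_mull; exact: dv.
  by apply: dvdp_sub; [apply: dvdp_mull; exact: dv|exact: dv].
have jets c : x1 = c \/ x2 = c -> forall j, (j <= 4)%N ->
    P1^`(j).[c] = T^`(j).[c] /\ (exp_numerator P1 j).[c] = (exp_numerator P2 j).[c].
  move=> cc j j4; have [f1 f2] := flat1 c cc; split.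
    have -> : P1 = (P1 - T) + T by rewrite subrK.
    by rewrite derivnD hornerD (dvdp_derivn_root f1) ?add0r.
  have f12 : ('X - c%:P) ^+ 5 %| P1 - P2.
    have -> : P1 - P2 = (P1 - T) - (P2 - T) by ring.
    exact: dvdp_sub.
  have := exp_numerator_congr f12 j4; rewrite subSn // exprS => h.
  have : ('X - c%:P) %| exp_numerator P1 j - exp_numerator P2 j.
    by apply: dvdp_trans h; apply: dvdp_mulr.
  by rewrite dvdp_XsubCl => /rootP /eqP; rewrite hornerD hornerN subr_eq0 => /eqP.
set m1 := integralR _ in large; set m2 := integralR _ in small.
have [th [th0 th1 mass]] : exists th, [/\ 0 <= th, th <= 1 & th * m1 + (1 - th) * m2 = 1].
  have [e|ne] := eqVneq m1 m2.
    exists 1; split=> //; have : m1 = 1 by apply/le_anti; rewrite large e small.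
    by move=> ->; ring.
  have m12 : 0 < m1 - m2.
    by rewrite subr_gt0 lt_neqAle eq_sym ne; exact: le_trans large.
  exists ((1 - m2) / (m1 - m2)); split.
  - by apply: divr_ge0; rewrite subr_ge0 //; exact: le_trans small large.
  - by rewrite ler_pdivrMr // mul1r lerD2r.
  - by field; rewrite gt_eqF.
have th1' : 0 <= 1 - th by rewrite subr_ge0.
have thp : 0 < th + (1 - th) by rewrite addrC subrK.
exists (fun x => th * expR P1.[x] + (1 - th) * expR P2.[x]); first exact: classP_comb.
have key c : x1 = c \/ x2 = c -> forall j, (j <= 4)%N ->
    log_derivative (fun x => th * expR P1.[x] + (1 - th) * expR P2.[x]) j c = T^`(j).[c].
  move=> cc j j4; have [J1 _] := jets c cc j j4; rewrite -J1 -(log_derivative_exp c d1 j4).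
  have P12 : expR P1.[c] = expR P2.[c].
    have [f1 f2] := flat1 c cc.
    have e1 : (P1 - T)^`(0).[c] = 0 by exact: dvdp_derivn_root f1 _.
    have e2 : (P2 - T)^`(0).[c] = 0 by exact: dvdp_derivn_root f2 _.
    move: e1 e2; rewrite !derivn0 !hornerD !hornerN => /eqP + /eqP.
    by rewrite !subr_eq0 => /eqP -> /eqP ->.
  have [c1p c1 _ _] := a1; have [c2p c2 _ _] := a2.
  apply: log_derivative_congr => // [|i /andP[_ i4]].
    by rewrite -P12; ring.
  rewrite /ratio derive1n_comb // !exp_chain -P12.
  have [_ <-] := jets c cc i i4.
  have e0 : expR P1.[c] != 0 by rewrite gt_eqF // expR_gt0.
  move: (expR P1.[c]) (exp_numerator P1 i).[c] e0 => e y e0.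
  have -> : th * (y * e) + (1 - th) * (y * e) = y * e by ring.
  by have -> : th * e + (1 - th) * e = e; first ring.
move=> j j4; have [h1 h2] := HT j j4; split.
  by rewrite key //; left.
by rewrite key //; right.
Qed.

End DensityWithJets.

Section EulerUniversal.
Variables (R : realType) (s : 'rV[R]_4 -> R).
Hypothesis sm : moderate 4 s.
Hypothesis pr : proper_score (local_score 2 s).

(** The Euler-Lagrange expression is one constant, the same for all densities:
    any two jets at distinct points occur in a common density. *)
Lemma euler_universal : exists c : R, forall v y3 y4, euler s v y3 y4 = c.
Proof.
pose jet_of (v : 'rV[R]_4) (y3 y4 : R) (j : nat) : R :=
  match j with 0 => v 0 1 | 1 => v 0 2 | 2 => v 0 3 | 3 => y3 | _ => y4 end.
have two (v : 'rV[R]_4) y3 y4 (w : 'rV[R]_4) z3 z4 : v 0 0 != w 0 0 -> euler s v y3 y4 = euler s w z3 z4.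
  move=> vw; have [p Pp Hp] := density_with_two_jets (jet_of v y3 y4) (jet_of w z3 z4) vw.
  have row (u : 'rV[R]_4) (t3 t4 : R) : (forall j, (j <= 4)%N ->
      log_derivative p j (u 0 0) = jet_of u t3 t4 j) -> log_jet 2 p (u 0 0) = u.
    move=> H; apply/rowP => i; rewrite mxE; case: i => -[|[|[|[|m]]]] im //=.
    - by congr (u _ _); apply/val_inj.
    - by have := H 0%N isT; rewrite /= => ->; congr (u _ _); apply/val_inj.
    - by have := H 1%N isT; rewrite /= => ->; congr (u _ _); apply/val_inj.
    - by have := H 2%N isT; rewrite /= => ->; congr (u _ _); apply/val_inj.
  have H1 j : (j <= 4)%N -> log_derivative p j (v 0 0) = jet_of v y3 y4 j by move=> /Hp[].
  have H2 j : (j <= 4)%N -> log_derivative p j (w 0 0) = jet_of w z3 z4 j by move=> /Hp[].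
  have E1 : euler_of s p (v 0 0) = euler s v y3 y4.
    by rewrite /euler_of (row _ _ _ H1) (H1 3%N isT) (H1 4%N isT).
  have E2 : euler_of s p (w 0 0) = euler s w z3 z4.
    by rewrite /euler_of (row _ _ _ H2) (H2 3%N isT) (H2 4%N isT).
  by rewrite -E1 -E2 !(euler_constant sm pr Pp).
pose o (x : R) : 'rV[R]_4 := const_mx x.
have oE x : o x 0 0 = x by rewrite mxE.
exists (euler s (o 0) 0 0) => v y3 y4.
have [v0|v0] := eqVneq (v 0 0) 0; last by apply: two; rewrite oE.
rewrite (two v y3 y4 (o 1) 0 0); last by rewrite oE v0 eq_sym oner_eq0.
by apply: two; rewrite !oE oner_eq0.
Qed.

Lemma partial_eq0 (f : 'rV[R]_4 -> R) i : (forall v, f v = 0) -> partial i f = fun=> 0.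
Proof. by move=> f0; rewrite (_ : f = fun=> 0) ?partial_cst //; apply/funext. Qed.

(** Consequences of the constancy of the Euler-Lagrange expression, read off its
    coefficients in the third and fourth derivatives of ln q. *)
Lemma euler_coefficients : exists c : R, [/\
  forall v, partial 3 (partial 3 s) v = 0, forall v, partial 3 (flux s) v = 0 &
  forall v, partial 1 s v + (partial 0 (flux s) v + v 0 2 * partial 1 (flux s) v
    + v 0 3 * partial 2 (flux s) v) + v 0 2 * flux s v = c].
Proof.
have [c H] := euler_universal; exists c.
have s33 v : partial 3 (partial 3 s) v = 0.
  have <- : euler s v 0 1 - euler s v 0 0 = partial 3 (partial 3 s) v.
    rewrite /euler; move: (partial 3 (partial 3 s) v) (partial 1 s v)
      (total_derivative _ v 0) (total_derivative (flux s) v 0) (flux s v) (v 0 2) => *; ring.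
  by rewrite !H subrr.
have ds33 v y3 : total_derivative (partial 3 (partial 3 s)) v y3 = 0.
  by rewrite /total_derivative !(partial_eq0 _ s33) !mulr0 !addr0.
have red v y3 : partial 1 s v + total_derivative (flux s) v y3 + v 0 2 * flux s v = c.
  by rewrite -(H v y3 0) /euler s33 ds33 !mulr0 !addr0 add0r.
have f3 v : partial 3 (flux s) v = 0.
  have <- : (partial 1 s v + total_derivative (flux s) v 1 + v 0 2 * flux s v)
      - (partial 1 s v + total_derivative (flux s) v 0 + v 0 2 * flux s v) = partial 3 (flux s) v.
    rewrite /total_derivative; move: (partial 1 s v) (partial 3 (flux s) v) (partial 0 (flux s) v)
      (v 0 2 * partial 1 _ v) (v 0 3 * partial 2 _ v) (v 0 2 * flux s v) => *; ring.
  by rewrite !red subrr.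
split; [exact: s33|exact: f3|move=> v].
have td0 (f : 'rV[R]_4 -> R) : partial 0 f v + v 0 2 * partial 1 f v + v 0 3 * partial 2 f v
    = total_derivative f v 0 by rewrite /total_derivative mul0r addr0.
by rewrite td0; exact: red.
Qed.

End EulerUniversal.

(** * The structure of proper scores *)

Section FluxVanishes.
Variables (R : realType) (s : 'rV[R]_4 -> R).
Implicit Types (v : 'rV[R]_4) (A F : 'rV[R]_4 -> R).

Lemma moderate1_derivable F v i : moderate 1 F -> derivable F v (delta_mx 0 i).
Proof. by case=> cF _; exact: cont_partials_derivable cF. Qed.

Let combine A (B0 B1 B2 : 'rV[R]_4 -> R) F v :=
  A v + (B0 v + v 0 2 * B1 v + v 0 3 * B2 v) + v 0 2 * F v.

Let partial_combine A (B0 B1 B2 : 'rV[R]_4 -> R) F i v (a b : R) :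
  (i == 2)%:R = a -> (i == 3)%:R = b -> moderate 1 A -> moderate 1 B0 -> moderate 1 B1 -> moderate 1 B2 -> moderate 1 F ->
  partial i (combine A B0 B1 B2 F) v =
  partial i A v + (partial i B0 v + (a * B1 v + v 0 2 * partial i B1 v)
    + (b * B2 v + v 0 3 * partial i B2 v))
  + (a * F v + v 0 2 * partial i F v).
Proof.
move=> <- <- mA m0 m1 m2 mF.
have d (G : 'rV[R]_4 -> R) : moderate 1 G -> forall w, derivable G w (delta_mx 0 i).
  by move=> mG w; exact: (moderate1_derivable mG).
have c j : moderate 1 (fun w : 'rV[R]_4 => w 0 j) by exact: moderate_coord.
have n1 := moderateM (c 2) m1; have n2 := moderateM (c 3) m2; have n3 := moderateM (c 2) mF.
have e1 := moderateD m0 n1; have e2 := moderateD e1 n2; have e3 := moderateD mA e2.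
rewrite /combine (partialD (d _ e3) (d _ n3)) (partialD (d _ mA) (d _ e2)).
rewrite (partialD (d _ e1) (d _ n2)) (partialD (d _ m0) (d _ n1)).
by rewrite (partialM (d _ (c 2)) (d _ m1)) (partialM (d _ (c 3)) (d _ m2))
  (partialM (d _ (c 2)) (d _ mF)) !partial_coord.
Qed.

Hypothesis sm : moderate 4 s.
Hypothesis pr : proper_score (local_score 2 s).

(** Let F be the flux, so that s_0 + D F + y_1 F = c. Differentiating this in y_2
    gives the derivative of F in y_1; differentiating it in y_1 then leaves only
    F = 0, all other terms cancelling by the symmetry of mixed derivatives. *)
Lemma flux_eq0 : exists c : R, [/\ forall v, partial 3 (partial 3 s) v = 0,
  forall v, flux s v = 0 & forall v, partial 1 s v = c].
Proof.
have [c [s33 f3 rel]] := euler_coefficients sm pr.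
pose f := flux s; pose S := partial 3 s.
have mf : moderate 2 f by exact: flux_moderate.
have mf1 : moderate 1 f by exact: (moderateW (isT : (1 <= 2)%N) mf).
have mfi i : moderate 1 (partial i f) by exact: moderate_partial.
have ms i : moderate 3 (partial i s) by exact: moderate_partial.
have ms1 i : moderate 1 (partial i s) by exact: (moderateW (isT : (1 <= 3)%N) (ms i)).
have mSi i : moderate 2 (partial i S) by exact: (moderate_partial i (ms 3)).
have mSi1 i : moderate 1 (partial i S) by exact: (moderateW (isT : (1 <= 2)%N) (mSi i)).
have Cs i j : partial i (partial j s) = partial j (partial i s).
  by apply: partialC; exact: (cont_partialsW (isT : (2 <= 4)%N) sm.1).
have CS i j : partial i (partial j S) = partial j (partial i S).
  by apply: partialC; exact: (cont_partialsW (isT : (2 <= 3)%N) (ms 3).1).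
have Cf i j : partial i (partial j f) = partial j (partial i f).
  by apply: partialC; exact: mf.1.
have relE : combine (partial 1 s) (partial 0 f) (partial 1 f) (partial 2 f) f = fun=> c.
  by apply/funext => v; exact: rel.
have f3i i v : partial 3 (partial i f) v = 0 by rewrite Cf (partial_eq0 i f3).
have L i v : 0 = partial i (combine (partial 1 s) (partial 0 f) (partial 1 f) (partial 2 f) f) v.
  by rewrite relE partial_cst.
have d3 v : partial 3 (partial 1 s) v + partial 2 f v = 0.
  have E := etrans (L 3 v) (@partial_combine (partial 1 s) (partial 0 f) (partial 1 f)
    (partial 2 f) f 3 v 0 1 erefl erefl (ms1 1) (mfi 0) (mfi 1) (mfi 2) mf1).
  have alg (a b0 b1 b2 B1 B2 F F3 y z : R) : 0 = a + (b0 + (0 * B1 + y * b1)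
      + (1 * B2 + z * b2)) + (0 * F + y * F3) -> b0 = 0 -> b1 = 0 -> b2 = 0 -> F3 = 0 -> a + B2 = 0.
    by move=> /[swap] -> /[swap] -> /[swap] -> /[swap] -> ->; ring.
  exact: (alg _ _ _ _ _ _ _ _ _ _ E (f3i 0 v) (f3i 1 v) (f3i 2 v) (f3 v)).
have f2 : partial 2 f = fun v => -1 * partial 1 S v.
  apply/funext => v; rewrite mulN1r; apply/eqP; rewrite -addr_eq0 addrC /S Cs.
  by apply/eqP; exact: d3.
have partialZ (a : R) F i v : moderate 1 F -> partial i (fun v => a * F v) v = a * partial i F v.
  move=> mF; have dF w : derivable F w (delta_mx 0 i) by exact: (moderate1_derivable mF).
  have da w : derivable (fun _ : 'rV[R]_4 => a) w (delta_mx 0 i).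
    exact: (moderate1_derivable (@moderate_cst R 3 1 a)).
  by rewrite (partialM da dF) partial_cst mul0r add0r.
have f2i i v : partial 2 (partial i f) v = -1 * partial i (partial 1 S) v.
  by rewrite Cf f2 partialZ.
have mN2 : moderate 1 (fun v => -1 * partial 2 s v).
  by apply: moderateM => //; exact: moderate_cst.
have fE : f = combine (fun v => -1 * partial 2 s v) (partial 0 S) (partial 1 S) (partial 2 S) S.
  have alg (b0 b1 b2 F a y z : R) : b0 + y * b1 + z * b2 + y * F - a
      = -1 * a + (b0 + y * b1 + z * b2) + y * F by ring.
  by apply/funext => v; exact: alg.
have f1 v : partial 1 f v = - partial 1 (partial 2 s) v + (partial 1 (partial 0 S) v
    + v 0 2 * partial 1 (partial 1 S) v + v 0 3 * partial 1 (partial 2 S) v) + v 0 2 * partial 1 S v.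
  have E := @partial_combine _ _ _ _ _ 1 v 0 0 erefl erefl mN2 (mSi1 0) (mSi1 1) (mSi1 2) (ms1 3).
  have alg (a a' b0 b1 b2 B1 B2 F F1 X y z : R) : X = a + (b0 + (0 * B1 + y * b1)
      + (0 * B2 + z * b2)) + (0 * F + y * F1) -> a = -1 * a' ->
      X = - a' + (b0 + y * b1 + z * b2) + y * F1.
    by move=> -> ->; ring.
  exact: (alg _ _ _ _ _ _ _ _ _ _ _ _ (etrans (congr1 (fun g => partial 1 g v) fE) E)
    (partialZ _ _ 1 v (ms1 2))).
have f0 v : f v = 0.
  have E := etrans (L 2 v) (@partial_combine (partial 1 s) (partial 0 f) (partial 1 f)
    (partial 2 f) f 2 v 1 0 erefl erefl (ms1 1) (mfi 0) (mfi 1) (mfi 2) mf1).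
  have alg (a a' b b' d d' e e' g g' h k l m n y z : R) :
      0 = a + (b + (1 * g + y * d) + (0 * h + z * e)) + (1 * k + y * g') ->
      b = -1 * b' -> d = -1 * d' -> e = -1 * e' -> g' = -1 * n ->
      g = - a' + (l + y * d' + z * m) + y * n -> a = a' -> l = b' -> m = e' -> k = 0.
    by move=> E0 h1 h2 h3 h4 h5 h6 h7 h8; move: E0; rewrite h1 h2 h3 h4 h5 h6 h7 h8 => ->; ring.
  exact: (alg _ _ _ _ _ _ _ _ _ _ _ _ _ _ _ _ _ E (f2i 0 v) (f2i 1 v) (f2i 2 v)
    (congr1 (fun g => g v) f2) (f1 v) (congr1 (fun g => g v) (Cs 2 1))
    (congr1 (fun g => g v) (CS 1 0)) (congr1 (fun g => g v) (CS 1 2))).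
exists c; split; [exact: s33|exact: f0|move=> v].
have fi i v' : partial i f v' = 0 by rewrite (partial_eq0 i f0).
have alg (a b0 b1 b2 F y z d : R) : a + (b0 + y * b1 + z * b2) + y * F = d ->
    b0 = 0 -> b1 = 0 -> b2 = 0 -> F = 0 -> a = d.
  by move=> <- -> -> -> ->; ring.
exact: (alg _ _ _ _ _ _ _ _ (rel v) (fi 0 v) (fi 1 v) (fi 2 v) (f0 v)).
Qed.

End FluxVanishes.

(** * Primitives depending on a parameter *)

Section Tame.
Variable R : realType.
Implicit Types (b bx : R -> R -> R) (x y z : R).

(** Lipschitz dependence on x with polynomial constants is a condition stable
    under integration in y, and strong enough to differentiate in x under the
    integral sign. *)
Definition tame b := [/\ forall x, continuous (b x),
  exists (C : R) (n : nat), 0 <= C /\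
    forall x y, `|b x y| <= C * ((1 + `|x|) * (1 + `|y|)) ^+ n &
  exists (C : R) (n : nat), 0 <= C /\
    forall x x' y, `|b x' y - b x y| <=
      C * ((1 + `|x|) * (1 + `|x'|) * (1 + `|y|)) ^+ n * `|x' - x|].

Definition primitive_y b x y := primitive (b x) y.

Lemma is_derive_primitive_y b x y : continuous (b x) ->
  is_derive y 1 (primitive_y b x) (b x y).
Proof. by move=> /primitiveP[h _]; exact: h. Qed.

Lemma primitive_y0 b x : continuous (b x) -> primitive_y b x 0 = 0.
Proof. by case/primitiveP. Qed.

Let growth_from_0 (g dg : R -> R) (K : R) (y : R) : (forall z, is_derive z 1 g (dg z)) ->
  g 0 = 0 -> (forall z, `|z| <= `|y| -> `|dg z| <= K) -> `|g y| <= K * `|y|.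
Proof.
move=> dgE g0 H; have [th th01] := @mean_value R g dg 0 y (fun th _ => dgE _).
rewrite g0 !subr0 add0r => ->; rewrite normrM; apply: ler_wpM2r => //; apply: H.
by case/andP: th01 => t0 t1; rewrite normrM ger0_norm // ler_piMl.
Qed.

Let weights_ge1 x y : 1 <= (1 + `|x|) * (1 + `|y|).
Proof. by rewrite -[leLHS]mulr1 ler_pM // weight_ge1. Qed.

Lemma primitive_y_tame b : tame b -> tame (primitive_y b).
Proof.
move=> [cb [C [n [C0 HC]]] [D [m [D0 HD]]]]; split.
- by move=> x; apply: is_derive_continuous => y; exact: is_derive_primitive_y.
- exists C, n.+1; split=> // x y.
  have h := @growth_from_0 (primitive_y b x) (b x) (C * ((1 + `|x|) * (1 + `|y|)) ^+ n) y
    (fun z => is_derive_primitive_y z (cb x)) (primitive_y0 (cb x)).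
  apply: le_trans (h _) _.
    move=> z zy; apply: le_trans (HC x z) _; apply: ler_wpM2l => //.
    apply: lerXn2r; rewrite ?nnegrE ?mulr_ge0 ?weight_ge0 //.
    by apply: ler_wpM2l; [exact: weight_ge0|rewrite lerD2l].
  rewrite -mulrA; apply: ler_wpM2l => //; rewrite exprSr; apply: ler_wpM2l.
    by rewrite exprn_ge0 // mulr_ge0 // weight_ge0.
  apply: le_trans (_ : 1 * (1 + `|y|) <= _); first by rewrite mul1r lerDr.
  by apply: ler_wpM2r; [exact: weight_ge0|exact: weight_ge1].
- exists D, m.+1; split=> // x x' y.
  have W0 z : 0 <= (1 + `|x|) * (1 + `|x'|) * (1 + `|z|).
    by rewrite !mulr_ge0 // weight_ge0.
  have h := @growth_from_0 (fun y => primitive_y b x' y - primitive_y b x y)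
    (fun y => b x' y - b x y)
    (D * ((1 + `|x|) * (1 + `|x'|) * (1 + `|y|)) ^+ m * `|x' - x|) y
    (fun z => is_derive_sub (is_derive_primitive_y z (cb x')) (is_derive_primitive_y z (cb x))).
  apply: le_trans (h _ _) _.
  + by rewrite !primitive_y0 // subrr.
  + move=> z zy; apply: le_trans (HD x x' z) _; apply: ler_wpM2r => //; apply: ler_wpM2l => //.
    apply: lerXn2r; rewrite ?nnegrE //.
    by apply: ler_wpM2l; [rewrite mulr_ge0 // weight_ge0|rewrite lerD2l].
  rewrite [leLHS]mulrAC; apply: ler_wpM2r => //; rewrite -[leLHS]mulrA; apply: ler_wpM2l => //.
  rewrite exprSr; apply: ler_wpM2l; first exact: exprn_ge0.
  apply: le_trans (_ : 1 * (1 + `|y|) <= _); first by rewrite mul1r lerDr.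
  by apply: ler_wpM2r; [exact: weight_ge0|exact: weights_ge1].
Qed.

Lemma is_derive_quadratic (g : R -> R) (x d K : R) :
  (forall h, `|h| <= 1 -> `|g (x + h) - g x - h * d| <= K * h ^+ 2) ->
  is_derive x 1 g d.
Proof.
move=> H.
have lim : h^-1 *: (g (h *: (1 : R) + x) - g x) @[h --> 0^'] --> d.
  apply/cvgrPdist_le => e e0.
  have K1 : 0 < `|K| + 1 by rewrite ltr_wpDl.
  near=> h.
  have hn0 : h != 0 by near: h; exact: nbhs_dnbhs_neq.
  have h1 : `|h| <= 1 by near: h; apply: dnbhs0_le.
  have he : `|h| <= e / (`|K| + 1) by near: h; apply: dnbhs0_le; rewrite divr_gt0.
  have -> : h *: (1 : R) + x = x + h by rewrite [h *: 1]mulr1 addrC.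
  rewrite distrC /GRing.scale /=.
  have -> : h^-1 * (g (x + h) - g x) - d = h^-1 * (g (x + h) - g x - h * d).
    by rewrite [in RHS]mulrBr mulKf.
  rewrite normrM normfV ler_pdivrMl ?normr_gt0 //.
  apply: le_trans (H h h1) _; apply: le_trans (_ : (`|K| + 1) * h ^+ 2 <= _).
    by apply: ler_wpM2r; [exact: sqr_ge0|apply: le_trans (ler_norm K) _; rewrite lerDl].
  rewrite -(real_normK (num_real h)) expr2 mulrCA; apply: ler_wpM2l => //.
  by rewrite -ler_pdivlMl // mulrC.
split; first by apply/cvg_ex; exists d.
exact/cvg_lim.
Unshelve. all: by end_near. Qed.

(** The remainder of the first-order expansion in x of the primitive has the
    remainder for b as its derivative in y, of order h^2 because bx is Lipschitz
    in x. *)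
Lemma is_derive_primitive_x b bx x y : tame b -> tame bx ->
  (forall x y, is_derive x 1 (fun t => b t y) (bx x y)) ->
  is_derive x 1 (fun t => primitive_y b t y) (primitive_y bx x y).
Proof.
move=> [cb _ _] [cbx _ [D [m [D0 HD]]]] dbx.
pose K z := D * ((1 + `|x|) * (2 + `|x|) * (1 + `|z|)) ^+ m.
apply: (@is_derive_quadratic _ _ _ (K y * `|y|)) => h h1.
have r z : is_derive z 1 (fun z => primitive_y b (x + h) z - primitive_y b x z - h * primitive_y bx x z)
    (b (x + h) z - b x z - h * bx x z).
  exact: (is_derive_sub (is_derive_sub (is_derive_primitive_y z (cb (x + h)))
    (is_derive_primitive_y z (cb x))) (is_derive_scale h (is_derive_primitive_y z (cbx x)))).
have := @growth_from_0 _ _ (K y * h ^+ 2) y r.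
rewrite !primitive_y0 // mulr0 !subrr => /(_ erefl) H.
rewrite [K y * _ * _]mulrAC; apply: H => z zy.
have [th th01] := @mean_value R (fun t => b t z) (fun t => bx t z) x (x + h) (fun th _ => dbx _ _).
rewrite addrAC subrr add0r => ->.
have -> : bx (x + th * h) z * h - h * bx x z = h * (bx (x + th * h) z - bx x z) by ring.
case/andP: th01 => t0 t1.
have th1 : `|th * h| <= `|h| by rewrite normrM ger0_norm // ler_piMl.
rewrite normrM; have := HD x (x + th * h) z; rewrite addrAC subrr add0r => Hz.
have w0 : 0 <= (1 + `|x|) * (1 + `|x + th * h|) * (1 + `|z|).
  by rewrite !mulr_ge0 // weight_ge0.
have Wle : D * ((1 + `|x|) * (1 + `|x + th * h|) * (1 + `|z|)) ^+ m <= K y.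
  apply: ler_wpM2l; first exact: D0.
  apply: lerXn2r; [by rewrite nnegrE|by rewrite nnegrE !mulr_ge0 ?weight_ge0 ?addr_ge0|].
  apply: ler_pM.
  - by rewrite mulr_ge0 ?weight_ge0.
  - exact: weight_ge0.
  - apply: ler_wpM2l; first exact: weight_ge0.
    by have := ler_normD x (th * h); clear -h1 th1; lra.
  - by rewrite lerD2l.
have K0 : 0 <= K y.
  by rewrite /K mulr_ge0 // exprn_ge0 // !mulr_ge0 ?weight_ge0 // addr_ge0.
rewrite -(real_normK (num_real h)) expr2 mulrCA; apply: ler_wpM2l => //.
apply: le_trans Hz _; apply: ler_pM => //.
by rewrite mulr_ge0 // exprn_ge0.
Qed.

Lemma tame_slice b : tame b -> tame (fun x _ => b x 0).
Proof.
move=> [cb [C [n [C0 HC]]] [D [m [D0 HD]]]]; split.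
- by move=> x y; exact: cvg_cst.
- exists C, n; split=> // x y; apply: le_trans (HC x 0) _; apply: ler_wpM2l => //.
  apply: lerXn2r; rewrite ?nnegrE ?mulr_ge0 ?weight_ge0 //.
  by apply: ler_wpM2l; [exact: weight_ge0|rewrite lerD2l normr0].
- exists D, m; split=> // x x' y; apply: le_trans (HD x x' 0) _.
  apply: ler_wpM2r => //; apply: ler_wpM2l => //.
  apply: lerXn2r; rewrite ?nnegrE ?mulr_ge0 ?weight_ge0 //.
  by apply: ler_wpM2l; [rewrite mulr_ge0 ?weight_ge0|rewrite lerD2l normr0].
Qed.

End Tame.

(** * Functions of two coordinates *)

(** The analogue of [partial_congr] for arbitrary directions, with existence of
    the derivative. *)
Lemma is_derive_congr (R : realType) (V W : normedModType R) (f : V -> R) (g : W -> R)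
    (v e : V) (w u : W) (d : R) :
  (forall h : R, f (h *: e + v) - f v = g (h *: u + w) - g w) ->
  is_derive w u g d -> is_derive v e f d.
Proof.
move=> E [dg gE].
have QE : (fun h : R => h^-1 *: ((f \o shift v) (h *: e) - f v)) =
    (fun h => h^-1 *: ((g \o shift w) (h *: u) - g w)).
  by apply/funext => h; congr (_ *: _); exact: E.
by split; [rewrite /derivable QE|rewrite /derive QE].
Qed.

Section Planar.
Variables (R : realType) (n : nat) (j : 'I_n.+1).
Hypothesis j0 : j != 0.
Implicit Types (P Px Py : R -> R -> R) (x y : R) (v : 'rV[R]_n.+1).

(** Rows of any length, to serve both for K_0 and for K. *)
Definition planar P v := P (v 0 0) (v 0 j).

Let shiftE (h : R) i k v : (h *: delta_mx 0 i + v) 0 k = h * (k == i)%:R + v 0 k.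
Proof. by rewrite !mxE eqxx. Qed.

Lemma is_derive_planar P Px Py v i :
  (forall x y, is_derive x 1 (fun t => P t y) (Px x y)) ->
  (forall x y, is_derive y 1 (P x) (Py x y)) ->
  is_derive v (delta_mx 0 i) (planar P)
    (if i == 0 then planar Px v else if i == j then planar Py v else 0).
Proof.
move=> dx dy; case: (altP (i =P 0)) => [->|i0].
  apply: is_derive_congr (dx (v 0 0) (v 0 j)) => h.
  by rewrite /planar !shiftE eqxx (negbTE j0) mulr0 add0r.
case: (altP (i =P j)) => [->|ij].
  apply: is_derive_congr (dy (v 0 0) (v 0 j)) => h.
  by rewrite /planar !shiftE eqxx eq_sym (negbTE j0) mulr0 add0r.
apply: is_derive_congr (is_derive_cst (0 : R) (0 : R) (1 : R)) => h.
have [e0 ej] : (0 == i) = false /\ (j == i) = false.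
  by rewrite ![_ == i]eq_sym (negbTE i0) (negbTE ij).
by rewrite /planar /cst !shiftE e0 ej !mulr0 !add0r subrr oppr0.
Qed.

(* Continuity: the Lipschitz bound in x is uniform for y bounded. *)
Lemma tame_planar P : tame P -> continuous (planar P) /\ row_growth (planar P).
Proof.
move=> [cP [C [N [C0 HC]]] [D [m [D0 HD]]]]; split; last first.
  exists C, (N + N)%N; split=> // v h vh; apply: le_trans (HC _ _) _.
  apply: ler_wpM2l => //; rewrite exprD exprMn.
  have e i : (1 + `|v 0 i|) ^+ N <= (1 + h) ^+ N.
    have vih : 1 + `|v 0 i| <= 1 + h by rewrite lerD2l.
    apply: lerXn2r => //; rewrite nnegrE; first exact: weight_ge0.
    exact: le_trans (weight_ge0 (v 0 i)) vih.
  by apply: ler_pM => //; rewrite weight_pow_ge0.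
move=> v.
pose rV := 'rV[R]_n.+1.
have c i : continuous (fun u : rV => u 0 i).
  exact: (moderate_continuous (moderate_coord R 0 i)).
have cc (a : R) : continuous (fun _ : rV => a) by move=> u; exact: cst_continuous.
have w i : continuous (fun u : rV => 1 + `|u 0 i|).
  by move=> u; exact: (cvgD (cc 1 u) (cvg_norm (c i u))).
have cX k : continuous (fun u : rV => ((1 + `|v 0 0|) * (1 + `|u 0 0|) * (1 + `|u 0 j|)) ^+ k).
  elim: k => [|k IH]; first by move=> u; exact: (cc 1 u).
  have -> : (fun u : rV => ((1 + `|v 0 0|) * (1 + `|u 0 0|) * (1 + `|u 0 j|)) ^+ k.+1) =
      (fun u => (1 + `|v 0 0|) * (1 + `|u 0 0|) * (1 + `|u 0 j|)
        * ((1 + `|v 0 0|) * (1 + `|u 0 0|) * (1 + `|u 0 j|)) ^+ k).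
    by apply/funext => u; exact: exprS.
  move=> u.
  exact: (cvgM (cvgM (cvgM (cc (1 + `|v 0 0|) u) (w 0 u)) (w j u)) (IH u)).
have cPu : continuous (fun u : rV => P (v 0 0) (u 0 j)).
  by move=> u; exact: (@continuous_comp rV R R _ (P (v 0 0)) u (c j u) (cP (v 0 0) _)).
pose B (u : rV) := D * ((1 + `|v 0 0|) * (1 + `|u 0 0|) * (1 + `|u 0 j|)) ^+ m
  * `|u 0 0 - v 0 0| + `|P (v 0 0) (u 0 j) - P (v 0 0) (v 0 j)|.
have Bv : B u @[u --> v] --> B v.
  exact: (cvgD (cvgM (cvgM (cc D v) (cX m v)) (cvg_norm (cvgB (c 0 v) (cc (v 0 0) v))))
    (cvg_norm (cvgB (cPu v) (cc (P (v 0 0) (v 0 j)) v)))).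
have Bv0 : B v = 0 by rewrite /B !subrr normr0 mulr0 addr0.
have FF : Filter (nbhs v) := nbhs_filter v.
apply: (@cvgrPdist_le _ _ _ _ FF _ _).2 => e e0.
have := (@cvgrPdist_le _ _ _ _ FF _ _).1 Bv e e0; rewrite Bv0; apply: filterS => u.
rewrite sub0r normrN => Be; rewrite distrC; apply: le_trans Be.
rewrite [leRHS]ger0_norm; last first.
  by rewrite addr_ge0 // !mulr_ge0 // exprn_ge0 // !mulr_ge0 ?weight_ge0.
rewrite /planar; apply: le_trans (_ : `|(P (u 0 0) (u 0 j) - P (v 0 0) (u 0 j))
  + (P (v 0 0) (u 0 j) - P (v 0 0) (v 0 j))| <= _); first by rewrite addrA subrK.
by apply: le_trans (ler_normD _ _) _; apply: lerD => //; exact: HD.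
Qed.

Lemma moderate_planar0 P : tame P -> moderate 0 (planar P).
Proof. by move=> /tame_planar/moderate0. Qed.

Lemma partial_planar P Px Py i :
  (forall x y, is_derive x 1 (fun t => P t y) (Px x y)) ->
  (forall x y, is_derive y 1 (P x) (Py x y)) ->
  partial i (planar P) =
    (if i == 0 then planar Px else if i == j then planar Py else (fun=> 0)).
Proof.
move=> dx dy; apply/funext => v; rewrite /partial.
have [_ ->] := is_derive_planar v i dx dy.
by case: ifP => // _; case: ifP.
Qed.

Lemma moderate_planarS m P Px Py : tame P ->
  (forall x y, is_derive x 1 (fun t => P t y) (Px x y)) ->
  (forall x y, is_derive y 1 (P x) (Py x y)) ->
  moderate m (planar Px) -> moderate m (planar Py) -> moderate m.+1 (planar P).
Proof.
move=> /tame_planar[cP gP] dx dy mx my.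
apply/moderateS; split; [exact: cP| |exact: gP|].
  by move=> v i; have [] := is_derive_planar v i dx dy.
move=> i; rewrite (partial_planar i dx dy).
by case: ifP => // _; case: ifP => // _; exact: moderate_cst.
Qed.

End Planar.

Section Slice.
Variable R : realType.
Implicit Types (f : 'rV[R]_4 -> R) (x y : R).

Lemma rowvec4_shift0 (h x y z t : R) :
  h *: delta_mx 0 0 + rowvec [tuple x; y; z; t] = rowvec [tuple h + x; y; z; t].
Proof. by rowvec_shift. Qed.

Lemma rowvec4_shift1 (h x y z t : R) :
  h *: delta_mx 0 1 + rowvec [tuple x; y; z; t] = rowvec [tuple x; h + y; z; t].
Proof. by rowvec_shift. Qed.

Lemma rowvec4_shift2 (h x y z t : R) :
  h *: delta_mx 0 2 + rowvec [tuple x; y; z; t] = rowvec [tuple x; y; h + z; t].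
Proof. by rowvec_shift. Qed.

Lemma rowvec4_shift3 (h x y z t : R) :
  h *: delta_mx 0 3 + rowvec [tuple x; y; z; t] = rowvec [tuple x; y; z; h + t].
Proof. by rowvec_shift. Qed.

Definition slice f x y := f (rowvec [tuple x; 0; y; 0]).

Lemma is_derive_slice_x f x y : (forall v, derivable f v (delta_mx 0 0)) ->
  is_derive x 1 (fun t => slice f t y) (slice (partial 0 f) x y).
Proof.
move=> df; apply: is_derive_congr (derivableP (df (rowvec [tuple x; 0; y; 0]))) => h.
by rewrite /slice rowvec4_shift0 [h *: 1]mulr1.
Qed.

Lemma is_derive_slice_y f x y : (forall v, derivable f v (delta_mx 0 2)) ->
  is_derive y 1 (slice f x) (slice (partial 2 f) x y).
Proof.
move=> df; apply: is_derive_congr (derivableP (df (rowvec [tuple x; 0; y; 0]))) => h.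
by rewrite /slice rowvec4_shift2 [h *: 1]mulr1.
Qed.

Lemma slice_growth f : row_growth f -> exists (C : R) (N : nat), 0 <= C /\
  forall x y B, 1 + `|x| <= B -> 1 + `|y| <= B -> `|slice f x y| <= C * B ^+ N.
Proof.
move=> [C [N [C0 H]]]; exists C, N; split=> // x y B xB yB.
have -> : B = 1 + (B - 1) by rewrite addrC subrK.
apply: H => i; rewrite rowvecE lerBrDl.
have B1 : 1 + `|0 : R| <= B by rewrite normr0 addr0; exact: le_trans (weight_ge1 x) xB.
by case: i => -[|[|[|[|m]]]] im.
Qed.

Lemma slice_tame f : moderate 1 f -> tame (slice f).
Proof.
move=> mf; have /moderateS[cf df gf pf] := mf; split.
- move=> x; apply: is_derive_continuous => y; apply: is_derive_slice_y => v; exact: df.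
- have [C [N [C0 H]]] := slice_growth gf; exists C, N; split=> // x y; apply: H.
    by rewrite ler_peMr ?weight_ge0 ?weight_ge1.
  by rewrite ler_peMl ?weight_ge0 ?weight_ge1.
- have [C [N [C0 H]]] := slice_growth (moderate_growth (pf 0)).
  exists C, N; split=> // x x' y.
  have [th /andP[t0 t1] ->] := @mean_value R (fun t => slice f t y)
    (fun t => slice (partial 0 f) t y) x x' (fun th _ => is_derive_slice_x _ _ (fun v => df v 0)).
  rewrite normrM; apply: ler_wpM2r => //.
  have xx : 1 <= (1 + `|x|) * (1 + `|x'|) by rewrite -[leLHS]mulr1 ler_pM ?weight_ge1.
  apply: H; last by rewrite ler_peMl ?weight_ge0.
  apply: le_trans (_ : (1 + `|x|) * (1 + `|x'|) <= _); last first.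
    by rewrite ler_peMr ?weight_ge1 // (le_trans ler01).
  have -> : x + th * (x' - x) = (1 - th) * x + th * x' by ring.
  have h1 : `|(1 - th) * x + th * x'| <= `|x| + `|x'|.
    apply: le_trans (ler_normD _ _) _; rewrite !normrM; apply: lerD.
      by rewrite ler_piMl // ger0_norm ?subr_ge0 // gerBl.
    by rewrite ler_piMl // ger0_norm.
  have := mulr_ge0 (normr_ge0 x) (normr_ge0 x').
  by move: h1; move: `|x| `|x'| `|_ + _| => a b c; nra.
Qed.

End Slice.

(** * The kernel of a proper score *)

Section ScoreToKernel.
Variables (R : realType) (s : 'rV[R]_4 -> R) (c : R).
Hypotheses (sm : moderate 4 s)
  (s33 : forall v, partial 3 (partial 3 s) v = 0)
  (fl : forall v, flux s v = 0)
  (s1 : forall v, partial 1 s v = c).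
Implicit Types (x y : R) (v : 'rV[R]_4).

Let S := partial 3 s.
Let b := slice S.
Let bx := slice (partial 0 S).
Let bxx := slice (partial 0 (partial 0 S)).
Let Sm : moderate 3 S. Proof. exact: moderate_partial. Qed.
Let S0m : moderate 2 (partial 0 S). Proof. exact: moderate_partial. Qed.
Let S00m : moderate 1 (partial 0 (partial 0 S)). Proof. exact: moderate_partial. Qed.

Let derivable_moderate m f v i : moderate m.+1 f -> derivable f v (delta_mx 0 i).
Proof. by move=> [cf _]; exact: cont_partials_derivable cf. Qed.

Let b_tame : tame b.
Proof. by apply: slice_tame; exact: (moderateW (isT : (1 <= 3)%N) Sm). Qed.
Let bx_tame : tame bx.
Proof. by apply: slice_tame; exact: (moderateW (isT : (1 <= 2)%N) S0m). Qed.
Let bxx_tame : tame bxx. Proof. exact: slice_tame. Qed.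

Let db x y : is_derive x 1 (fun t => b t y) (bx x y).
Proof. by apply: is_derive_slice_x => v; exact: derivable_moderate Sm. Qed.
Let dbx x y : is_derive x 1 (fun t => bx t y) (bxx x y).
Proof. by apply: is_derive_slice_x => v; exact: derivable_moderate S0m. Qed.

Let F := primitive_y b.
Let Fx := primitive_y bx.
Let Fxx := primitive_y bxx.
Let F_tame : tame F. Proof. exact: primitive_y_tame. Qed.
Let Fx_tame : tame Fx. Proof. exact: primitive_y_tame. Qed.
Let Fxx_tame : tame Fxx. Proof. exact: primitive_y_tame. Qed.
Let dFx x y : is_derive x 1 (fun t => F t y) (Fx x y).
Proof. exact: is_derive_primitive_x. Qed.
Let dFxx x y : is_derive x 1 (fun t => Fx t y) (Fxx x y).
Proof. exact: is_derive_primitive_x. Qed.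
Let dFy x y : is_derive y 1 (F x) (b x y).
Proof. by apply: is_derive_primitive_y; case: b_tame. Qed.
Let dFxy x y : is_derive y 1 (Fx x) (bx x y).
Proof. by apply: is_derive_primitive_y; case: bx_tame. Qed.

Let M := primitive_y F.
Let Mx := primitive_y Fx.
Let dMx x y : is_derive x 1 (fun t => M t y) (Mx x y).
Proof. exact: is_derive_primitive_x. Qed.
Let dMxx x y : is_derive x 1 (fun t => Mx t y) (primitive_y Fxx x y).
Proof. exact: is_derive_primitive_x. Qed.
Let dMy x y : is_derive y 1 (M x) (F x y).
Proof. by apply: is_derive_primitive_y; case: F_tame. Qed.
Let dMxy x y : is_derive y 1 (Mx x) (Fx x y).
Proof. by apply: is_derive_primitive_y; case: Fx_tame. Qed.

Let at0 (f : 'rV[R]_4 -> R) : R -> R -> R := fun x _ => slice f x 0.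
Let dat0x m f x y : moderate m.+1 f ->
  is_derive x 1 (fun t => at0 f t y) (at0 (partial 0 f) x y).
Proof. by move=> mf; apply: is_derive_slice_x => v; exact: derivable_moderate mf. Qed.
Let dat0y f x y : is_derive y 1 (at0 f x) 0.
Proof. exact: is_derive_cst. Qed.
Let at0_tame f : moderate 1 f -> tame (at0 f).
Proof. by move=> mf; apply: tame_slice; exact: slice_tame. Qed.

(** The kernel K_0. Comparing coefficients of y_2 in the score forces its second
    derivative in y to be - s_2, the derivative of the score in y_2 (constant in
    y_0 and y_2); its value at y = 0 can be taken from the score, the first
    derivative there being set to 0. *)
Definition potential x y := slice s x 0 - primitive_y (primitive_y (slice (partial 3 s))) x y.

Let potential_moderate n (j : 'I_n.+1) : j != 0 -> moderate 2 (planar j potential).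
Proof.
move=> j0; have s0m : moderate 3 (partial 0 s) by exact: moderate_partial.
have s00m : moderate 2 (partial 0 (partial 0 s)) by exact: moderate_partial.
have z m : moderate m (planar j (fun _ _ => 0)) by exact: (moderate_cst _ m 0).
have t1 : tame (at0 s) by apply: at0_tame; exact: (moderateW (isT : (1 <= 4)%N) sm).
have t2 : tame (at0 (partial 0 s)) by apply: at0_tame; exact: (moderateW (isT : (1 <= 3)%N) s0m).
have t3 : tame (at0 (partial 0 (partial 0 s))).
  by apply: at0_tame; exact: (moderateW (isT : (1 <= 2)%N) s00m).
have h1 : moderate 2 (planar j (at0 s)).
  apply: (moderate_planarS j0 t1 (fun x y => dat0x x y sm) (@dat0y s)); last exact: z.
  apply: (moderate_planarS j0 t2 (fun x y => dat0x x y s0m) (@dat0y (partial 0 s))); last exact: z.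
  exact: moderate_planar0.
have tM : tame M by exact: primitive_y_tame.
have tMx : tame Mx by exact: primitive_y_tame.
have tMxx : tame (primitive_y Fxx) by exact: primitive_y_tame.
have h2 : moderate 2 (planar j M).
  apply: (moderate_planarS j0 tM dMx dMy).
    apply: (moderate_planarS j0 tMx dMxx dMxy); exact: moderate_planar0.
  by apply: (moderate_planarS j0 F_tame dFx dFy); exact: moderate_planar0.
exact: (moderateB h1 h2).
Qed.

Definition kernel (v : 'rV[R]_3) := c * v 0 1 + planar 2 potential v.

Lemma kernel_kernel_form : kernel_form c (planar 1 potential) kernel.
Proof. by move=> x y0 y1; rewrite /kernel /planar !rowvecE. Qed.

Lemma kernel_classR : classR R 1 kernel.
Proof.
apply: moderate_classR.
exact: (moderateD (moderateM (moderate_cst _ 2 c) (moderate_coord R 2 1)) (potential_moderate _)).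
Qed.

Let partial_potential (i : 'I_2) : partial i (planar 1 potential) =
  (if i == 0 then planar 1 (fun x y => at0 (partial 0 s) x y - Mx x y)
   else planar 1 (fun x y => 0 - F x y)).
Proof.
have dx x y : is_derive x 1 (fun t => potential t y) (at0 (partial 0 s) x y - Mx x y).
  exact: (is_derive_sub (dat0x x y sm) (dMx x y)).
have dy x y : is_derive y 1 (potential x) (0 - F x y).
  exact: (is_derive_sub (dat0y s x y) (dMy x y)).
by have -> := @partial_planar R 1 1 isT _ _ _ i dx dy; case: i => -[|[|]].
Qed.

Let partial_F (i : 'I_2) : partial i (planar 1 (fun x y => 0 - F x y)) =
  (if i == 0 then planar 1 (fun x y => 0 - Fx x y) else planar 1 (fun x y => 0 - b x y)).
Proof.
have dx x y : is_derive x 1 (fun t => 0 - F t y) (0 - Fx x y).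
  exact: (is_derive_sub (is_derive_cst 0 x 1) (dFx x y)).
have dy x y : is_derive y 1 (fun t => 0 - F x t) (0 - b x y).
  exact: (is_derive_sub (is_derive_cst 0 y 1) (dFy x y)).
by have -> := @partial_planar R 1 1 isT _ _ _ i dx dy; case: i => -[|[|]].
Qed.

Let s_affine0 x y0 y1 y2 :
  s (rowvec [tuple x; y0; y1; y2]) = s (rowvec [tuple x; 0; y1; y2]) + c * y0.
Proof.
pose f (t : R) := s (rowvec [tuple x; t; y1; y2]) - c * t.
suff : f y0 = f 0 by rewrite /f mulr0 subr0 => <-; rewrite subrK.
have d (t : R) : is_derive t 1 (fun t : R => s (rowvec [tuple x; t; y1; y2]))
    (partial 1 s (rowvec [tuple x; t; y1; y2])).
  apply: is_derive_congr (derivableP (@derivable_moderate _ _ (rowvec [tuple x; t; y1; y2]) 1 sm)) => h.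
  by rewrite rowvec4_shift1 [h *: 1]mulr1.
apply: is_derive0_eq => t.
apply: is_derive_eq (is_derive_sub (d t) (is_derive_scale c (is_derive_id t 1))) _.
by rewrite s1 mulr1 subrr.
Qed.

Let s_affine2 x y1 y2 : s (rowvec [tuple x; 0; y1; y2]) = slice s x y1 + y2 * b x y1.
Proof.
have d (f : 'rV[R]_4 -> R) m (t : R) : moderate m.+1 f ->
    is_derive t 1 (fun t : R => f (rowvec [tuple x; 0; y1; t]))
    (partial 3 f (rowvec [tuple x; 0; y1; t])).
  move=> mf.
  apply: is_derive_congr (derivableP (@derivable_moderate _ _ (rowvec [tuple x; 0; y1; t]) 3 mf)) => h.
  by rewrite rowvec4_shift3 [h *: 1]mulr1.
have SE t : S (rowvec [tuple x; 0; y1; t]) = b x y1.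
  apply: (is_derive0_eq (f := fun t => S (rowvec [tuple x; 0; y1; t]))) => z.
  by apply: is_derive_eq (d _ _ z Sm) _; exact: s33.
pose f (t : R) := s (rowvec [tuple x; 0; y1; t]) - b x y1 * t.
suff : f y2 = f 0 by rewrite /f mulr0 subr0 /slice => <-; rewrite [y2 * _]mulrC subrK.
apply: is_derive0_eq => t.
apply: is_derive_eq (is_derive_sub (d _ _ t sm) (is_derive_scale (b x y1) (is_derive_id t 1))) _.
by rewrite -/S SE mulr1 subrr.
Qed.

(* At y_2 = 0 the vanishing of the flux reads s_1 = d_x s_2 + y_1 s_2. *)
Let s_slice x y1 : slice s x y1 = slice s x 0 - M x y1 + y1 * F x y1 + Fx x y1.
Proof.
pose f y := slice s x y - (y * F x y - M x y + Fx x y).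
suff : f y1 = f 0.
  rewrite /f /F /M /Fx !primitive_y0; first last.
  - by case: b_tame.
  - by case: F_tame.
  - by case: bx_tame.
  rewrite mul0r subrr addr0 subr0 => <-.
  by move: (slice s x y1) (primitive_y b x y1) (primitive_y _ x y1) (primitive_y _ x y1) =>
    *; ring.
have ds y := is_derive_slice_y x y (fun v => @derivable_moderate _ _ v 2 sm).
apply: is_derive0_eq => y.
apply: is_derive_eq (is_derive_sub (ds y) (is_derive_add (is_derive_sub
  (is_derive_mul (is_derive_id y 1) (dFy x y)) (dMy x y)) (dFxy x y))) _.
have := fl (rowvec [tuple x; 0; y; 0]); rewrite /flux !rowvecE /= -/S.
have -> : partial 1 S = fun=> 0.
  rewrite /S (partialC 1 3 (cont_partialsW (isT : (2 <= 4)%N) sm.1)).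
  have -> : partial 1 s = fun=> c by apply/funext.
  exact: partial_cst.
rewrite mulr0 mul0r !addr0 -/(slice (partial 0 S) x y) -/(slice S x y) -/(slice (partial 2 s) x y).
rewrite -/b -/bx; move: (slice _ x y) (F x y) (bx x y) (b x y) => d e g h E.
by rewrite -[RHS]oppr0 -E; ring.
Qed.

Lemma kernel_score_form : score_form c (planar 1 potential) s.
Proof.
move=> x y0 y1 y2; rewrite s_affine0 s_affine2 s_slice.
rewrite (partial_potential 1) /= (partial_F 0) (partial_F 1) /= /planar !rowvecE /=.
rewrite /potential -/S -/b -/F -/M.
move: (slice s x 0) (F x y1) (Fx x y1) (b x y1) (M x y1) => *; ring.
Qed.

End ScoreToKernel.

(** * Proper scores have concave kernels *)

Section ProperConcave.
Variables (R : realType) (c : R) (K0 : 'rV[R]_2 -> R) (K : 'rV[R]_3 -> R).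
Variable s : 'rV[R]_4 -> R.
Hypotheses (KE : kernel_form c K0 K) (KR : classR R 1 K) (sE : score_form c K0 s).
Implicit Types (p q : R -> R) (t : R).

Let score p q := integralR (fun x => s (log_jet 2 q x) * p x).

Let scoreE p q : classP R p -> classP R q ->
  expected_score (local_score 2 s) p q = (score p q)%:E.
Proof. by move=> Pp Pq; exact: (kernel_expected_score KE KR sE Pp Pq). Qed.

Let score_diag p : classP R p -> Phi 1 K p = score p p.
Proof. by move=> /classPE[ap _]; rewrite /score (integral_score_diag KE KR sE ap). Qed.

Let Phi_mixture p q t : classP R p -> classP R q -> 0 <= t <= 1 ->
  Phi 1 K (mixture t p q) = t * score p (mixture t p q) + (1 - t) * score q (mixture t p q).
Proof.
move=> Pp Pq t01; have Pm := classP_mixture t01 Pp Pq.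
have /classPE[am _] := Pm; have /classPE[ap _] := Pp; have /classPE[aq _] := Pq.
have ip := kernel_score_integrable KE KR sE ap am.
have iq := kernel_score_integrable KE KR sE aq am.
rewrite score_diag // /score -(integralRZ t ip) -(integralRZ (1 - t) iq).
rewrite -(integralRD (integrableRZ t ip) (integrableRZ (1 - t) iq)).
congr (integralR _); apply/funext => x; rewrite [X in _ * X = _]/mixture.
by move: (s _) => *; ring.
Qed.

(** By propriety the expected scores of the mixture under p and q exceed those of
    p and q themselves: Phi is an infimum of functions linear in the density. *)
Lemma proper_concave : proper_score (local_score 2 s) -> concave_on (classP R) (Phi 1 K).
Proof.
move=> pr p q t Pp Pq t01; have Pm := classP_mixture t01 Pp Pq.
have le r : classP R r -> Phi 1 K r <= score r (mixture t p q).
  by move=> Pr; have := pr r _ Pr Pm; rewrite !scoreE // lee_fin score_diag.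
rewrite Phi_mixture //; case/andP: t01 => t0 t1.
by apply: lerD; apply: ler_wpM2l; rewrite ?subr_ge0 //; exact: le.
Qed.

Lemma strictly_proper_strictly_concave :
  strictly_proper_score (local_score 2 s) -> strictly_concave_on (classP R) (Phi 1 K).
Proof.
move=> [pr spr] p q t Pp Pq pq /andP[t0 t1].
have t01 : 0 <= t <= 1 by rewrite !ltW.
have Pm := classP_mixture t01 Pp Pq.
have lt r : classP R r -> mixture t p q <> r -> Phi 1 K r < score r (mixture t p q).
  move=> Pr mr; have := pr r _ Pr Pm; rewrite !scoreE // lee_fin score_diag // => h.
  rewrite lt_neqAle h andbT; apply/eqP => E.
  by apply: mr; apply/(spr r _ Pr Pm); rewrite !scoreE // E.
have mE x : mixture t p q x - p x = (1 - t) * (q x - p x).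
  by rewrite /mixture; move: (p x) (q x) => *; ring.
have mE' x : mixture t p q x - q x = t * (p x - q x).
  by rewrite /mixture; move: (p x) (q x) => *; ring.
rewrite Phi_mixture //; apply: ltrD.
  rewrite ltr_pM2l //; apply: lt => // mp; apply: pq; apply/funext => x.
  have /eqP := mE x; rewrite mp subrr eq_sym mulf_eq0 !subr_eq0.
  by case/orP => /eqP // t1'; move: t1; rewrite t1' ltxx.
rewrite ltr_pM2l ?subr_gt0 //; apply: lt => // mq; apply: pq; apply/funext => x.
have /eqP := mE' x; rewrite mq subrr eq_sym mulf_eq0 subr_eq0.
by case/orP => /eqP // t0'; move: t0; rewrite t0' ltxx.
Qed.

End ProperConcave.

Lemma proper_score_kernel (R : realType) (s : 'rV[R]_4 -> R) : classR R 2 s ->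
  proper_score (local_score 2 s) -> exists (c : R) (K0 : 'rV[R]_2 -> R) (K : 'rV[R]_3 -> R),
  [/\ kernel_form c K0 K, classR R 1 K & score_form c K0 s].
Proof.
move=> /classR_moderate sm pr; have [c [s33 fl s1]] := flux_eq0 sm pr.
exists c, (planar 1 (potential s)), (kernel s c); split.
- exact: kernel_kernel_form.
- exact: kernel_classR.
- exact: kernel_score_form.
Qed.

Theorem theorem3p2 (R : realType) :
  [/\ (* (a) *)
      forall (c : R) (K0 : 'rV[R]_2 -> R) (K : 'rV[R]_3 -> R)
             (s : 'rV[R]_4 -> R),
        kernel_form c K0 K -> classR R 1 K ->
        concave_on (classP R) (Phi 1 K) ->
        score_form c K0 s ->
        represents_local_score 2 s /\ proper_score (local_score 2 s),
      (* (b) *)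
      forall s : 'rV[R]_4 -> R,
        classR R 2 s -> represents_local_score 2 s ->
        proper_score (local_score 2 s) ->
        exists (K : 'rV[R]_3 -> R) (c : R) (K0 : 'rV[R]_2 -> R),
          [/\ classR R 1 K, kernel_form c K0 K,
              concave_on (classP R) (Phi 1 K) & score_form c K0 s],
      (* (c), for (a) *)
      forall (c : R) (K0 : 'rV[R]_2 -> R) (K : 'rV[R]_3 -> R)
             (s : 'rV[R]_4 -> R),
        kernel_form c K0 K -> classR R 1 K ->
        strictly_concave_on (classP R) (Phi 1 K) ->
        score_form c K0 s ->
        represents_local_score 2 s /\
        strictly_proper_score (local_score 2 s)
    & (* (c), for (b) *)
      forall s : 'rV[R]_4 -> R,
        classR R 2 s -> represents_local_score 2 s ->
        strictly_proper_score (local_score 2 s) ->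
        exists (K : 'rV[R]_3 -> R) (c : R) (K0 : 'rV[R]_2 -> R),
          [/\ classR R 1 K, kernel_form c K0 K,
              strictly_concave_on (classP R) (Phi 1 K) &
              score_form c K0 s]].
Proof.
split.
- move=> c K0 K s KE KR cF sE; split; first exact: (kernel_represents KE KR sE).
  exact: (kernel_proper KE KR sE cF).
- move=> s sR _ pr; have [c [K0 [K [KE KR sE]]]] := proper_score_kernel sR pr.
  by exists K, c, K0; split=> //; exact: (proper_concave KE KR sE pr).
- move=> c K0 K s KE KR cF sE; split; first exact: (kernel_represents KE KR sE).
  exact: (kernel_strictly_proper KE KR sE cF).
- move=> s sR _ spr; have [c [K0 [K [KE KR sE]]]] := proper_score_kernel sR spr.1.
  by exists K, c, K0; split=> //; exact: (strictly_proper_strictly_concave KE KR sE spr).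
Qed.
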